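(* Let $N\ge 2$, let $E_{ij}$ be the matrix units of $gl(N)$ over $\mathbb{C}$, let $\xi$ be a formal parameter, and put $H=E_{11}-E_{NN}$ and $\sigma=\frac12\ln(1+2\xi E_{1N})$. Then the element $$\mathcal{F}=\exp\Big\{2\xi\sum_{i=2}^{N-1}E_{1i}\otimes E_{iN}e^{-\sigma}\Big\}\exp\{H\otimes\sigma\}$$ of (the $\xi$-adic completion of) $\mathcal{U}(sl(N))^{\otimes2}[[\xi]]$ satisfies the twist equation $$\mathcal{F}_{12}(\Delta\otimes \mathrm{id})(\mathcal{F})=\mathcal{F}_{23}(\mathrm{id}\otimes\Delta)(\mathcal{F}).$$ Hence it defines a triangular deformation of $\mathcal{U}(sl(N))$: the algebra $\mathcal{U}(sl(N))[[\xi]]$ with the coproduct $\Delta_{\mathcal{F}}(a)=\mathcal{F}\Delta(a)\mathcal{F}^{-1}$ and unchanged counit is a triangular Hopf algebra with universal $R$-matrix $\mathcal{R}=\mathcal{F}_{21}\mathcal{F}^{-1}$.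
   Context: $\Delta$ is the standard cocommutative coproduct of the universal enveloping algebra, $\Delta(Y)=Y\otimes1+1\otimes Y$ for $Y\in sl(N)$. Brackets: $[E_{ik},E_{lm}]=\delta_{kl}E_{im}-\delta_{im}E_{lk}$. Tensor products are completed $\xi$-adically. Subscripts denote tensor factors ($\mathcal{F}_{12}=\mathcal{F}\otimes1$, $\mathcal{F}_{23}=1\otimes\mathcal{F}$), and $\mathcal{F}_{21}=\tau(\mathcal{F})$ with $\tau(f\otimes g)=g\otimes f$. A Hopf algebra with coproduct $\Delta'$ is quasitriangular with universal $R$-matrix $\mathcal{R}$ if $\mathcal{R}$ is invertible, $\mathcal{R}\Delta'(a)\mathcal{R}^{-1}=\tau(\Delta'(a))$ for all $a$, $(\Delta'\otimes \mathrm{id})(\mathcal{R})=\mathcal{R}_{13}\mathcal{R}_{23}$ and $(\mathrm{id}\otimes\Delta')(\mathcal{R})=\mathcal{R}_{13}\mathcal{R}_{12}$; it is triangular if moreover $\mathcal{R}_{21}\mathcal{R}=1$. *)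

(* Defs.v *)
From HB Require Import structures.
From mathcomp Require Import all_boot all_order all_algebra.
From mathcomp Require Import ssrAC ring.
From mathcomp Require Import boolp classical_sets reals complex.

Set Implicit Arguments.
Unset Strict Implicit.
Unset Printing Implicit Defensive.

Import GRing.Theory.
Local Open Scope ring_scope.
Local Open Scope quotient_scope.

Reserved Notation "A \ox B" (at level 40, left associativity).
Reserved Notation "x \oxs y" (at level 40, left associativity).
Reserved Notation "{ 'series' R }" (format "{ 'series'  R }").
Reserved Notation "c %:S" (at level 1, format "c %:S").

HB.mixin Record Lmodule_isLieAlgebra (K : pzRingType) L of GRing.Lmodule K L := {
  lie : L -> L -> L;
  lie_linearl : forall y, linear (lie^~ y);
  lie_linearr : forall x, linear (lie x);
  liexx : forall x, lie x x = 0;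
  lie_jacobi : forall x y z,
    lie x (lie y z) + lie y (lie z x) + lie z (lie x y) = 0
}.

#[short(type="lieAlgType")]
HB.structure Definition LieAlgebra (K : pzRingType) :=
  {L of GRing.Lmodule K L & Lmodule_isLieAlgebra K L}.

Section SpecialLinear.
Variables (K : fieldType) (N : nat).

Definition traceless : {pred 'M[K]_N} := [pred A | \tr A == 0].

Lemma traceless_submod : submod_closed traceless.
Proof.
split=> [|a A B]; rewrite !inE ?mxtrace0 // => /eqP A0 /eqP B0.
by rewrite mxtraceD mxtraceZ A0 B0 mulr0 addr0.
Qed.

HB.instance Definition _ := GRing.isSubmodClosed.Build K 'M[K]_N traceless traceless_submod.

Definition sl := {A : 'M[K]_N | A \in traceless}.
HB.instance Definition _ := SubChoice.on sl.
HB.instance Definition _ := [SubChoice_isSubLmodule of sl by <:].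

Lemma sl_lie_subproof (A B : sl) :
  val A *m val B - val B *m val A \in traceless.
Proof. by rewrite inE linearB /= (mxtrace_mulC (val B)) subrr. Qed.

Definition sl_lie (A B : sl) : sl :=
  Sub (val A *m val B - val B *m val A) (sl_lie_subproof A B).

Lemma sl_lie_linearl B : linear (sl_lie^~ B).
Proof.
move=> a A A'; apply: val_inj; rewrite linearP !SubK /=.
by rewrite mulmxDl mulmxDr -scalemxAl -scalemxAr scalerBr opprD addrACA.
Qed.

Lemma sl_lie_linearr A : linear (sl_lie A).
Proof.
move=> a B B'; apply: val_inj; rewrite linearP !SubK /=.
by rewrite mulmxDl mulmxDr -scalemxAl -scalemxAr scalerBr opprD addrACA.
Qed.

Lemma sl_liexx A : sl_lie A A = 0.
Proof. by apply: val_inj; rewrite raddf0 SubK subrr. Qed.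

Lemma sl_jacobi A B C :
  sl_lie A (sl_lie B C) + sl_lie B (sl_lie C A) + sl_lie C (sl_lie A B) = 0.
Proof.
apply: val_inj; rewrite raddf0 !raddfD /=.
rewrite !(mulmxBl, mulmxBr) !mulmxA.
move: (val A) (val B) (val C) => a b c.
set x1 := a *m b *m c; set x2 := a *m c *m b; set x3 := b *m c *m a.
set x4 := c *m b *m a; set x5 := b *m a *m c; set x6 := c *m a *m b.
move: x1 x2 x3 x4 x5 x6 => x1 x2 x3 x4 x5 x6.
by apply/matrixP=> i j; rewrite !mxE; ring.
Qed.

HB.instance Definition _ := Lmodule_isLieAlgebra.Build K sl
  sl_lie_linearl sl_lie_linearr sl_liexx sl_jacobi.

(* The matrix unit E_ij, with the rows and columns numbered from 1 to N. *)
Definition mxunit (i j : nat) : 'M[K]_N :=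
  \matrix_(a, b) ((a.+1 == i) && (b.+1 == j))%:R.

(* Only used on traceless matrices, see [val_sl_of]. *)
Definition sl_of (A : 'M[K]_N) : sl := insubd (0 : sl) A.

Lemma val_sl_of A : \tr A = 0 -> val (sl_of A) = A.
Proof. by move=> trA; rewrite val_insubd inE trA eqxx. Qed.

Lemma mxtrace_mxunit i j :
  \tr (mxunit i j) = ((0 < i <= N)%N && (i == j))%:R.
Proof.
rewrite /mxtrace; under eq_bigr do rewrite mxE.
have [/andP[i0 iN]|iP] /= := boolP (0 < i <= N)%N; last first.
  rewrite big1 // => a _; case: eqP => //= ai.
  by rewrite -ai ltn_ord in iP.
have iN' : (i.-1 < N)%N by rewrite prednK.
rewrite (bigD1 (Ordinal iN')) //= prednK // eqxx big1 ?addr0 // => a.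
by rewrite -val_eqE /= -eqSS prednK // => /negPf ->.
Qed.

Lemma mxtrace_mxunit_neq i j : i != j -> \tr (mxunit i j) = 0.
Proof. by rewrite mxtrace_mxunit => /negPf ->; rewrite andbF. Qed.

Lemma mxtrace_mxunitB i j : (0 < i <= N)%N -> (0 < j <= N)%N ->
  \tr (mxunit i i - mxunit j j) = 0.
Proof. by move=> iN jN; rewrite raddfB /= !mxtrace_mxunit iN jN !eqxx subrr. Qed.

End SpecialLinear.

Section EnvelopingAlgebra.
Variables (K : fieldType) (L : lieAlgType K).

(* U(L) is presented by generators and relations: associative polynomial
   expressions in elements of L, modulo the least congruence that contains the
   axioms of unital associative K-algebras, the linearity of L -> U(L) and the
   relations [x, y] = x y - y x. *)
Inductive env_expr : Type :=
  | EScal of K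
  | EGen of L
  | EAdd of env_expr & env_expr
  | EMul of env_expr & env_expr.

HB.instance Definition _ := gen_eqMixin env_expr.
HB.instance Definition _ := gen_choiceMixin env_expr.

Inductive env_congr : env_expr -> env_expr -> Prop :=
  | ec_refl x : env_congr x x
  | ec_sym x y : env_congr x y -> env_congr y x
  | ec_trans y x z : env_congr x y -> env_congr y z -> env_congr x z
  | ec_add x x' y y' :
      env_congr x x' -> env_congr y y' -> env_congr (EAdd x y) (EAdd x' y')
  | ec_mul x x' y y' :
      env_congr x x' -> env_congr y y' -> env_congr (EMul x y) (EMul x' y')
  | ec_addA x y z : env_congr (EAdd x (EAdd y z)) (EAdd (EAdd x y) z)
  | ec_addC x y : env_congr (EAdd x y) (EAdd y x)
  | ec_add0 x : env_congr (EAdd (EScal 0) x) x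
  | ec_mulA x y z : env_congr (EMul x (EMul y z)) (EMul (EMul x y) z)
  | ec_mul1 x : env_congr (EMul (EScal 1) x) x
  | ec_mulDl x y z : env_congr (EMul (EAdd x y) z) (EAdd (EMul x z) (EMul y z))
  | ec_mulDr x y z : env_congr (EMul x (EAdd y z)) (EAdd (EMul x y) (EMul x z))
  | ec_scalD a b : env_congr (EScal (a + b)) (EAdd (EScal a) (EScal b))
  | ec_scalM a b : env_congr (EScal (a * b)) (EMul (EScal a) (EScal b))
  | ec_scalC a x : env_congr (EMul (EScal a) x) (EMul x (EScal a))
  | ec_scal0 x : env_congr (EMul (EScal 0) x) (EScal 0)
  | ec_genP a x y :
      env_congr (EGen (a *: x + y)) (EAdd (EMul (EScal a) (EGen x)) (EGen y))
  | ec_lie x y :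
      env_congr (EAdd (EGen (lie x y)) (EMul (EGen y) (EGen x)))
                (EMul (EGen x) (EGen y)).

Definition env_rel : rel env_expr := fun x y => `[< env_congr x y >].

Lemma env_rel_refl : reflexive env_rel.
Proof. by move=> x; apply/asboolP; exact: ec_refl. Qed.
Lemma env_rel_sym : symmetric env_rel.
Proof. by move=> x y; apply/asboolP/asboolP; exact: ec_sym. Qed.
Lemma env_rel_trans : transitive env_rel.
Proof.
by move=> y x z /asboolP xy /asboolP yz; apply/asboolP; exact: ec_trans xy yz.
Qed.

Canonical env_equiv := EquivRel env_rel env_rel_refl env_rel_sym env_rel_trans.

Definition envalg : Type := {eq_quot env_rel}.
HB.instance Definition _ := Choice.on envalg.
HB.instance Definition _ := EqQuotient.on envalg.

Definition env_proj (x : env_expr) : envalg := \pi_envalg x.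

Lemma env_projP x y : env_proj x = env_proj y <-> env_congr x y.
Proof.
split; first by move=> /eqmodP /asboolP.
by move=> xy; apply/eqmodP/asboolP.
Qed.

Lemma env_reprK (x : envalg) : env_proj (repr x) = x. Proof. exact: reprK. Qed.

Lemma env_projK x : env_congr (repr (env_proj x)) x.
Proof. by apply/env_projP; rewrite env_reprK. Qed.

Definition env_zero := env_proj (EScal 0).
Definition env_one := env_proj (EScal 1).
Definition env_add (x y : envalg) := env_proj (EAdd (repr x) (repr y)).
Definition env_mul (x y : envalg) := env_proj (EMul (repr x) (repr y)).
Definition env_opp (x : envalg) := env_proj (EMul (EScal (-1)) (repr x)).
Definition env_scale a (x : envalg) := env_proj (EMul (EScal a) (repr x)).

Let piD x y : env_add (env_proj x) (env_proj y) = env_proj (EAdd x y).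
Proof. by apply/env_projP/ec_add; exact: env_projK. Qed.
Let piM x y : env_mul (env_proj x) (env_proj y) = env_proj (EMul x y).
Proof. by apply/env_projP/ec_mul; exact: env_projK. Qed.
Let piZ a x : env_scale a (env_proj x) = env_proj (EMul (EScal a) x).
Proof. by apply/env_projP/ec_mul; [exact: ec_refl|exact: env_projK]. Qed.

Let piS (P : envalg -> Prop) : (forall x, P (env_proj x)) -> forall x, P x.
Proof. by move=> Pp x; rewrite -[x]env_reprK. Qed.

Lemma env_addA : associative env_add.
Proof.
elim/piS=> x; elim/piS=> y; elim/piS=> z; rewrite !piD.
exact/env_projP/ec_addA.
Qed.
Lemma env_addC : commutative env_add.
Proof. by elim/piS=> x; elim/piS=> y; rewrite !piD; exact/env_projP/ec_addC. Qed.
Lemma env_add0 : left_id env_zero env_add.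
Proof. by elim/piS=> x; rewrite piD; exact/env_projP/ec_add0. Qed.
Lemma env_mulA : associative env_mul.
Proof.
elim/piS=> x; elim/piS=> y; elim/piS=> z; rewrite !piM.
exact/env_projP/ec_mulA.
Qed.
Lemma env_mul1 : left_id env_one env_mul.
Proof. by elim/piS=> x; rewrite piM; exact/env_projP/ec_mul1. Qed.
Lemma env_mulr1 : right_id env_one env_mul.
Proof.
elim/piS=> x; rewrite piM; apply/env_projP.
by apply: ec_trans (ec_mul1 _); apply: ec_sym; exact: ec_scalC.
Qed.
Lemma env_mulDl : left_distributive env_mul env_add.
Proof.
elim/piS=> x; elim/piS=> y; elim/piS=> z; rewrite !(piM, piD).
exact/env_projP/ec_mulDl.
Qed.
Lemma env_mulDr : right_distributive env_mul env_add.
Proof.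
elim/piS=> x; elim/piS=> y; elim/piS=> z; rewrite !(piM, piD).
exact/env_projP/ec_mulDr.
Qed.
Lemma env_scaleE a x : env_scale a x = env_mul (env_proj (EScal a)) x.
Proof. by elim/piS: x => x; rewrite piZ piM. Qed.
Lemma env_scalC a x :
  env_mul (env_proj (EScal a)) x = env_mul x (env_proj (EScal a)).
Proof. by elim/piS: x => x; rewrite !piM; exact/env_projP/ec_scalC. Qed.
Lemma env_scalD a b : env_proj (EScal (a + b)) =
  env_add (env_proj (EScal a)) (env_proj (EScal b)).
Proof. by rewrite piD; exact/env_projP/ec_scalD. Qed.
Lemma env_scalM a b : env_proj (EScal (a * b)) =
  env_mul (env_proj (EScal a)) (env_proj (EScal b)).
Proof. by rewrite piM; exact/env_projP/ec_scalM. Qed.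
Lemma env_addN : left_inverse env_zero env_opp env_add.
Proof.
move=> x; rewrite -[env_opp x]/(env_scale (-1) x) env_scaleE.
rewrite -{2}[x]env_mul1 -env_mulDl -env_scalD addNr.
by elim/piS: x => x; rewrite piM; exact/env_projP/ec_scal0.
Qed.

HB.instance Definition _ :=
  GRing.isZmodule.Build envalg env_addA env_addC env_add0 env_addN.

(* Evaluation of an expression in an algebra; [env_lift f] is the extension of
   [f] to U(L), meaningful when [f] is a Lie morphism (see [env_liftP]). *)
Fixpoint env_eval (A : algType K) (f : L -> A) (x : env_expr) : A :=
  match x with
  | EScal a => a%:A
  | EGen x => f x
  | EAdd x y => env_eval f x + env_eval f y
  | EMul x y => env_eval f x * env_eval f y
  end.

Definition env_lift (A : algType K) (f : L -> A) (x : envalg) : A :=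
  env_eval f (repr x).

Definition lie_morphism (A : algType K) (f : L -> A) :=
  linear f /\ forall x y, f (lie x y) = f x * f y - f y * f x.

Lemma env_eval_congr (A : algType K) (f : L -> A) x y : lie_morphism f ->
  env_congr x y -> env_eval f x = env_eval f y.
Proof.
move=> [flin fM]; elim=> //=.
- by move=> ? ? ? _ -> _ ->.
- by move=> ? ? ? ? _ -> _ ->.
- by move=> ? ? ? ? _ -> _ ->.
- by move=> *; rewrite addrA.
- by move=> *; rewrite addrC.
- by move=> *; rewrite scale0r add0r.
- by move=> *; rewrite mulrA.
- by move=> *; rewrite scale1r mul1r.
- by move=> *; rewrite mulrDl.
- by move=> *; rewrite mulrDr.
- by move=> *; rewrite scalerDl.
- by move=> *; rewrite mulr_algl scalerA.
- by move=> *; rewrite mulr_algl mulr_algr.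
- by move=> *; rewrite scale0r mul0r.
- by move=> *; rewrite mulr_algl flin.
- by move=> *; rewrite fM subrK.
Qed.

Lemma env_lift_proj (A : algType K) (f : L -> A) x : lie_morphism f ->
  env_lift f (env_proj x) = env_eval f x.
Proof. by move=> fL; exact: (env_eval_congr fL (env_projK x)). Qed.

Lemma env_one_neq0 : env_one != env_zero.
Proof.
pose f (x : L) : K^o := 0.
have fL : lie_morphism f.
  by split=> [a x y|x y]; rewrite /f ?scaler0 ?addr0 // mulr0 subrr.
apply/eqP => /(congr1 (env_lift f)); rewrite !env_lift_proj //=.
by rewrite scale0r scale1r => /eqP; rewrite oner_eq0.
Qed.

HB.instance Definition _ := GRing.Zmodule_isNzRing.Build envalg
  env_mulA env_mul1 env_mulr1 env_mulDl env_mulDr env_one_neq0.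

Lemma env_scaleA a b v : env_scale a (env_scale b v) = env_scale (a * b) v.
Proof. by rewrite !env_scaleE env_mulA env_scalM. Qed.
Lemma env_scale1 : left_id 1 env_scale.
Proof. by move=> x; rewrite env_scaleE; exact: mul1r. Qed.
Lemma env_scaleDr : right_distributive env_scale +%R.
Proof. by move=> a x y; rewrite !env_scaleE; exact: mulrDr. Qed.
Lemma env_scaleDl v : {morph env_scale^~ v : a b / a + b}.
Proof. by move=> a b; rewrite !env_scaleE env_scalD; exact: mulrDl. Qed.

HB.instance Definition _ := GRing.Zmodule_isLmodule.Build K envalg
  env_scaleA env_scale1 env_scaleDr env_scaleDl.

Lemma env_scaleAl a (x y : envalg) : a *: (x * y) = (a *: x) * y.
Proof.
rewrite -![a *: _]/(env_scale a _) !env_scaleE.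
exact: (mulrA (env_proj (EScal a) : envalg)).
Qed.
HB.instance Definition _ := GRing.Lmodule_isLalgebra.Build K envalg env_scaleAl.

Lemma env_scaleAr a (x y : envalg) : a *: (x * y) = x * (a *: y).
Proof.
rewrite -![a *: _]/(env_scale a _) !env_scaleE env_scalC.
by rewrite -[env_mul _ _]/(x * y * _) -mulrA; congr (_ * _); rewrite env_scalC.
Qed.
HB.instance Definition _ := GRing.Lalgebra_isAlgebra.Build K envalg env_scaleAr.

Definition env_inj (x : L) : envalg := env_proj (EGen x).

Lemma env_inj_lie_morphism : lie_morphism env_inj.
Proof.
split=> [a x y|x y].
  transitivity (env_add (env_scale a (env_inj x)) (env_inj y)) => //.
  by rewrite /env_inj piZ piD; exact/env_projP/ec_genP.
apply/eqP; rewrite eq_sym subr_eq; apply/eqP.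
transitivity (env_mul (env_inj x) (env_inj y)) => //.
transitivity (env_add (env_inj (lie x y)) (env_mul (env_inj y) (env_inj x))) => //.
by rewrite /env_inj !piM piD; apply/env_projP/ec_sym/ec_lie.
Qed.

Lemma env_algE a : env_proj (EScal a) = a%:A.
Proof.
rewrite -[a%:A]/(env_scale a env_one) env_scaleE.
exact: esym (mulr1 (env_proj (EScal a) : envalg)).
Qed.

Lemma env_ind (P : envalg -> Prop) :
  (forall a, P a%:A) -> (forall x, P (env_inj x)) ->
  (forall x y, P x -> P y -> P (x + y)) ->
  (forall x y, P x -> P y -> P (x * y)) -> forall x, P x.
Proof.
move=> Pa Pi PD PM; elim/piS; elim=> [a|x|x Px y Py|x Px y Py].
- by rewrite env_algE.
- exact: Pi.
- by rewrite -piD; exact: PD.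
- by rewrite -piM; exact: PM.
Qed.

Section Lift.
Variables (A : algType K) (f : L -> A).
Hypothesis fL : lie_morphism f.

Lemma env_lift_inj x : env_lift f (env_inj x) = f x.
Proof. exact: env_lift_proj. Qed.

Lemma env_lift_linear : linear (env_lift f).
Proof.
move=> a; elim/piS=> x; elim/piS=> y; rewrite [LHS](_ : _ =
  env_lift f (env_add (env_scale a (env_proj x)) (env_proj y))) //.
by rewrite piZ piD !env_lift_proj //= mulr_algl.
Qed.

Lemma env_lift_monoid : monoid_morphism (env_lift f).
Proof.
split; first by rewrite -[1]/env_one env_lift_proj //= scale1r.
elim/piS=> x; elim/piS=> y.
transitivity (env_lift f (env_mul (env_proj x) (env_proj y))) => //.
by rewrite piM !env_lift_proj.
Qed.

Lemma env_lift_unique (g : envalg -> A) :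
  linear g -> monoid_morphism g -> (forall x, g (env_inj x) = f x) ->
  g =1 env_lift f.
Proof.
have lin0 (h : envalg -> A) : linear h -> h 0 = 0.
  by move=> hl; have := hl (-1) 0 0; rewrite scaler0 addr0 scaleN1r addNr.
have linZ (h : envalg -> A) a x : linear h -> h (a *: x) = a *: h x.
  by move=> hl; have := hl a x 0; rewrite lin0 // !addr0.
have linD (h : envalg -> A) x y : linear h -> h (x + y) = h x + h y.
  by move=> hl; have := hl 1 x y; rewrite !scale1r.
have fl := env_lift_linear; have [f1 fM] := env_lift_monoid.
move=> gl [g1 gM] gi; elim/env_ind => [a|x|x y gx gy|x y gx gy].
- by rewrite !linZ // g1 f1.
- by rewrite gi env_lift_inj.
- by rewrite !linD // gx gy.
- by rewrite gM fM gx gy.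
Qed.

End Lift.

End EnvelopingAlgebra.

(* Only used to show that 1 \ox 1 != 0. *)
Lemma exists_unital_form (K : fieldType) (A : algType K) :
  exists2 phi : A -> K, (forall a x y, phi (a *: x + y) = a * phi x + phi y) &
    phi 1 = 1.
Proof.
pose sub (S : set A) := forall a x y, S x -> S y -> S (a *: x + y).
pose P (S : set A) := sub S /\ ~ S 1.
have [F FP Ftot|S [[Ssub S1] Smax]] := @Zorn_bigcup A P.
  split=> [a x y [X FX Xx] [Y FY Yy]|[X FX X1]]; last first.
    by have [_] := FP _ FX; apply.
  have [XY|YX] := Ftot _ _ FX FY.
    by exists Y => //; apply: (FP _ FY).1 => //; exact: XY.
  by exists X => //; apply: (FP _ FX).1 => //; exact: YX.
have S0 : S 0.
  apply: contrapT => S0.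
  have SE x : ~ S x.
    by move=> Sx; apply: S0; rewrite -(addNr x) -scaleN1r; exact: Ssub.
  apply: (Smax [set 0]%classic).
    split; first by move=> x /SE.
    by move=> /(_ 0 erefl).
  split; first by move=> a x y /= -> ->; rewrite scaler0 addr0.
  by move=> /= /eqP; rewrite oner_eq0.
have SZ a x : S x -> S (a *: x) by move=> Sx; rewrite -[_ *: _]addr0; exact: Ssub.
have SD x y : S x -> S y -> S (x + y).
  by move=> Sx Sy; rewrite -[x]scale1r; exact: Ssub.
have ex x : exists c : K, S (x - c%:A).
  apply: contrapT => noc.
  have Sx : ~ S x by move=> Sx; apply: noc; exists 0; rewrite scale0r subr0.
  pose T : set A := [set y | exists p c, S p /\ y = p + c *: x]%classic.
  apply: (Smax T).
    split; first by move=> y Sy; exists y, 0; rewrite scale0r addr0.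
    by move=> /(_ x); apply: contra_not (Sx); apply; exists 0, 1; rewrite scale1r add0r.
  split.
    move=> a _ _ [p [c [Sp ->]]] [q [d [Sq ->]]].
    exists (a *: p + q), (a * c + d); split; first exact: Ssub.
    by rewrite scalerDr scalerDl scalerA addrACA.
  move=> [p [c [Sp E]]].
  have c0 : c != 0 by apply/eqP=> c0; move: E; rewrite c0 scale0r addr0 => E; rewrite E in S1.
  apply: noc; exists c^-1; rewrite E scalerDr scalerA mulVf // scale1r.
  by rewrite opprD addrC addrNK -scaleNr; exact: SZ.
have uniq x c d : S (x - c%:A) -> S (x - d%:A) -> c = d.
  move=> Sc /(SZ (-1)); rewrite scaleN1r => Sd.
  have := SD _ _ Sc Sd; rewrite opprB addrC addrA addrNK -scalerBl => Scd.
  apply/eqP; rewrite eq_sym -subr_eq0; apply/eqP; apply: contrapT => /eqP cd.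
  by apply: S1; have := SZ (d - c)^-1 _ Scd; rewrite scalerA mulVf // scale1r.
have [phi Sphi] := choice ex.
exists phi => [a x y|].
  apply: (uniq (a *: x + y)); first exact: Sphi.
  rewrite scalerDl opprD addrACA -scalerA -scalerBr; exact: Ssub.
by apply: (uniq 1); [exact: Sphi|rewrite scale1r subrr].
Qed.

Section Tensor.
Variables (K : fieldType) (A B : algType K).

(* Finite sums of pure tensors, represented as sequences of pairs, modulo the
   least congruence that makes (a, b) |-> a \ox b bilinear. *)
Inductive tens_congr : seq (A * B) -> seq (A * B) -> Prop :=
  | tc_refl s : tens_congr s s
  | tc_sym s t : tens_congr s t -> tens_congr t s
  | tc_trans t s u : tens_congr s t -> tens_congr t u -> tens_congr s u
  | tc_cat s s' t t' :
      tens_congr s s' -> tens_congr t t' -> tens_congr (s ++ t) (s' ++ t')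
  | tc_catC s t : tens_congr (s ++ t) (t ++ s)
  | tc_addl a a' b : tens_congr [:: (a + a', b)] [:: (a, b); (a', b)]
  | tc_addr a b b' : tens_congr [:: (a, b + b')] [:: (a, b); (a, b')]
  | tc_scale c a b : tens_congr [:: (c *: a, b)] [:: (a, c *: b)]
  | tc_zero b : tens_congr [:: (0, b)] [::].

Definition tens_rel : rel (seq (A * B)) := fun s t => `[< tens_congr s t >].

Lemma tens_rel_refl : reflexive tens_rel.
Proof. by move=> x; apply/asboolP; exact: tc_refl. Qed.
Lemma tens_rel_sym : symmetric tens_rel.
Proof. by move=> x y; apply/asboolP/asboolP; exact: tc_sym. Qed.
Lemma tens_rel_trans : transitive tens_rel.
Proof.
by move=> y x z /asboolP xy /asboolP yz; apply/asboolP; exact: tc_trans xy yz.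
Qed.

Canonical tens_equiv :=
  EquivRel tens_rel tens_rel_refl tens_rel_sym tens_rel_trans.

Definition tensor : Type := {eq_quot tens_rel}.
HB.instance Definition _ := Choice.on tensor.
HB.instance Definition _ := EqQuotient.on tensor.

Definition tens_proj (s : seq (A * B)) : tensor := \pi_tensor s.
Definition pure (a : A) (b : B) : tensor := tens_proj [:: (a, b)].

Lemma tens_projP s t : tens_proj s = tens_proj t <-> tens_congr s t.
Proof.
split; first by move=> /eqmodP /asboolP.
by move=> xy; apply/eqmodP/asboolP.
Qed.

Lemma tens_reprK (t : tensor) : tens_proj (repr t) = t.
Proof. exact: reprK. Qed.

Lemma tens_projK s : tens_congr (repr (tens_proj s)) s.
Proof. by apply/tens_projP; rewrite tens_reprK. Qed.

Definition scale_pairs (c : K) (s : seq (A * B)) :=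
  [seq (c *: p.1, p.2) | p <- s].

Definition tens_add (t u : tensor) : tensor := tens_proj (repr t ++ repr u).
Definition tens_scale c (t : tensor) : tensor := tens_proj (scale_pairs c (repr t)).
Definition tens_zero := tens_proj [::].

Lemma scale_pairs_congr c s t :
  tens_congr s t -> tens_congr (scale_pairs c s) (scale_pairs c t).
Proof.
elim=> //=.
- by move=> *; exact: tc_refl.
- by move=> *; exact: tc_sym.
- by move=> y x z _ xy _ yz; exact: tc_trans xy yz.
- by move=> *; rewrite /scale_pairs !map_cat; exact: tc_cat.
- by move=> *; rewrite /scale_pairs !map_cat; exact: tc_catC.
- by move=> *; rewrite scalerDr; exact: tc_addl.
- by move=> *; exact: tc_addr.
- by move=> d *; rewrite scalerA mulrC -scalerA; exact: tc_scale.
- by move=> *; rewrite scaler0; exact: tc_zero.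
Qed.

Let piD s t : tens_add (tens_proj s) (tens_proj t) = tens_proj (s ++ t).
Proof. by apply/tens_projP/tc_cat; exact: tens_projK. Qed.
Let piZ c s : tens_scale c (tens_proj s) = tens_proj (scale_pairs c s).
Proof. by apply/tens_projP/scale_pairs_congr; exact: tens_projK. Qed.
Let piS (P : tensor -> Prop) : (forall s, P (tens_proj s)) -> forall x, P x.
Proof. by move=> Pp x; rewrite -[x]tens_reprK. Qed.

Lemma tens_addA : associative tens_add.
Proof. by elim/piS=> s; elim/piS=> t; elim/piS=> u; rewrite !piD catA. Qed.
Lemma tens_addC : commutative tens_add.
Proof.
by elim/piS=> s; elim/piS=> t; rewrite !piD; exact/tens_projP/tc_catC.
Qed.
Lemma tens_add0 : left_id tens_zero tens_add.
Proof. by elim/piS=> s; rewrite piD. Qed.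

Let pureDl a a' b : pure (a + a') b = tens_add (pure a b) (pure a' b).
Proof. by rewrite piD; exact/tens_projP/tc_addl. Qed.
Let pureDr a b b' : pure a (b + b') = tens_add (pure a b) (pure a b').
Proof. by rewrite piD; exact/tens_projP/tc_addr. Qed.
Let pureZ c a b : pure (c *: a) b = pure a (c *: b).
Proof. exact/tens_projP/tc_scale. Qed.
Let pure0 b : pure 0 b = tens_zero.
Proof. exact/tens_projP/tc_zero. Qed.

Let pi_cons p s : tens_proj (p :: s) = tens_add (pure p.1 p.2) (tens_proj s).
Proof. by rewrite piD /=; case: p. Qed.

Lemma tens_scaleDl t : {morph tens_scale^~ t : a b / a + b >-> tens_add a b}.
Proof.
move=> a b; elim/piS: t => s; rewrite !piZ.
elim: s => [|p s IHs] /=; first by rewrite piD.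
rewrite !pi_cons /= IHs scalerDl pureDl.
rewrite -!tens_addA; congr tens_add; rewrite !tens_addA; congr tens_add.
exact: tens_addC.
Qed.
Lemma tens_scale0 t : tens_scale 0 t = tens_zero.
Proof.
elim/piS: t => s; rewrite piZ; elim: s => //= p s IHs.
by rewrite pi_cons /= scale0r pure0 tens_add0.
Qed.
Lemma tens_scale1 : left_id 1 tens_scale.
Proof.
elim/piS => s; rewrite piZ; elim: s => //= p s IHs.
by rewrite !pi_cons /= IHs scale1r.
Qed.
Lemma tens_scaleA a b t : tens_scale a (tens_scale b t) = tens_scale (a * b) t.
Proof.
elim/piS: t => s; rewrite !piZ; congr tens_proj.
by rewrite /scale_pairs -map_comp; apply: eq_map => p /=; rewrite scalerA.
Qed.
Lemma tens_scaleDr : right_distributive tens_scale tens_add.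
Proof.
by move=> a; elim/piS=> s; elim/piS=> t; rewrite !(piD, piZ) /scale_pairs map_cat.
Qed.

Lemma tens_addN : left_inverse tens_zero (tens_scale (-1)) tens_add.
Proof.
move=> t; rewrite -[X in tens_add _ X]tens_scale1 -tens_scaleDl addNr.
exact: tens_scale0.
Qed.

HB.instance Definition _ :=
  GRing.isZmodule.Build tensor tens_addA tens_addC tens_add0 tens_addN.
HB.instance Definition _ := GRing.Zmodule_isLmodule.Build K tensor
  tens_scaleA tens_scale1 tens_scaleDr tens_scaleDl.

Lemma pure_is_linearl b : linear (pure^~ b).
Proof.
move=> c a a'; rewrite pureDl; congr (_ + _).
by rewrite -[RHS]/(tens_scale _ _) piZ.
Qed.
Lemma pure_is_linearr a : linear (pure a).
Proof.
move=> c b b'; rewrite pureDr; congr (_ + _).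
by rewrite -pureZ -[RHS]/(tens_scale _ _) piZ.
Qed.

Lemma tens_ind (P : tensor -> Prop) :
  P 0 -> (forall a b, P (pure a b)) -> (forall x y, P x -> P y -> P (x + y)) ->
  forall x, P x.
Proof.
move=> P0 Pp PD; elim/piS; elim=> [|p s IHs]; first exact: P0.
by rewrite pi_cons; exact: PD.
Qed.

(* [tens_lift f] is the extension to tensors of a bilinear [f], i.e. the
   additive map such that [a \ox b] is mapped to [f a b]; it is meaningful when
   [f] is [balanced], see [tens_lift_pure]. *)
Definition tens_lift (V : zmodType) (f : A -> B -> V) (t : tensor) : V :=
  \sum_(p <- repr t) f p.1 p.2.

Definition balanced (V : zmodType) (f : A -> B -> V) :=
  [/\ forall a a' b, f (a + a') b = f a b + f a' b,
      forall a b b', f a (b + b') = f a b + f a b' &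
      forall c a b, f (c *: a) b = f a (c *: b)].

Section Lift.
Variables (V : zmodType) (f : A -> B -> V).
Hypothesis fB : balanced f.

Lemma tens_lift_proj s : tens_lift f (tens_proj s) = \sum_(p <- s) f p.1 p.2.
Proof.
case: fB => fDl fDr fZ; rewrite /tens_lift.
suff E u v : tens_congr u v -> \sum_(p <- u) f p.1 p.2 = \sum_(p <- v) f p.1 p.2.
  exact/E/tens_projK.
elim=> //=.
- by move=> ? ? ? _ -> _ ->.
- by move=> ? ? ? ? _ E _ E'; rewrite !big_cat E E'.
- by move=> ? ?; rewrite !big_cat /= addrC.
- by move=> *; rewrite !big_cons !big_nil !addr0 /= fDl.
- by move=> *; rewrite !big_cons !big_nil !addr0 /= fDr.
- by move=> *; rewrite !big_cons !big_nil !addr0 /= fZ.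
- move=> b; rewrite big_cons !big_nil addr0 /=.
  by apply: (addrI (f 0 b)); rewrite -fDl !addr0.
Qed.

Lemma tens_lift_pure a b : tens_lift f (pure a b) = f a b.
Proof. by rewrite tens_lift_proj big_seq1. Qed.

Lemma tens_lift0 : tens_lift f 0 = 0.
Proof. by rewrite -[0 in LHS]/tens_zero tens_lift_proj big_nil. Qed.

Lemma tens_liftD : {morph tens_lift f : x y / x + y}.
Proof.
elim/piS=> s; elim/piS=> t.
transitivity (tens_lift f (tens_add (tens_proj s) (tens_proj t))) => //.
by rewrite piD !tens_lift_proj big_cat.
Qed.
End Lift.

Lemma tens_liftZ (V : lmodType K) (f : A -> B -> V) :
  (forall b, linear (f^~ b)) -> (forall a, linear (f a)) ->
  balanced f /\ linear (tens_lift f).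
Proof.
move=> fl fr.
have fDl a a' b : f (a + a') b = f a b + f a' b.
  by have := fl b 1 a a'; rewrite !scale1r.
have fDr a b b' : f a (b + b') = f a b + f a b'.
  by have := fr a 1 b b'; rewrite !scale1r.
have f0l b : f 0 b = 0 by apply: (addrI (f 0 b)); rewrite -fDl !addr0.
have f0r a : f a 0 = 0 by apply: (addrI (f a 0)); rewrite -fDr !addr0.
have fZl c a b : f (c *: a) b = c *: f a b.
  by have := fl b c a 0; rewrite f0l !addr0.
have fZr c a b : f a (c *: b) = c *: f a b.
  by have := fr a c b 0; rewrite f0r !addr0.
have fB : balanced f by split=> // c a b; rewrite fZl fZr.
split=> // c x y; rewrite tens_liftD //; congr (_ + _).
elim/piS: x => s.
transitivity (tens_lift f (tens_scale c (tens_proj s))) => //.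
rewrite piZ !tens_lift_proj // big_map scaler_sumr.
by apply: eq_bigr => p _ /=.
Qed.

Definition tens_one : tensor := pure 1 1.
Definition tens_mul (t u : tensor) : tensor :=
  tens_lift (fun a b => tens_lift (fun a' b' => pure (a * a') (b * b')) u) t.

Let mul_pure_lin a b :
  let f a' b' := pure (a * a') (b * b') in
  (forall b, linear (f^~ b)) /\ (forall a, linear (f a)).
Proof.
split=> [b' c x y|a' c x y] /=.
  by rewrite mulrDr -scalerAr pure_is_linearl.
by rewrite mulrDr -scalerAr pure_is_linearr.
Qed.

Let mul_pureB a b : balanced (fun a' b' => pure (a * a') (b * b')).
Proof. by have [? ?] := mul_pure_lin a b; case: (tens_liftZ (f := fun a' b' => pure (a * a') (b * b'))). Qed.

Let mulB u : balanced (fun a b => tens_lift (fun a' b' => pure (a * a') (b * b')) u).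
Proof.
split=> [a a' b|a b b'|c a b].
- elim/tens_ind: u => [|x y|x y IHx IHy].
  + by rewrite !tens_lift0 // addr0.
  + by rewrite !tens_lift_pure // mulrDl; exact: pureDl.
  + by rewrite !tens_liftD // IHx IHy addrACA.
- elim/tens_ind: u => [|x y|x y IHx IHy].
  + by rewrite !tens_lift0 // addr0.
  + by rewrite !tens_lift_pure // mulrDl; exact: pureDr.
  + by rewrite !tens_liftD // IHx IHy addrACA.
- elim/tens_ind: u => [|x y|x y IHx IHy].
  + by rewrite !tens_lift0.
  + by rewrite !tens_lift_pure // -!scalerAl pureZ.
  + by rewrite !tens_liftD // IHx IHy.
Qed.

Lemma tens_mul_pure a b a' b' :
  tens_mul (pure a b) (pure a' b') = pure (a * a') (b * b').
Proof. by rewrite /tens_mul !tens_lift_pure. Qed.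

Lemma tens_mulDl : left_distributive tens_mul +%R.
Proof. by move=> x y z; rewrite /tens_mul tens_liftD. Qed.
Lemma tens_mul0r x : tens_mul 0 x = 0.
Proof. by rewrite /tens_mul tens_lift0. Qed.
Lemma tens_mulDr : right_distributive tens_mul +%R.
Proof.
move=> x y z; elim/tens_ind: x => [|a b|x x' IH IH'].
- by rewrite !tens_mul0r addr0.
- by rewrite /tens_mul !tens_lift_pure // tens_liftD.
- by rewrite !tens_mulDl IH IH' addrACA.
Qed.
Lemma tens_mulr0 x : tens_mul x 0 = 0.
Proof. by apply: (addrI (tens_mul x 0)); rewrite -tens_mulDr !addr0. Qed.
Lemma tens_mulA : associative tens_mul.
Proof.
elim/tens_ind=> [||x x' IH IH'].
- by move=> y z; rewrite !tens_mul0r.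
- move=> a b; elim/tens_ind=> [|a' b'|y y' IH IH'].
  + by move=> z; rewrite tens_mul0r !tens_mulr0 tens_mul0r.
  + elim/tens_ind=> [|a'' b''|z z' IH IH'].
    * by rewrite !tens_mulr0.
    * by rewrite !tens_mul_pure !mulrA.
    * by rewrite !tens_mulDr IH IH'.
  + by move=> z; rewrite tens_mulDr !tens_mulDl tens_mulDr IH IH'.
- by move=> y z; rewrite !tens_mulDl IH IH'.
Qed.
Lemma tens_mul1 : left_id tens_one tens_mul.
Proof.
elim/tens_ind=> [|a b|x x' IH IH']; first by rewrite tens_mulr0.
  by rewrite tens_mul_pure !mul1r.
by rewrite tens_mulDr IH IH'.
Qed.
Lemma tens_mulr1 : right_id tens_one tens_mul.
Proof.
elim/tens_ind=> [|a b|x x' IH IH']; first by rewrite tens_mul0r.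
  by rewrite tens_mul_pure !mulr1.
by rewrite tens_mulDl IH IH'.
Qed.
Lemma tens_one_neq0 : tens_one != 0.
Proof.
have [phi phiP phi1] := exists_unital_form A.
have [psi psiP psi1] := exists_unital_form B.
pose f a b : K^o := phi a * psi b.
have [||fB _] := @tens_liftZ K^o f.
- by move=> b c a a'; rewrite /f phiP mulrDl -mulrA.
- by move=> a c b b'; rewrite /f psiP mulrDr mulrCA.
apply/eqP => /(congr1 (tens_lift f)); rewrite tens_lift_pure // tens_lift0 //.
by rewrite /f phi1 psi1 mulr1 => /eqP; rewrite oner_eq0.
Qed.

HB.instance Definition _ := GRing.Zmodule_isNzRing.Build tensor
  tens_mulA tens_mul1 tens_mulr1 tens_mulDl tens_mulDr tens_one_neq0.

Lemma tens_scaleAl c (x y : tensor) : c *: (x * y) = (c *: x) * y.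
Proof.
elim/tens_ind: x => [|a b|x x' IH IH'].
- by rewrite mul0r !scaler0 mul0r.
- elim/tens_ind: y => [|a' b'|y y' IH IH']; first by rewrite !mulr0 scaler0.
    have Z a0 b0 : c *: pure a0 b0 = pure (c *: a0) b0.
      by rewrite -[LHS]/(tens_scale _ _) piZ.
    rewrite Z; rewrite -![_ * _]/(tens_mul _ _) !tens_mul_pure Z.
    by rewrite scalerAl.
  by rewrite !mulrDr scalerDr IH IH'.
- by rewrite mulrDl !scalerDr mulrDl IH IH'.
Qed.
HB.instance Definition _ := GRing.Lmodule_isLalgebra.Build K tensor tens_scaleAl.

Lemma tens_scaleAr c (x y : tensor) : c *: (x * y) = x * (c *: y).
Proof.
elim/tens_ind: x => [|a b|x x' IH IH'].
- by rewrite !mul0r scaler0.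
- elim/tens_ind: y => [|a' b'|y y' IH IH']; first by rewrite !(mulr0, scaler0).
    have Z a0 b0 : c *: pure a0 b0 = pure (c *: a0) b0.
      by rewrite -[LHS]/(tens_scale _ _) piZ.
    rewrite Z; rewrite -![_ * _]/(tens_mul _ _) !tens_mul_pure Z.
    by rewrite scalerAr.
  by rewrite !(mulrDr, scalerDr) IH IH'.
- by rewrite !mulrDl scalerDr IH IH'.
Qed.
HB.instance Definition _ := GRing.Lalgebra_isAlgebra.Build K tensor tens_scaleAr.

End Tensor.

Arguments tensor {K} (A B)%_type.
Notation "A \ox B" := (tensor A B) : type_scope.
Notation "a \ox b" := (pure a b) : ring_scope.

(* [x : {series R}] is the series of general term [x n * xi ^ n]. *)
Definition series (R : Type) : Type := nat -> R.
Notation "{ 'series' R }" := (series R) : type_scope.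

HB.instance Definition _ (R : Type) := gen_eqMixin {series R}.
HB.instance Definition _ (R : Type) := gen_choiceMixin {series R}.

Section SeriesZmodule.
Variable R : zmodType.

Definition ser_cst (c : R) : {series R} := fun n => if n == 0%N then c else 0.
Definition ser_zero : {series R} := fun=> 0.
Definition ser_opp (x : {series R}) : {series R} := fun n => - x n.
Definition ser_add (x y : {series R}) : {series R} := fun n => x n + y n.

Lemma ser_addA : associative ser_add.
Proof. by move=> x y z; apply/funext=> n; exact: addrA. Qed.
Lemma ser_addC : commutative ser_add.
Proof. by move=> x y; apply/funext=> n; exact: addrC. Qed.
Lemma ser_add0 : left_id ser_zero ser_add.
Proof. by move=> x; apply/funext=> n; exact: add0r. Qed.
Lemma ser_addN : left_inverse ser_zero ser_opp ser_add.
Proof. by move=> x; apply/funext=> n; exact: addNr. Qed.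

HB.instance Definition _ :=
  GRing.isZmodule.Build {series R} ser_addA ser_addC ser_add0 ser_addN.
End SeriesZmodule.

Notation "c %:S" := (ser_cst c) : ring_scope.

Section SeriesRing.
Variable R : nzRingType.
Implicit Types x y z : {series R}.

Definition ser_mul x y : {series R} := fun n => \sum_(i < n.+1) x i * y (n - i)%N.

Let trunc n x : {poly R} := \poly_(i < n.+1) x i.

Let coef_trunc n x i : (i <= n)%N -> (trunc n x)`_i = x i.
Proof. by rewrite coef_poly ltnS => ->. Qed.

Let mul_trunc n x y i : (i <= n)%N ->
  ser_mul x y i = (trunc n x * trunc n y)`_i.
Proof.
move=> le_in; rewrite coefM; apply: eq_bigr => j _.
rewrite !coef_trunc ?(leq_trans (leq_subr _ _)) //.
by rewrite (leq_trans _ le_in) // -ltnS.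
Qed.

Let coefM_trunc n (p p' q q' : {poly R}) :
  (forall i, (i <= n)%N -> p`_i = p'`_i) -> (forall i, (i <= n)%N -> q`_i = q'`_i) ->
  (p * q)`_n = (p' * q')`_n.
Proof.
move=> Ep Eq; rewrite !coefM; apply: eq_bigr => j _.
by rewrite Ep ?Eq ?leq_subr // -ltnS.
Qed.

Lemma ser_mulA : associative ser_mul.
Proof.
move=> x y z; apply/funext=> n; rewrite !(@mul_trunc n) //.
transitivity ((trunc n x * (trunc n y * trunc n z))`_n).
  by apply: coefM_trunc => // i le_in; rewrite coef_trunc // (@mul_trunc n).
rewrite mulrA; apply: coefM_trunc => // i le_in.
by rewrite coef_trunc // (@mul_trunc n).
Qed.
Lemma ser_mul1 : left_id (1%:S) ser_mul.
Proof.
move=> x; apply/funext=> n; rewrite /ser_mul big_ord_recl /= mul1r subn0.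
by rewrite big1 ?addr0 // => i _; rewrite mul0r.
Qed.
Lemma ser_mulr1 : right_id (1%:S) ser_mul.
Proof.
move=> x; apply/funext=> n; rewrite /ser_mul big_ord_recr /= subnn mulr1.
rewrite big1 ?add0r // => i _; rewrite /ser_cst subn_eq0 leqNgt ltn_ord /=.
by rewrite mulr0.
Qed.
Lemma ser_mulDl : left_distributive ser_mul +%R.
Proof.
move=> x y z; apply/funext=> n; rewrite /ser_mul -[RHS]big_split /=.
by apply: eq_bigr => i _; exact: mulrDl.
Qed.
Lemma ser_mulDr : right_distributive ser_mul +%R.
Proof.
move=> x y z; apply/funext=> n; rewrite /ser_mul -[RHS]big_split /=.
by apply: eq_bigr => i _; exact: mulrDr.
Qed.
Lemma ser_one_neq0 : (1%:S : {series R}) != 0.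
Proof. by apply/eqP => /(congr1 (fun x => x 0%N)) /eqP; rewrite oner_eq0. Qed.

HB.instance Definition _ := GRing.Zmodule_isNzRing.Build {series R}
  ser_mulA ser_mul1 ser_mulr1 ser_mulDl ser_mulDr ser_one_neq0.

(* [x^-1] is the two-sided inverse of [x] if there is one, and [x] otherwise. *)
Definition ser_unit : pred {series R} :=
  fun x => `[< exists y, y * x = 1 /\ x * y = 1 >].
Definition ser_inv x : {series R} :=
  if pselect (exists y, y * x = 1 /\ x * y = 1) is left ex then projT1 (cid ex)
  else x.

Lemma ser_mulVx : {in ser_unit, left_inverse 1 ser_inv *%R}.
Proof.
move=> x; rewrite unfold_in => /asboolP ex; rewrite /ser_inv.
by case: pselect => // ex'; case: cid => y /= [].
Qed.
Lemma ser_mulxV : {in ser_unit, right_inverse 1 ser_inv *%R}.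
Proof.
move=> x; rewrite unfold_in => /asboolP ex; rewrite /ser_inv.
by case: pselect => // ex'; case: cid => y /= [].
Qed.
Lemma ser_unitP x y : y * x = 1 /\ x * y = 1 -> ser_unit x.
Proof. by move=> xy; apply/asboolP; exists y. Qed.
Lemma ser_inv_out : {in [predC ser_unit], ser_inv =1 id}.
Proof.
move=> x; rewrite !inE unfold_in => /asboolPn ex; rewrite /ser_inv.
by case: pselect.
Qed.

HB.instance Definition _ := GRing.NzRing_hasMulInverse.Build {series R}
  ser_mulVx ser_mulxV ser_unitP ser_inv_out.

Definition ser_xi : {series R} := fun n => (n == 1%N)%:R.

Lemma ser_coefM x y n : (x * y) n = \sum_(i < n.+1) x i * y (n - i)%N.
Proof. by []. Qed.

End SeriesRing.

Arguments ser_xi {R}.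

Lemma ser_mulC (R : comNzRingType) : commutative (@ser_mul R).
Proof.
move=> x y; apply/funext=> n; rewrite /ser_mul (reindex_inj rev_ord_inj) /=.
by apply: eq_bigr => i _; rewrite subSS mulrC subKn // -ltnS.
Qed.

HB.instance Definition _ (R : comNzRingType) :=
  GRing.PzRing_hasCommutativeMul.Build {series R} (@ser_mulC R).

Section SeriesAlgebra.
Variables (K : fieldType) (A : algType K).
Implicit Types (c d : {series K}) (x y : {series A}).

Definition ser_scale c x : {series A} :=
  fun n => \sum_(i < n.+1) c i *: x (n - i)%N.

Let inA c : {series A} := fun n => (c n)%:A.

Let scaleE c x : ser_scale c x = inA c * x.
Proof. by apply/funext=> n; apply: eq_bigr => i _; rewrite mulr_algl. Qed.
Let inAM c d : inA (c * d) = inA c * inA d.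
Proof.
apply/funext=> n; rewrite /inA !ser_coefM scaler_suml.
by apply: eq_bigr => i _; rewrite mulr_algl scalerA.
Qed.
Let inAD c d : inA (c + d) = inA c + inA d.
Proof. by apply/funext=> n; exact: scalerDl. Qed.
Let inA1 : inA 1 = 1.
Proof.
apply/funext=> n; rewrite /inA -[LHS]/((ser_cst (1 : K) n)%:A) -[RHS]/(ser_cst 1 n).
by rewrite /ser_cst; case: eqP; rewrite ?scale1r ?scale0r.
Qed.
Let inAC c x : inA c * x = x * inA c.
Proof.
apply/funext=> n; rewrite !ser_coefM (reindex_inj rev_ord_inj) /=.
apply: eq_bigr => i _; rewrite subSS subKn; last by rewrite -ltnS.
by rewrite mulr_algl mulr_algr.
Qed.

Lemma ser_scaleA c d x : ser_scale c (ser_scale d x) = ser_scale (c * d) x.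
Proof. by rewrite !scaleE inAM mulrA. Qed.
Lemma ser_scale1 : left_id 1 ser_scale.
Proof. by move=> x; rewrite scaleE inA1 mul1r. Qed.
Lemma ser_scaleDr : right_distributive ser_scale +%R.
Proof. by move=> c x y; rewrite !scaleE mulrDr. Qed.
Lemma ser_scaleDl x : {morph ser_scale^~ x : c d / c + d}.
Proof. by move=> c d; rewrite !scaleE inAD mulrDl. Qed.

HB.instance Definition _ := GRing.Zmodule_isLmodule.Build {series K} {series A}
  ser_scaleA ser_scale1 ser_scaleDr ser_scaleDl.

Lemma ser_scaleAl c x y : c *: (x * y) = (c *: x) * y.
Proof.
by rewrite -[LHS]/(ser_scale _ _) -[c *: x]/(ser_scale _ _) !scaleE mulrA.
Qed.
HB.instance Definition _ :=
  GRing.Lmodule_isLalgebra.Build {series K} {series A} ser_scaleAl.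

Lemma ser_scaleAr c x y : c *: (x * y) = x * (c *: y).
Proof.
rewrite -[LHS]/(ser_scale _ _) -[c *: y]/(ser_scale _ _) !scaleE.
by rewrite mulrA inAC -mulrA.
Qed.
HB.instance Definition _ :=
  GRing.Lalgebra_isAlgebra.Build {series K} {series A} ser_scaleAr.

(* The xi-adic sum of the [u k], for [u k] divisible by [xi ^ k]. *)
Definition ser_sum (u : nat -> {series A}) : {series A} :=
  fun n => \sum_(k < n.+1) u k n.

(* Exponential of a series with constant term 0. *)
Definition ser_exp x : {series A} :=
  ser_sum (fun k => (k`!%:R^-1)%:S *: x ^+ k).

(* Logarithm of a series with constant term 1. The term of index 0 vanishes
   since [0%:R^-1 = 0]. *)
Definition ser_ln x : {series A} :=
  ser_sum (fun k => ((-1) ^+ k.+1 * k%:R^-1)%:S *: (x - 1) ^+ k).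

End SeriesAlgebra.

(* Coefficientwise extension to series of a linear map. *)
Definition ser_map (V W : Type) (f : V -> W) (x : {series V}) : {series W} :=
  fun n => f (x n).

(* The xi-adic completion of A[[xi]] (x) B[[xi]] is (A \ox B)[[xi]]. *)
Section CompletedTensor.
Variables (K : fieldType) (A B : algType K).

Definition ser_pure (x : {series A}) (y : {series B}) : {series A \ox B} :=
  fun n => \sum_(i < n.+1) x i \ox y (n - i)%N.

(* The continuous extension of a K[[xi]]-bilinear map [f] to the completed
   tensor product. *)
Definition ser_lift (V : zmodType) (f : {series A} -> {series B} -> {series V})
    (t : {series A \ox B}) : {series V} :=
  fun n => \sum_(i < n.+1)
    tens_lift (fun a b => f a%:S b%:S) (t i) (n - i)%N.

Definition flip : A \ox B -> B \ox A := tens_lift (fun a b => b \ox a).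

End CompletedTensor.

Notation "x \oxs y" := (ser_pure x y) : ring_scope.

(* [f (x) g], for K[[xi]]-linear maps [f] and [g]. *)
Definition ser_tens (K : fieldType) (A B C D : algType K)
    (f : {series A} -> {series C}) (g : {series B} -> {series D}) :
    {series A \ox B} -> {series C \ox D} :=
  ser_lift (fun x y => f x \oxs g y).

(* A (x) A (x) A is represented by (A \ox A) \ox A. *)
Definition assoc (K : fieldType) (A B C : algType K) :
    A \ox (B \ox C) -> A \ox B \ox C :=
  tens_lift (fun a => tens_lift (fun b c => a \ox b \ox c)).

Section Legs.
Variables (K : fieldType) (A : algType K).
Let A2 : Type := A \ox A.
Let A3 : Type := A \ox A \ox A.

Definition leg21 : {series A2} -> {series A2} := ser_map (@flip K A A).
Definition leg12 : {series A2} -> {series A3} :=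
  ser_map (tens_lift (fun a b : A => a \ox b \ox (1 : A))).
Definition leg13 : {series A2} -> {series A3} :=
  ser_map (tens_lift (fun a b : A => a \ox (1 : A) \ox b)).
Definition leg23 : {series A2} -> {series A3} :=
  ser_map (tens_lift (fun a b : A => (1 : A) \ox a \ox b)).

Variables (Delta : {series A} -> {series A \ox A}).

Definition coprod_id : {series A2} -> {series A3} := ser_tens Delta id.
Definition id_coprod (t : {series A2}) : {series A3} :=
  ser_map (@assoc K A A A) (ser_tens id Delta t).

(* Hopf algebra structure on the K[[xi]]-algebra A[[xi]], with completed tensor
   products. The antipode is determined by the other data. *)
Definition is_antipode (eps : {series A} -> {series K^o})
    (S : {series A} -> {series A}) : Prop :=
  linear S /\
  forall x, ser_lift (fun y z => S y * z) (Delta x) = (eps x : {series K})%:A /\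
            ser_lift (fun y z => y * S z) (Delta x) = (eps x : {series K})%:A.

Record hopf_algebra (eps : {series A} -> {series K^o}) : Prop := HopfAlgebra {
  coprod_linear : linear Delta;
  coprod_monoid : monoid_morphism Delta;
  counit_linear : linear eps;
  counit_monoid : monoid_morphism eps;
  coprodA : forall x, coprod_id (Delta x) = id_coprod (Delta x);
  counitl : forall x,
    ser_lift (fun y z => (eps y : {series K}) *: z) (Delta x) = x;
  counitr : forall x,
    ser_lift (fun y z => (eps z : {series K}) *: y) (Delta x) = x;
  antipode : exists S, is_antipode eps S
}.

Record quasitriangular (R : {series A \ox A}) : Prop := Quasitriangular {
  Rmx_unit : R \is a GRing.unit;
  Rmx_conj : forall x, R * Delta x * R^-1 = leg21 (Delta x);
  Rmx_coprod_id : coprod_id R = leg13 R * leg23 R;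
  Rmx_id_coprod : id_coprod R = leg13 R * leg12 R
}.

Definition triangular (R : {series A \ox A}) : Prop :=
  quasitriangular R /\ leg21 R * R = 1.

Definition twist_equation (F : {series A \ox A}) : Prop :=
  leg12 F * coprod_id F = leg23 F * id_coprod F.

Definition twisted_coprod (F : {series A \ox A}) (x : {series A}) :
    {series A \ox A} := F * Delta x * F^-1.

End Legs.

Section EnvelopingHopf.
Variables (K : fieldType) (L : lieAlgType K).

Definition env_coprod : envalg L -> envalg L \ox envalg L :=
  env_lift (fun y : L => env_inj y \ox 1 + 1 \ox env_inj y).
Definition env_counit : envalg L -> K^o := env_lift (fun _ : L => 0 : K^o).

Lemma env_coprod_lie_morphism :
  lie_morphism (fun y : L => env_inj y \ox 1 + 1 \ox env_inj y).
Proof.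
have [il iM] := env_inj_lie_morphism L.
split=> [a x y|x y].
  by rewrite il pure_is_linearl pure_is_linearr scalerDr addrACA.
have pM (a b c d : envalg L) : (a \ox b) * (c \ox d) = (a * c) \ox (b * d).
  exact: tens_mul_pure.
rewrite !mulrDl !mulrDr !pM !mulr1 !mul1r iM.
have -> (u v : envalg L) : (u - v) \ox (1 : envalg L) = u \ox 1 - v \ox 1.
  by rewrite addrC -scaleN1r pure_is_linearl scaleN1r addrC.
have -> (u v : envalg L) : (1 : envalg L) \ox (u - v) = 1 \ox u - 1 \ox v.
  by rewrite addrC -scaleN1r pure_is_linearr scaleN1r addrC.
apply/eqP; rewrite eq_sym subr_eq; apply/eqP.
by rewrite [RHS](AC (2*2*(2*2)) (1*7*(6*3)*(5*2)*(8*4))) /= !subrr !addr0.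
Qed.

Lemma env_counit_lie_morphism : lie_morphism (fun _ : L => 0 : K^o).
Proof. by split=> [a x y|x y]; rewrite ?scaler0 ?addr0 // mulr0 subrr. Qed.

End EnvelopingHopf.

Section JordanianTwist.
Variables (K : fieldType) (N : nat).

Definition usl : algType K := envalg (sl K N).
Let U := usl.
Let xi : {series K} := ser_xi.

Definition Emx (i j : nat) : U := env_inj (sl_of (mxunit K N i j)).
Definition Hmx : U := env_inj (sl_of (mxunit K N 1 1 - mxunit K N N N)).

Definition sigma : {series U} :=
  (2^-1)%:S *: ser_ln (1 + (2 * xi) *: (Emx 1 N)%:S).

Definition jordanian_twist : {series U \ox U} :=
  ser_exp ((2 * xi) *:
    \sum_(2 <= i < N) (Emx 1 i)%:S \oxs ((Emx i N)%:S * ser_exp (- sigma)))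
  * ser_exp (Hmx%:S \oxs sigma).

End JordanianTwist.

(* Main.v *)
Require Import Defs.
From HB Require Import structures.
From mathcomp Require Import all_boot all_order all_algebra.
From mathcomp Require Import zify.
From mathcomp Require Import boolp reals complex.

(* Write F = E Phi with Phi = exp(H (x) sigma) and E = exp(2 xi sum_i X_i (x) y_i),
   where X_i = E_1i, Y_i = E_iN, Z = E_1N and y_i = Y_i e^-sigma. Conjugation by
   Phi maps x (x) 1 to x (x) e^(k sigma) when [H, x] = k x, so Phi Delta(e^(2 sigma)) Phi^-1 is
   e^(2 sigma) (x) e^(2 sigma), whence Phi Delta(sigma) Phi^-1 = sigma (x) 1 + 1 (x) sigma and Phi is
   a twist. Pushing Phi to the right on both sides, the twist equation of F
   becomes e^A e^(B + C) = e^C e^(A + D) with, up to the factor 2 xi,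
     A = sum_i X_i (x) y_i (x) 1,   B = sum_i X_i (x) e^sigma (x) y_i,
     C = sum_i 1 (x) X_i (x) y_i,   D = sum_i X_i (x) e^-sigma (x) y_i,
   which holds because [A, C] = D - B commutes with A and C.

   For any twist F of a cocommutative Hopf algebra with coproduct Delta and
   antipode S, the new antipode is S_F(a) = u S(a) v with u = m(id (x) S)(F) and
   v = m(S (x) id)(F^-1); the twist equation gives u v = 1 after applying
   a (x) b (x) c |-> a S(b) c to F_23^-1 F_12 = (id (x) Delta)(F) (Delta (x) id)(F^-1). The
   hexagon identities of R = F_21 F^-1 come from the images of the twist equation
   under permutations of the legs. *)

Set Implicit Arguments.
Unset Strict Implicit.
Unset Printing Implicit Defensive.

Import GRing.Theory.
Local Open Scope ring_scope.

(** * Convolution of series *)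

(** The constants of the twist are tied together. With W = 1 + 2 xi Z, the half in sigma gives e^(2
    sigma) = W, which matches the weight 2 of Z under ad H: Phi Delta(W) Phi^-1 = 1 + 2 xi (Z (x) W
    + 1 (x) Z) = W (x) W. The factor e^-sigma in y_i compensates the weight 1 of Y_i, so that Phi
    Delta(y_i) Phi^-1 = y_i (x) 1 + e^-sigma (x) y_i. Finally [y_i, X_j] = - delta_ij Z e^-sigma,
    and 2 xi Z e^-sigma = (W - 1) e^-sigma = e^sigma - e^-sigma: a commutator quadratic in 2 xi
    becomes linear again. The obstacle is formal: coefficients do not commute, and exponentials and
    logarithms are known only coefficient by coefficient. Identities are therefore compared on
    finite truncations, exp(ln W) = W is proved with the derivation xi d/dxi, and two logarithms of
    the same series are identified by the injectivity of exp on commuting series. *)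

Lemma sum_triangle (V : zmodType) (F : nat -> nat -> nat -> V) n :
  \sum_(i < n.+1) \sum_(j < i.+1) F j (i - j)%N (n - i)%N =
  \sum_(i < n.+1) \sum_(j < (n - i).+1) F i j (n - i - j)%N.
Proof.
(* Both sides run over the triples of sum n: the outer index is the sum of the first two parts on
   the left, the first part on the right. *)
pose G i j := F j (i - j)%N (n - i)%N.
transitivity (\sum_(0 <= i < n.+1) \sum_(0 <= j < n.+1 | (j <= i)%N) G i j).
  rewrite big_mkord; apply: eq_bigr => i _.
  by rewrite big_mkord; exact: (big_ord_widen_cond n.+1 predT (G i) (ltn_ord i)).
rewrite (exchange_big_dep_nat xpredT) //= big_mkord; apply: eq_bigr => j _.
rewrite (big_cat_nat (n := j)) ?(ltnW (ltn_ord j)) //= big_nat_cond big1 ?add0r; last first.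
  by move=> i /andP[/andP[_ ij]]; rewrite leqNgt ij.
rewrite -{1}[j : nat]add0n big_addn subSn -1?ltnS // big_mkord.
apply: eq_big => [i|i _]; first by rewrite leq_addl.
by rewrite /G addnK addnC subnDA.
Qed.

Section Convolution.

(** The product of series, [ser_scale] and [ser_pure] are all convertible to a [ser_conv], so one
    associativity lemma serves for all of them and for the actions by antipodes. *)
Definition ser_conv (U V W : zmodType) (f : U -> V -> W)
    (x : {series U}) (y : {series V}) : {series W} :=
  fun n => \sum_(i < n.+1) f (x i) (y (n - i)%N).

Lemma ser_convA (U V W P Q Z : zmodType) (f : U -> V -> P) (g : P -> W -> Z)
    (f' : V -> W -> Q) (g' : U -> Q -> Z) x y z :
  (forall w, {morph g^~ w : p q / p + q}) ->
  (forall u, {morph g' u : p q / p + q}) ->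
  (forall u v w, g (f u v) w = g' u (f' v w)) ->
  ser_conv g (ser_conv f x y) z = ser_conv g' x (ser_conv f' y z).
Proof.
move=> gD g'D fg; apply/funext=> n; rewrite /ser_conv.
have gs (I : finType) (F : I -> P) w : g (\sum_i F i) w = \sum_i g (F i) w.
  apply: (big_morph (g^~ w)) => [p q|]; first exact: gD.
  by apply: (addrI (g 0 w)); rewrite -gD !addr0.
have g's (I : finType) (F : I -> Q) u : g' u (\sum_i F i) = \sum_i g' u (F i).
  apply: (big_morph (g' u)) => [p q|]; first exact: g'D.
  by apply: (addrI (g' u 0)); rewrite -g'D !addr0.
under eq_bigr do rewrite gs.
under [in RHS]eq_bigr do rewrite g's.
rewrite (sum_triangle (fun i j k => g (f (x i) (y j)) (z k))).
by apply: eq_bigr => i _; apply: eq_bigr => j _; rewrite fg.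
Qed.

Lemma ser_conv_rev (U V W : zmodType) (f : U -> V -> W) x y :
  ser_conv f x y = ser_conv (fun v u => f u v) y x.
Proof.
apply/funext=> n; rewrite /ser_conv (reindex_inj rev_ord_inj) /=.
by apply: eq_bigr => i _; rewrite subSS subKn // -ltnS.
Qed.

Lemma ser_conv_cst (U V W : zmodType) (f : U -> V -> W) a y :
  (forall v, f 0 v = 0) -> ser_conv f a%:S y = (fun n => f a (y n)).
Proof.
move=> f0; apply/funext=> n; rewrite /ser_conv big_ord_recl /= subn0.
by rewrite big1 ?addr0.
Qed.

Lemma ser_conv_cstr (U V W : zmodType) (f : U -> V -> W) x b :
  (forall u, f u 0 = 0) -> ser_conv f x b%:S = (fun n => f (x n) b).
Proof. by move=> f0; rewrite ser_conv_rev ser_conv_cst. Qed.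

Lemma ser_conv_map (U V W U' V' W' : zmodType) (f : U -> V -> W)
    (f' : U' -> V' -> W') (p : U -> U') (q : V -> V') (r : W -> W') x y :
  {morph r : a b / a + b} -> (forall u v, r (f u v) = f' (p u) (q v)) ->
  ser_map r (ser_conv f x y) = ser_conv f' (ser_map p x) (ser_map q y).
Proof.
move=> rD rf; apply/funext=> n; rewrite /ser_map /ser_conv.
rewrite (big_morph r rD (id1 := 0)); first by apply: eq_bigr => i _; rewrite rf.
by apply: (addrI (r 0)); rewrite -rD !addr0.
Qed.

End Convolution.

Lemma ser_scaleEn (K : fieldType) (A : algType K) a (x : {series A}) n :
  (a%:S *: x) n = a *: x n.
Proof.
rewrite -[LHS]/(ser_conv *:%R a%:S x n) ser_conv_cst // => v.
exact: scale0r.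
Qed.

Lemma ser_cstM (R : nzRingType) (a b : R) : (a * b)%:S = a%:S * b%:S.
Proof.
rewrite -[RHS]/(ser_conv *%R a%:S b%:S) ser_conv_cst => [|v]; last exact: mul0r.
by apply/funext=> n; rewrite /ser_cst; case: eqP => //; rewrite mulr0.
Qed.

Lemma ser_cstD (R : zmodType) (a b : R) : (a + b)%:S = a%:S + b%:S.
Proof. by apply/funext=> n; rewrite -[RHS]/(a%:S n + b%:S n) /ser_cst; case: eqP; rewrite ?addr0. Qed.

Lemma ser_coef0M (R : nzRingType) (x y : {series R}) : (x * y) 0%N = x 0%N * y 0%N.
Proof. by rewrite ser_coefM big_ord1. Qed.

Lemma ser_coefD (R : zmodType) (x y : {series R}) n : (x + y) n = x n + y n.
Proof. by []. Qed.

Lemma ser_coefN (R : zmodType) (x : {series R}) n : (- x) n = - x n.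
Proof. by []. Qed.

Lemma ser_coef_sum (R : zmodType) I (r : seq I) P (F : I -> {series R}) n :
  (\sum_(i <- r | P i) F i) n = \sum_(i <- r | P i) F i n.
Proof. exact: (big_morph (fun x : {series R} => x n)). Qed.

Lemma ser_mapE (V W : Type) (f : V -> W) x n : ser_map f x n = f (x n).
Proof. by []. Qed.

(** * Coefficientwise maps as morphisms *)

Section SerMap.
Variables (K : fieldType).

Lemma ser_map_zmod (V W : zmodType) (f : {additive V -> W}) :
  zmod_morphism (ser_map f).
Proof. by move=> x y; apply/funext=> n; exact: raddfB. Qed.

HB.instance Definition _ (V W : zmodType) (f : {additive V -> W}) :=
  GRing.isZmodMorphism.Build {series V} {series W} (ser_map f) (ser_map_zmod f).

Lemma ser_map_monoid (R S : nzRingType) (f : {rmorphism R -> S}) :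
  monoid_morphism (ser_map f).
Proof.
split; last by move=> x y; exact: (ser_conv_map _ _ (rmorphD f) (rmorphM f)).
apply/funext=> n; rewrite -[LHS]/(f (ser_cst 1 n)) -[RHS]/(ser_cst 1 n) /ser_cst.
by case: eqP; rewrite ?rmorph1 ?rmorph0.
Qed.

HB.instance Definition _ (R S : nzRingType) (f : {rmorphism R -> S}) :=
  GRing.isMonoidMorphism.Build {series R} {series S} (ser_map f)
    (ser_map_monoid f).

Lemma ser_map_scalable (A B : algType K) (f : {linear A -> B}) :
  scalable (ser_map f).
Proof. by move=> c x; apply: (ser_conv_map (f := *:%R) (f' := *:%R) (p := id) _ _ (raddfD f)) => a v; exact: linearZZ. Qed.

HB.instance Definition _ (A B : algType K) (f : {linear A -> B}) :=
  GRing.isScalable.Build {series K} {series A} {series B} *:%R (ser_map f) (@ser_map_scalable A B f).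

End SerMap.

Lemma ser_map_cst (V W : zmodType) (f : {additive V -> W}) a :
  ser_map f a%:S = (f a)%:S.
Proof. by apply/funext=> n; rewrite /ser_map /ser_cst; case: eqP; rewrite ?raddf0. Qed.

HB.instance Definition _ (K : fieldType) (A B : algType K)
  (f : {lrmorphism A -> B}) := GRing.Linear.on (ser_map f).

(** * Exponential and logarithm of series *)

Definition ser_div (R : zmodType) k (x : {series R}) :=
  forall n, (n < k)%N -> x n = 0.

Lemma ser_divM (R : nzRingType) i j (x y : {series R}) :
  ser_div i x -> ser_div j y -> ser_div (i + j) (x * y).
Proof.
move=> xi yj n nij; rewrite ser_coefM big1 // => k _.
have [ki|ik] := ltnP k i; first by rewrite xi // mul0r.
by rewrite yj ?mulr0 //; have := ltn_ord k; lia.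
Qed.

Lemma ser_divX (R : nzRingType) k (x : {series R}) :
  x 0%N = 0 -> ser_div k (x ^+ k).
Proof.
move=> x0; elim: k => [|k IHk] //; rewrite exprS -add1n.
by apply: ser_divM => // -[].
Qed.

Lemma ser_coefMn (R : zmodType) (x : {series R}) m n : (x *+ m) n = x n *+ m.
Proof. by elim: m => [|m IHm] //; rewrite !mulrS ser_coefD IHm. Qed.

Section ExpLn.
Variables (K : fieldType).
Hypothesis char0 : [pchar K] =i pred0.

Let natr_neq0 n : n.+1%:R != 0 :> K.
Proof. by move/pcharf0P: char0 => ->. Qed.

Let fact_neq0 n : n`!%:R != 0 :> K.
Proof. by have := fact_gt0 n; case: n`! => // m _. Qed.

Section Algebra.
Variable A : algType K.
Implicit Types x y z : {series A}.

(** A coefficient of the exponential is that of any long enough partial sum, because x^k is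
    divisible by xi^k; identities between exponentials are then proved on finite sums. *)
Lemma ser_expE x M n : x 0%N = 0 -> (n < M)%N ->
  ser_exp x n = (\sum_(k < M) (k`!%:R^-1)%:S *: x ^+ k) n.
Proof.
move=> x0 nM; rewrite ser_coef_sum /ser_exp /ser_sum.
rewrite (big_ord_widen M (fun k => ((k`!%:R^-1)%:S *: x ^+ k) n)) //.
rewrite big_mkcond; apply: eq_bigr => k _; case: ifPn => // nk.
by rewrite ser_scaleEn ser_divX ?scaler0 // ltnNge.
Qed.

Lemma ser_lnE x M n : x 0%N = 1 -> (n < M)%N ->
  ser_ln x n = (\sum_(k < M) ((-1) ^+ k.+1 * k%:R^-1)%:S *: (x - 1) ^+ k) n.
Proof.
move=> x0 nM; rewrite ser_coef_sum /ser_ln /ser_sum.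
rewrite (big_ord_widen M (fun k => (((-1) ^+ k.+1 * k%:R^-1)%:S *: (x - 1) ^+ k) n)) //.
rewrite big_mkcond; apply: eq_bigr => k _; case: ifPn => // nk.
rewrite ser_scaleEn ser_divX ?scaler0 // -?ltnNge //.
  by rewrite ser_coefD x0 ser_coefN subrr.
by rewrite ltnNge.
Qed.

Lemma ser_exp_coef0 x : ser_exp x 0%N = 1.
Proof.
by rewrite /ser_exp /ser_sum big_ord1 ser_scaleEn expr0 fact0 invr1 scale1r.
Qed.

Lemma ser_ln_coef0 x : ser_ln x 0%N = 0.
Proof.
by rewrite /ser_ln /ser_sum big_ord1 ser_scaleEn invr0 mulr0 scale0r.
Qed.

Lemma ser_exp0 : ser_exp 0 = 1 :> {series A}.
Proof.
apply/funext=> n; rewrite (ser_expE (M := n.+1)) // big_ord_recl expr0 fact0 invr1.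
rewrite big1 ?addr0 => [|i _]; last by rewrite exprS mul0r scaler0.
by rewrite ser_scaleEn scale1r.
Qed.

(** At order n the binomial formula gives the terms [T i j] with i + j <= n, while the product of
    truncations gives the whole square i, j <= n. The extra terms vanish because x^i y^j is
    divisible by xi^(i + j). *)
Lemma ser_expD x y : x 0%N = 0 -> y 0%N = 0 -> x * y = y * x ->
  ser_exp (x + y) = ser_exp x * ser_exp y.
Proof.
move=> x0 y0 xy; apply/funext=> n.
pose T i j := (i`!%:R^-1 * j`!%:R^-1) *: (x ^+ i * y ^+ j) n.
transitivity (\sum_(k < n.+1) \sum_(i < k.+1) T i (k - i)%N).
  rewrite (ser_expE (M := n.+1)) // ?ser_coefD ?x0 ?y0 ?addr0 //.
  rewrite ser_coef_sum; apply: eq_bigr => k _.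
  rewrite ser_scaleEn addrC exprDn_comm; last exact/esym.
  rewrite ser_coef_sum scaler_sumr; apply: eq_bigr => i _.
  have ik : (i <= k)%N by rewrite -ltnS.
  have -> : y ^+ (k - i) * x ^+ i = x ^+ i * y ^+ (k - i).
    by apply: commrX; apply/esym/commrX/esym.
  rewrite ser_coefMn -scaler_nat scalerA /T; congr (_ *: _).
  rewrite -(bin_fact ik) !natrM !invfM [RHS]mulrC mulrAC mulVf ?mul1r; first exact: mulrC.
  by move: ik; rewrite -bin_gt0; case: 'C(k, i).
rewrite (sum_triangle (fun i j _ => T i j)) ser_coefM.
transitivity (\sum_(i < n.+1) \sum_(j < n.+1) T i j); last first.
  pose E z := \sum_(k < n.+1) (k`!%:R^-1)%:S *: z ^+ k.
  transitivity ((E x * E y) n); last first.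
    rewrite ser_coefM; apply: eq_bigr => i _.
    by rewrite !(ser_expE (M := n.+1)) // ltnS leq_subr.
  rewrite /E mulr_suml ser_coef_sum; apply: eq_bigr => i _.
  rewrite mulr_sumr ser_coef_sum; apply: eq_bigr => j _.
  by rewrite -scalerAl -scalerAr !ser_scaleEn scalerA.
apply: eq_bigr => i _; rewrite (big_ord_widen n.+1 (T i)) ?ltnS ?leq_subr //.
rewrite big_mkcond; apply: eq_bigr => j _; case: ifPn => // ij.
rewrite /T (ser_divM (ser_divX (k := i) x0) (ser_divX (k := j) y0)) ?scaler0 //.
have := ltn_ord i; have := ltn_ord j; move: ij; lia.
Qed.

Lemma ser_expN x : x 0%N = 0 -> ser_exp (- x) * ser_exp x = 1.
Proof.
move=> x0; rewrite -ser_expD ?addNr ?ser_exp0 ?ser_coefN ?x0 ?oppr0 //.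
by rewrite mulrN mulNr.
Qed.

(* Intertwiners rather than conjugations, so that [g] need not be a unit. *)
Lemma ser_exp_conj g x x' : x 0%N = 0 -> x' 0%N = 0 -> g * x = x' * g ->
  g * ser_exp x = ser_exp x' * g.
Proof.
move=> x0 x0' gx; apply/funext=> n.
have gX k : g * x ^+ k = x' ^+ k * g.
  elim: k => [|k IHk]; first by rewrite !expr0 mulr1 mul1r.
  by rewrite !exprSr mulrA IHk -!mulrA gx.
pose E z := \sum_(k < n.+1) (k`!%:R^-1)%:S *: z ^+ k.
transitivity ((g * E x) n); last transitivity ((E x' * g) n).
- rewrite !ser_coefM; apply: eq_bigr => i _.
  by rewrite (ser_expE (M := n.+1)) // ltnS leq_subr.
- rewrite /E mulr_sumr mulr_suml; congr (_ n); apply: eq_bigr => i _.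
  by rewrite -scalerAr gX scalerAl.
- rewrite !ser_coefM; apply: eq_bigr => i _.
  by rewrite (ser_expE (M := n.+1)) // ltnS leq_subr.
Qed.

Lemma ser_ln_conj g x x' : x 0%N = 1 -> x' 0%N = 1 -> g * x = x' * g ->
  g * ser_ln x = ser_ln x' * g.
Proof.
move=> x0 x0' gx; apply/funext=> n.
have gX k : g * (x - 1) ^+ k = (x' - 1) ^+ k * g.
  elim: k => [|k IHk]; first by rewrite !expr0 mulr1 mul1r.
  by rewrite !exprSr mulrA IHk -!mulrA mulrBr mulrBl gx mulr1 mul1r.
pose E z := \sum_(k < n.+1) ((-1) ^+ k.+1 * k%:R^-1)%:S *: (z - 1) ^+ k.
transitivity ((g * E x) n); last transitivity ((E x' * g) n).
- rewrite !ser_coefM; apply: eq_bigr => i _.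
  by rewrite (ser_lnE (M := n.+1)) // ltnS leq_subr.
- rewrite /E mulr_sumr mulr_suml; congr (_ n); apply: eq_bigr => i _.
  by rewrite -scalerAr gX scalerAl.
- rewrite !ser_coefM; apply: eq_bigr => i _.
  by rewrite (ser_lnE (M := n.+1)) // ltnS leq_subr.
Qed.

(** If z vanishes up to order n, its powers of exponent at least 2 are divisible by xi^(n + 2), so
    the coefficient of order n + 1 of exp z is that of z. *)
Lemma ser_exp_eq1 z : z 0%N = 0 -> ser_exp z = 1 -> z = 0.
Proof.
move=> z0 ez; apply/funext=> n; elim/ltn_ind: n => -[|n] IHn; first by rewrite z0.
have zd : ser_div n.+1 z by move=> k kn; rewrite IHn.
have := congr1 (fun y : {series A} => y n.+1) ez; rewrite (ser_expE (M := n.+2)) //.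
rewrite !big_ord_recl !ser_coefD !ser_scaleEn !expr0 !fact0 invr1 scale1r expr1 scale1r.
rewrite ser_coef_sum big1 ?addr0 => [|i _]; first by rewrite add0r.
rewrite ser_scaleEn /bump /= 2!exprS mulrA.
have zz : ser_div n.+2 (z * z).
  by rewrite -addn1; apply: ser_divM => // -[].
by rewrite (ser_divM (i := n.+2) (j := 0) zz) ?scaler0 ?addn0.
Qed.

Lemma ser_exp_inj x y : x 0%N = 0 -> y 0%N = 0 -> x * y = y * x ->
  ser_exp x = ser_exp y -> x = y.
Proof.
move=> x0 y0 xy exy; apply/eqP; rewrite -subr_eq0; apply/eqP/ser_exp_eq1.
  by rewrite ser_coefD ser_coefN x0 y0 subrr.
rewrite ser_expD ?ser_coefN ?y0 ?oppr0 ?exy //; last by rewrite mulrN mulNr xy.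
by have := @ser_expN (- y); rewrite opprK ser_coefN y0 oppr0; exact.
Qed.

(** * The derivation [xi d/dxi] *)

Definition ser_deriv (x : {series A}) : {series A} := fun n => x n *+ n.

Lemma ser_derivD x y : ser_deriv (x + y) = ser_deriv x + ser_deriv y.
Proof. by apply/funext=> n; exact: mulrnDl. Qed.

Lemma ser_derivM x y : ser_deriv (x * y) = ser_deriv x * y + x * ser_deriv y.
Proof.
apply/funext=> n; rewrite ser_coefD !ser_coefM /ser_deriv -sumrMnl -big_split.
apply: eq_bigr => i _ /=; rewrite mulrnAl mulrnAr -mulrnDr subnKC //.
by rewrite -ltnS.
Qed.

Lemma ser_deriv_eq0 x : ser_deriv x = 0 -> x = (x 0%N)%:S.
Proof.
move=> Dx; apply/funext=> -[|n] //.
have := congr1 (fun y : {series A} => y n.+1) Dx; rewrite /ser_deriv /=.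
rewrite -scaler_nat => /(congr1 ( *:%R (n.+1%:R^-1))).
by rewrite scalerA mulVf // scale1r scaler0.
Qed.

Lemma ser_derivX x k : x * ser_deriv x = ser_deriv x * x ->
  ser_deriv (x ^+ k.+1) = (x ^+ k * ser_deriv x) *+ k.+1.
Proof.
move=> xD; elim: k => [|k IHk]; first by rewrite expr1 expr0 mul1r.
rewrite exprSr ser_derivM IHk mulrnAl -mulrA -xD mulrA -exprSr.
by rewrite [RHS]mulrSr.
Qed.

Lemma ser_derivZ (a : K) x : ser_deriv (a%:S *: x) = a%:S *: ser_deriv x.
Proof. by apply/funext=> n; rewrite /ser_deriv !ser_scaleEn scalerMnr. Qed.
Lemma ser_deriv_exp x : x 0%N = 0 -> x * ser_deriv x = ser_deriv x * x ->
  ser_deriv (ser_exp x) = ser_exp x * ser_deriv x.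
Proof.
move=> x0 xD; apply/funext=> n.
pose E M := \sum_(k < M) (k`!%:R^-1)%:S *: x ^+ k.
(* The left truncation is one term longer because the derivation lowers the exponent of each power
   of x by one; both are exact at order n. *)
have DE : ser_deriv (E n.+2) = E n.+1 * ser_deriv x.
  rewrite /E big_ord_recl ser_derivD mulr_suml.
  rewrite (_ : ser_deriv _ = 0) ?add0r; last first.
    by apply/funext=> m; rewrite /ser_deriv ser_scaleEn; case: m => // m; rewrite scaler0 mul0rn.
  rewrite (big_morph _ ser_derivD (id1 := 0)); last by apply/funext=> m; exact: mul0rn.
  apply: eq_bigr => k _; rewrite ser_derivZ ser_derivX // -scalerAl.
  apply/funext=> m; rewrite !ser_scaleEn ser_coefMn -scaler_nat scalerA.
  by congr (_ *: _); rewrite factS natrM invfM mulrC mulVKf.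
transitivity (ser_deriv (E n.+2) n); first by rewrite /ser_deriv (ser_expE (M := n.+2)).
rewrite DE !ser_coefM; apply: eq_bigr => i _.
by rewrite (ser_expE (M := n.+1)) // ltn_ord.
Qed.

(** With u = x - 1, the derivative of the logarithm is the geometric series of -u times the
    derivative of x. Multiplied by x = 1 + u, the truncated geometric sum telescopes to 1 - (-u)^(n
    + 1), which is 1 up to order n. *)
Lemma ser_deriv_ln x : x 0%N = 1 -> x * ser_deriv x = ser_deriv x * x ->
  x * ser_deriv (ser_ln x) = ser_deriv x.
Proof.
move=> x0 xD; apply/funext=> n; pose u := x - 1.
have D0 : ser_deriv 1 = 0 :> {series A}.
  by apply/funext=> -[|m] //; rewrite /ser_deriv mul0rn.
have Du : ser_deriv u = ser_deriv x.
  by have := ser_derivD u 1; rewrite subrK D0 addr0 => ->.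
have u0 : u 0%N = 0 by rewrite /u ser_coefD x0 ser_coefN subrr.
have uD : u * ser_deriv u = ser_deriv u * u.
  by rewrite Du mulrBl mulrBr xD mulr1 mul1r.
pose E M := \sum_(k < M) ((-1) ^+ k.+1 * k%:R^-1)%:S *: u ^+ k.
have DE : ser_deriv (E n.+2) = (\sum_(k < n.+1) (- u) ^+ k) * ser_deriv x.
  rewrite /E big_ord_recl ser_derivD mulr_suml.
  (* The term of index 0 has coefficient 0 by the convention 0^-1 = 0. *)
  rewrite (_ : ser_deriv _ = 0) ?add0r; last first.
    by apply/funext=> m; rewrite /ser_deriv ser_scaleEn invr0 mulr0 scale0r mul0rn.
  rewrite (big_morph _ ser_derivD (id1 := 0)); last by apply/funext=> m; exact: mul0rn.
  apply: eq_bigr => k _; rewrite ser_derivZ ser_derivX // Du.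
  apply/funext=> m; rewrite ser_scaleEn ser_coefMn -scaler_nat scalerA.
  rewrite lift0 mulfVK // !exprSr mulrN1 mulrN1 opprK.
  rewrite (exprNn u) -(signr_odd K k) -(signr_odd {series A} k).
  by case: odd; rewrite ?expr0 ?expr1 ?mul1r ?mulN1r ?mulNr ?scaleN1r ?scale1r.
transitivity ((x * ser_deriv (E n.+2)) n).
  rewrite !ser_coefM; apply: eq_bigr => i _; congr (_ * _).
  rewrite /ser_deriv (ser_lnE (M := n.+2)) // ltnS.
  by rewrite (leq_trans (leq_subr _ _)).
rewrite DE mulrA.
have -> : x * (\sum_(k < n.+1) (- u) ^+ k) = 1 - (- u) ^+ n.+1.
  have := subrX1 (- u) n.+1.
  have -> : - u - 1 = - x by rewrite /u opprB addrC addrA addNr add0r.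
  by rewrite mulNr => /(congr1 -%R); rewrite opprK opprB => <-.
rewrite mulrBl mul1r ser_coefD ser_coefN.
rewrite [X in _ - X](ser_divM (i := n.+1) (j := 0)) ?subr0 ?addn0 //.
by apply: ser_divX; rewrite ser_coefN u0 oppr0.
Qed.

Lemma ser_mulI x y : x 0%N = 1 -> x * y = 0 -> y = 0.
Proof.
move=> x0 xy; apply/funext; elim/ltn_ind => n IHn.
have := congr1 (fun z : {series A} => z n) xy.
rewrite ser_coefM big_ord_recl x0 mul1r subn0 big1 ?addr0 // => i _.
by rewrite IHn ?mulr0 // lift0 ltn_subrL /= (leq_ltn_trans _ (ltn_ord i)).
Qed.

(** The derivation kills exp(- ln x) x, which is therefore equal to its constant term 1.
    Differentiating the exponential requires ln x to commute with its derivative, which has to be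
    deduced from the same property of x. *)
Lemma ser_lnK x : x 0%N = 1 -> x * ser_deriv x = ser_deriv x * x ->
  ser_exp (ser_ln x) = x.
Proof.
move=> x0 xD; set l := ser_ln x; have l0 : l 0%N = 0 by exact: ser_ln_coef0.
have xDl : x * ser_deriv l = ser_deriv x by exact: ser_deriv_ln.
have lC y : y * x = x * y -> y * l = l * y by move=> yx; exact: ser_ln_conj.
have Dlx : ser_deriv l * x = x * ser_deriv l.
  have := congr1 ser_deriv (lC x erefl); rewrite !ser_derivM.
  by rewrite -(lC (ser_deriv x)) // addrC => /addIr.
(* It suffices to check this after multiplication by x, where x times the derivative of l is the
   derivative of x. *)
have lDl : l * ser_deriv l = ser_deriv l * l.
  apply/eqP; rewrite -subr_eq0; apply/eqP/(ser_mulI x0).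
  rewrite mulrBr !mulrA (lC x) // -[l * x * _]mulrA !xDl -(lC (ser_deriv x)) //.
  by rewrite subrr.
have P1 : ser_exp (- l) * x = 1.
  rewrite [LHS]ser_deriv_eq0.
    by rewrite ser_coef0M ser_exp_coef0 x0 mulr1.
  have DN : ser_deriv (- l) = - ser_deriv l by apply/funext=> n; exact: mulNrn.
  rewrite ser_derivM ser_deriv_exp ?DN ?ser_coefN ?l0 ?oppr0 //.
    by rewrite mulrN mulNr -mulrA Dlx xDl addNr.
  by rewrite !mulrN !mulNr lDl.
rewrite -[LHS]mulr1 -P1 mulrA.
by have := @ser_expN (- l); rewrite opprK ser_coefN l0 oppr0 => ->; rewrite ?mul1r.
Qed.

End Algebra.

Lemma ser_map_exp (A B : algType K) (f : {lrmorphism A -> B}) x :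
  ser_map f (ser_exp x) = ser_exp (ser_map f x).
Proof.
apply/funext=> n; rewrite /ser_map /ser_exp /ser_sum raddf_sum.
apply: eq_bigr => k _; rewrite /= !ser_scaleEn linearZ; congr (_ *: _).
by rewrite -[RHS]/((ser_map f x ^+ k) n) -rmorphXn.
Qed.

Lemma ser_map_ln (A B : algType K) (f : {lrmorphism A -> B}) x :
  ser_map f (ser_ln x) = ser_ln (ser_map f x).
Proof.
apply/funext=> n; rewrite /ser_map /ser_ln /ser_sum raddf_sum.
apply: eq_bigr => k _; rewrite /= !ser_scaleEn linearZ; congr (_ *: _).
by rewrite -[RHS]/(((ser_map f x - 1) ^+ k) n) -(rmorph1 (ser_map f)) -rmorphB -rmorphXn.
Qed.

End ExpLn.

(** * Tensor products of algebras *)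

Section PureTensors.
Variables (K : fieldType) (A B : algType K).

Lemma pureM (a c : A) (b d : B) : (a \ox b) * (c \ox d) = (a * c) \ox (b * d).
Proof. exact: tens_mul_pure. Qed.

Lemma pureDl (a a' : A) (b : B) : (a + a') \ox b = a \ox b + a' \ox b.
Proof. by rewrite -[a]scale1r pure_is_linearl !scale1r. Qed.

Lemma pureDr (a : A) (b b' : B) : a \ox (b + b') = a \ox b + a \ox b'.
Proof. by rewrite -[b]scale1r pure_is_linearr !scale1r. Qed.

Lemma pure0l (b : B) : (0 : A) \ox b = 0.
Proof. by apply: (addrI (0 \ox b)); rewrite -pureDl !addr0. Qed.

Lemma pure0r (a : A) : a \ox (0 : B) = 0.
Proof. by apply: (addrI (a \ox 0)); rewrite -pureDr !addr0. Qed.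

Lemma pureZl c (a : A) (b : B) : (c *: a) \ox b = c *: (a \ox b).
Proof. by have := pure_is_linearl b c a 0; rewrite pure0l !addr0. Qed.

Lemma pureZr c (a : A) (b : B) : a \ox (c *: b) = c *: (a \ox b).
Proof. by have := pure_is_linearr a c b 0; rewrite pure0r !addr0. Qed.

Definition tens_inl (a : A) : A \ox B := a \ox 1.
Definition tens_inr (b : B) : A \ox B := 1 \ox b.

Lemma tens_inl_linear : linear tens_inl. Proof. exact: pure_is_linearl. Qed.
Lemma tens_inr_linear : linear tens_inr. Proof. exact: pure_is_linearr. Qed.
Lemma tens_inl_monoid : monoid_morphism tens_inl.
Proof. by split=> // x y; rewrite /tens_inl pureM mulr1. Qed.
Lemma tens_inr_monoid : monoid_morphism tens_inr.
Proof. by split=> // x y; rewrite /tens_inr pureM mulr1. Qed.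

HB.instance Definition _ :=
  GRing.isLinear.Build K A (A \ox B)%type _ tens_inl tens_inl_linear.
HB.instance Definition _ :=
  GRing.isMonoidMorphism.Build A (A \ox B)%type tens_inl tens_inl_monoid.
HB.instance Definition _ :=
  GRing.isLinear.Build K B (A \ox B)%type _ tens_inr tens_inr_linear.
HB.instance Definition _ :=
  GRing.isMonoidMorphism.Build B (A \ox B)%type tens_inr tens_inr_monoid.

Lemma tens_inl_inr a b : tens_inl a * tens_inr b = a \ox b.
Proof. by rewrite pureM mulr1 mul1r. Qed.

Lemma tens_inC a b : GRing.comm (tens_inl a) (tens_inr b).
Proof. by rewrite /GRing.comm tens_inl_inr pureM mulr1 mul1r. Qed.

Lemma additive_ext (V : zmodType) (f g : {additive A \ox B -> V}) :
  (forall a b, f (a \ox b) = g (a \ox b)) -> f =1 g.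
Proof.
move=> fg; elim/tens_ind=> [|//|x y Ex Ey]; first by rewrite !raddf0.
by rewrite !raddfD Ex Ey.
Qed.

Lemma rmorph_tens_ext (R : nzRingType) (f g : {rmorphism A \ox B -> R}) :
  (forall a, f (tens_inl a) = g (tens_inl a)) ->
  (forall b, f (tens_inr b) = g (tens_inr b)) -> f =1 g.
Proof.
by move=> fgl fgr; apply: additive_ext => a b; rewrite -tens_inl_inr /= !rmorphM fgl fgr.
Qed.

Section Universal.
Variables (C : algType K) (u : {lrmorphism A -> C}) (v : {lrmorphism B -> C}).
Hypothesis uv : forall a b, GRing.comm (u a) (v b).

(** The universal property of the tensor product of algebras. The commutation proof is an argument,
    so that the term itself determines the algebra morphism structure registered below. *)
Definition tens_mor (_ : forall a b, GRing.comm (u a) (v b)) : A \ox B -> C :=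
  tens_lift (fun a b => u a * v b).

Let ul b : linear ((fun a b => u a * v b)^~ b).
Proof. by move=> c x y; rewrite linearP mulrDl scalerAl. Qed.
Let vl a : linear ((fun a b => u a * v b) a).
Proof. by move=> c x y; rewrite linearP mulrDr scalerAr. Qed.

Lemma tens_mor_pure a b : tens_mor uv (a \ox b) = u a * v b.
Proof. by rewrite /tens_mor tens_lift_pure //; case: (tens_liftZ ul vl). Qed.

Lemma tens_mor_linear : linear (tens_mor uv).
Proof. by case: (tens_liftZ ul vl). Qed.

HB.instance Definition _ :=
  GRing.isLinear.Build K (A \ox B)%type C _ (tens_mor uv) tens_mor_linear.

Lemma tens_mor_monoid : monoid_morphism (tens_mor uv).
Proof.
split; first by rewrite -[1]/(1 \ox 1) tens_mor_pure !rmorph1 mulr1.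
move=> x y; elim/tens_ind: x => [|a b|x x' Ex Ex']; first by rewrite mul0r !raddf0 mul0r.
  elim/tens_ind: y => [|a' b'|y y' Ey Ey']; first by rewrite mulr0 !raddf0 mulr0.
    rewrite pureM !tens_mor_pure !rmorphM -!mulrA; congr (_ * _).
    by rewrite !mulrA; congr (_ * _); exact: uv.
  by rewrite mulrDr !raddfD /= Ey Ey' mulrDr.
by rewrite mulrDl !raddfD /= Ex Ex' mulrDl.
Qed.

HB.instance Definition _ :=
  GRing.isMonoidMorphism.Build (A \ox B)%type C (tens_mor uv) tens_mor_monoid.

Lemma tens_mor_inl a : tens_mor uv (tens_inl a) = u a.
Proof. by rewrite tens_mor_pure rmorph1 mulr1. Qed.
Lemma tens_mor_inr b : tens_mor uv (tens_inr b) = v b.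
Proof. by rewrite tens_mor_pure rmorph1 mul1r. Qed.

Lemma tens_mor_comm c : (forall a, GRing.comm c (u a)) ->
  (forall b, GRing.comm c (v b)) -> forall t, GRing.comm c (tens_mor uv t).
Proof.
move=> cu cv; elim/tens_ind=> [|a b|x y Ex Ey]; first by rewrite raddf0; exact: commr0.
  by rewrite tens_mor_pure; exact: commrM.
by rewrite raddfD; exact: commrD.
Qed.

End Universal.

End PureTensors.

(** * Continuous maps between series *)

(* [T] is additive on constants, commutes with [xi] and is xi-adically
   continuous: exactly what makes it equal to a [ser_lift]. *)
Definition ser_continuous (V W : zmodType) (T : {series V} -> {series W}) :=
  (forall a b, T (a + b)%:S = T a%:S + T b%:S) /\
  forall u n, T u n = \sum_(i < n.+1) T (u i)%:S (n - i)%N.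

Lemma ser_continuous_conv (U V W : zmodType) (f : U -> V -> W) y :
  (forall v, {morph f^~ v : a b / a + b}) ->
  ser_continuous (fun x => ser_conv f x y).
Proof.
move=> fD; have f0 v : f 0 v = 0 by apply: (addrI (f 0 v)); rewrite -fD !addr0.
split=> [a b|u n]; last by apply: eq_bigr => i _; rewrite ser_conv_cst.
by apply/funext=> n; rewrite ser_coefD !ser_conv_cst // fD.
Qed.

Lemma ser_continuous_map (V W : zmodType) (f : {additive V -> W}) :
  ser_continuous (ser_map f).
Proof.
split=> [a b|u n]; first by rewrite ser_cstD raddfD.
rewrite big_ord_recr big1 => [|i _]; first by rewrite /= add0r ser_map_cst subnn.
by rewrite ser_map_cst /ser_cst subn_eq0 leqNgt /= ltn_ord.
Qed.

(** Needed because a twisted coproduct is not coefficientwise: it is a coefficientwise map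
    multiplied by fixed series on both sides. *)
Lemma ser_continuousMl (V : zmodType) (R : nzRingType) (g : {series R})
    (T : {series V} -> {series R}) :
  ser_continuous T -> ser_continuous (fun x => g * T x).
Proof.
move=> [TD Tc]; split=> [a b|u n]; first by rewrite TD mulrDr.
pose F i j k := g i * T (u j)%:S k.
transitivity (\sum_(i < n.+1) \sum_(j < (n - i).+1) F i j (n - i - j)%N).
  by rewrite ser_coefM; apply: eq_bigr => i _; rewrite Tc mulr_sumr.
transitivity (\sum_(i < n.+1) \sum_(j < (n - i).+1) F j i (n - i - j)%N); last first.
  by apply: eq_bigr => i _; rewrite ser_coefM.
rewrite -(sum_triangle F) -(sum_triangle (fun i j => F j i)).
apply: eq_bigr => i _; rewrite (reindex_inj rev_ord_inj) /=.
by apply: eq_bigr => j _; rewrite subSS subKn // -ltnS.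
Qed.

Lemma ser_continuousMr (V : zmodType) (R : nzRingType) (g : {series R})
    (T : {series V} -> {series R}) :
  ser_continuous T -> ser_continuous (fun x => T x * g).
Proof.
move=> [TD Tc]; split=> [a b|u n]; first by rewrite TD mulrDl.
pose F i j k := T (u i)%:S j * g k.
transitivity (\sum_(i < n.+1) \sum_(j < (n - i).+1) F i j (n - i - j)%N).
  rewrite -(sum_triangle F) ser_coefM; apply: eq_bigr => i _.
  by rewrite Tc mulr_suml.
by apply: eq_bigr => i _; rewrite ser_coefM.
Qed.

(** Agreement on constant pure tensors determines [ser_lift f]. The balancedness of [f] on constants
    is read off from [T], which sees only the tensor of a and b. *)
Lemma ser_liftE (K : fieldType) (A B : algType K) (V : zmodType)
    (f : {series A} -> {series B} -> {series V}) (T : {series A \ox B} -> {series V}) t :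
  ser_continuous T -> (forall a b, f a%:S b%:S = T (a \ox b)%:S) ->
  ser_lift f t = T t.
Proof.
move=> [TD Tc] fT; apply/funext=> n; rewrite Tc; apply: eq_bigr => i _.
have T0 : T 0%:S = 0 by apply: (addrI (T 0%:S)); rewrite -TD !addr0.
have fB : balanced (fun a b => f a%:S b%:S).
  split=> [a a' b|a b b'|c a b]; rewrite !fT ?pureDl ?pureDr ?TD //.
  by rewrite pureZl pureZr.
congr (_ _); elim/tens_ind: (t i) => [|a b|x y Ex Ey].
- by rewrite tens_lift0 // T0.
- by rewrite tens_lift_pure // fT.
- by rewrite tens_liftD // Ex Ey TD.
Qed.

(** Brings [assoc] inside the [ser_lift] of [id_coprod], after which [ser_liftE] applies. *)
Lemma ser_map_lift (K : fieldType) (A B : algType K) (V W : zmodType)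
    (p : {additive V -> W}) (f : {series A} -> {series B} -> {series V}) t :
  ser_map p (ser_lift f t) = ser_lift (fun x y => ser_map p (f x y)) t.
Proof.
apply/funext=> n; rewrite /ser_map /ser_lift raddf_sum; apply: eq_bigr => i _.
by rewrite /tens_lift !ser_coef_sum raddf_sum.
Qed.

Lemma ser_lrmap_cst (K : fieldType) (A B : algType K) (f : {lrmorphism A -> B}) a :
  ser_map f a%:S = (f a)%:S.
Proof. exact: ser_map_cst. Qed.

(** * The three legs *)

Section Legs3.
Variables (K : fieldType) (A : algType K).

Definition leg1 : A -> A \ox A \ox A := tens_inl A \o tens_inl A.
Definition leg2 : A -> A \ox A \ox A := tens_inl A \o @tens_inr K A A.
Definition leg3 : A -> A \ox A \ox A := @tens_inr K (A \ox A)%type A.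

HB.instance Definition _ := GRing.LRMorphism.copy leg1 (tens_inl A \o tens_inl A).
HB.instance Definition _ := GRing.LRMorphism.copy leg2 (tens_inl A \o @tens_inr K A A).
HB.instance Definition _ := GRing.LRMorphism.copy leg3 (@tens_inr K (A \ox A)%type A).

Lemma leg_12C a b : GRing.comm (leg1 a) (leg2 b).
Proof. by rewrite /GRing.comm /leg1 /leg2 /= -!rmorphM tens_inC. Qed.
Lemma leg_13C a b : GRing.comm (leg1 a) (leg3 b).
Proof. exact: tens_inC. Qed.
Lemma leg_23C a b : GRing.comm (leg2 a) (leg3 b).
Proof. exact: tens_inC. Qed.
Lemma leg_21C a b : GRing.comm (leg2 a) (leg1 b).
Proof. exact/esym/leg_12C. Qed.
Lemma leg_31C a b : GRing.comm (leg3 a) (leg1 b).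
Proof. exact/esym/leg_13C. Qed.
Lemma leg_32C a b : GRing.comm (leg3 a) (leg2 b).
Proof. exact/esym/leg_23C. Qed.

(** This and the similar lemmas below replace raw [tens_lift] definitions by [tens_mor], which
    carries the algebra morphism structure. *)
Lemma flipE : @flip K A A = tens_mor (fun a b => esym (tens_inC b a)).
Proof.
congr tens_lift; apply/funext=> a; apply/funext=> b /=.
by rewrite -tens_inC tens_inl_inr.
Qed.

Lemma leg21E : @leg21 K A = ser_map (tens_mor (fun a b => esym (tens_inC b a))).
Proof. by rewrite /leg21 flipE. Qed.

Lemma leg12E : @leg12 K A = ser_map (tens_mor leg_12C).
Proof.
congr (ser_map (tens_lift _)); apply/funext=> a; apply/funext=> b.
by rewrite /= /leg1 /leg2 /= -rmorphM tens_inl_inr.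
Qed.

Lemma leg13E : @leg13 K A = ser_map (tens_mor leg_13C).
Proof.
congr (ser_map (tens_lift _)); apply/funext=> a; apply/funext=> b.
by rewrite /= /leg1 /leg3 /= tens_inl_inr.
Qed.

Lemma leg23E : @leg23 K A = ser_map (tens_mor leg_23C).
Proof.
congr (ser_map (tens_lift _)); apply/funext=> a; apply/funext=> b.
by rewrite /= /leg2 /leg3 /= tens_inl_inr.
Qed.

Lemma tens_mor23_leg1C a t : GRing.comm (leg1 a) (tens_mor leg_23C t).
Proof. by apply: tens_mor_comm => b; [exact: leg_12C|exact: leg_13C]. Qed.

Lemma tens_mor12_leg3C t a : GRing.comm (tens_mor leg_12C t) (leg3 a).
Proof. by apply/esym/tens_mor_comm => b; [exact: leg_31C|exact: leg_32C]. Qed.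

Lemma assocE : @assoc K A A A = tens_mor tens_mor23_leg1C.
Proof.
congr tens_lift; apply/funext=> a; apply/funext=> t.
have fl : balanced (fun b c : A => a \ox b \ox c).
  split=> [b1 b2 d|b1 d1 d2|k b1 d].
  - by rewrite pureDr pureDl.
  - by rewrite pureDr.
  - by rewrite pureZr pureZl pureZr.
elim/tens_ind: t => [|b c|x y Ex Ey].
- by rewrite tens_lift0 //= raddf0 mulr0.
- rewrite tens_lift_pure //= tens_mor_pure /= /leg1 /leg2 /leg3 /=.
  by rewrite mulrA -rmorphM !tens_inl_inr.
- by rewrite tens_liftD // Ex Ey /= raddfD mulrDr.
Qed.

Lemma tens_mor12E : tens_mor leg_12C =1 tens_inl A.
Proof. by apply: rmorph_tens_ext => a; rewrite /= ?tens_mor_inl ?tens_mor_inr. Qed.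

Lemma leg12_inl : @leg12 K A = ser_map (tens_inl A).
Proof.
by rewrite leg12E; apply/funext=> x; apply/funext=> n; exact: tens_mor12E.
Qed.

Lemma ser_pure_cstr (x : {series A \ox A}) b :
  x \oxs b%:S = leg12 x * (leg3 b)%:S.
Proof.
rewrite -[RHS]/(ser_conv *%R _ _) ser_conv_cstr => [|?]; last exact: mulr0.
rewrite -[LHS]/(ser_conv (@pure _ _ _) _ _) ser_conv_cstr => [|?]; last exact: pure0r.
by apply/funext=> n; rewrite leg12_inl /ser_map /leg3 tens_inl_inr.
Qed.

Lemma assoc_pure_cst a (x : {series A \ox A}) :
  ser_map (tens_mor tens_mor23_leg1C) (a%:S \oxs x) = (leg1 a)%:S * leg23 x.
Proof.
rewrite -[RHS]/(ser_conv *%R _ _) ser_conv_cst => [|?]; last exact: mul0r.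
rewrite -[a%:S \oxs x]/(ser_conv (@pure _ _ _) _ _) ser_conv_cst => [|?]; last exact: pure0l.
by apply/funext=> n; rewrite leg23E /ser_map tens_mor_pure.
Qed.

Lemma ser_cst_comm (R : nzRingType) (a : R) (x : {series R}) :
  (forall n, GRing.comm a (x n)) -> GRing.comm a%:S x.
Proof.
move=> ax; rewrite /GRing.comm -[LHS]/(ser_conv *%R _ _) -[RHS]/(ser_conv *%R _ _).
rewrite ser_conv_cst => [|?]; last exact: mul0r.
rewrite ser_conv_cstr => [|?]; last exact: mulr0.
by apply/funext=> n; exact: ax.
Qed.

Section Coprod.
Variable D : {lrmorphism A -> A \ox A}.

(** [tens_mor coprod_leg3C] is Delta (x) id, and [tens_mor leg1_coprodC] is id (x) Delta, both with
    values in the left-bracketed triple tensor product. *)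
Lemma coprod_leg3C a b : GRing.comm ((tens_mor leg_12C \o D) a) (leg3 b).
Proof. exact: tens_mor12_leg3C. Qed.
Lemma leg1_coprodC a b : GRing.comm (leg1 a) ((tens_mor leg_23C \o D) b).
Proof. exact: tens_mor23_leg1C. Qed.

(** With g = h = 1 this computes the plain coproduct, with g = F and h = F^-1 the twisted one. The
    factors come out on both sides because h_12 commutes with the third leg. *)
Lemma coprod_id_conj (f : {series A} -> {series A \ox A}) g h t :
  (forall a, f a%:S = g * (D a)%:S * h) ->
  coprod_id f t = leg12 g * ser_map (tens_mor coprod_leg3C) t * leg12 h.
Proof.
move=> fE; apply: (ser_liftE (T := fun t => _ * ser_map _ t * _)).
  by apply/ser_continuousMr/ser_continuousMl/ser_continuous_map.
move=> a b /=; rewrite ser_pure_cstr fE leg12E.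
rewrite !rmorphM !ser_lrmap_cst /=.
rewrite tens_mor_pure ser_cstM -!mulrA; congr (_ * (_ * _)).
  exact: ser_lrmap_cst.
apply: esym; apply: (ser_cst_comm (x := ser_map _ h)) => n.
exact/esym/tens_mor12_leg3C.
Qed.

Lemma id_coprod_conj (f : {series A} -> {series A \ox A}) g h t :
  (forall a, f a%:S = g * (D a)%:S * h) ->
  id_coprod f t = leg23 g * ser_map (tens_mor leg1_coprodC) t * leg23 h.
Proof.
move=> fE; rewrite /id_coprod assocE ser_map_lift.
apply: (ser_liftE (T := fun t => _ * ser_map _ t * _)).
  by apply/ser_continuousMr/ser_continuousMl/ser_continuous_map.
move=> a b /=; rewrite assoc_pure_cst fE leg23E !rmorphM !ser_lrmap_cst /=.
rewrite tens_mor_pure ser_cstM !mulrA; congr (_ * _ * _); last first.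
  exact: ser_lrmap_cst.
by apply: (ser_cst_comm (x := ser_map _ g)) => n; exact: tens_mor23_leg1C.
Qed.
End Coprod.
End Legs3.

(** * Twisting a cocommutative Hopf algebra *)

Section CounitAlg.
Variables (K : fieldType) (A : algType K) (e : {lrmorphism A -> K^o}).

(** The counit followed by the unit of A: taking values in A makes eps (x) id and id (x) eps
    instances of [tens_mor]. *)
Definition counit_alg (a : A) : A := (e a : K)%:A.

Lemma counit_alg_linear : linear counit_alg.
Proof. by move=> c x y; rewrite /counit_alg linearP scalerDl scalerA. Qed.
Lemma counit_alg_monoid : monoid_morphism counit_alg.
Proof.
rewrite /counit_alg; split=> [|x y]; first by rewrite rmorph1 scale1r.
by rewrite rmorphM -scalerA mulr_algl.
Qed.
HB.instance Definition _ :=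
  GRing.isLinear.Build K A A _ counit_alg counit_alg_linear.
HB.instance Definition _ :=
  GRing.isMonoidMorphism.Build A A counit_alg counit_alg_monoid.

Lemma counit_algC a b : GRing.comm (counit_alg a) (idfun b).
Proof. by rewrite /GRing.comm /counit_alg mulr_algl mulr_algr. Qed.
Lemma counit_algC' a b : GRing.comm (idfun a) (counit_alg b).
Proof. exact/esym/counit_algC. Qed.
End CounitAlg.

Lemma ser_map_eq (V W Z : Type) (p : W -> Z) (q : V -> W) (r : V -> Z) x :
  (forall v, p (q v) = r v) -> ser_map p (ser_map q x) = ser_map r x.
Proof. by move=> pq; apply/funext=> n; exact: pq. Qed.

(** * Permutations of the three legs *)

Section Permutations.
Variables (K : fieldType) (A : algType K) (D : {lrmorphism A -> A \ox A}).
Hypothesis cocomm : forall a, flip (D a) = D a.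

Local Notation t12 := (tens_mor (@leg_12C K A)).
Local Notation t13 := (tens_mor (@leg_13C K A)).
Local Notation t23 := (tens_mor (@leg_23C K A)).
Local Notation t21 := (tens_mor (@leg_21C K A)).
Local Notation t31 := (tens_mor (@leg_31C K A)).
Local Notation t32 := (tens_mor (@leg_32C K A)).

Lemma tens_mor13_leg2C t a : GRing.comm (t13 t) (leg2 a).
Proof. by apply/esym/tens_mor_comm => b; [exact: leg_21C|exact: leg_23C]. Qed.
Lemma tens_mor23_leg1C' t a : GRing.comm (t23 t) (leg1 a).
Proof. exact/esym/tens_mor23_leg1C. Qed.
Lemma tens_mor31_leg2C t a : GRing.comm (t31 t) (leg2 a).
Proof. by apply/esym/tens_mor_comm => b; [exact: leg_23C|exact: leg_21C]. Qed.
Lemma tens_mor21_leg3C t a : GRing.comm (t21 t) (leg3 a).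
Proof. by apply/esym/tens_mor_comm => b; [exact: leg_32C|exact: leg_31C]. Qed.

(* [tens_perm ijk] moves the first leg to the [i]-th place, and so on. *)
Definition tens_perm312 := tens_mor tens_mor31_leg2C.
Definition tens_perm231 := tens_mor tens_mor23_leg1C'.
Definition tens_perm132 := tens_mor tens_mor13_leg2C.
Definition tens_perm213 := tens_mor tens_mor21_leg3C.
HB.instance Definition _ := GRing.LRMorphism.copy tens_perm312 (tens_mor tens_mor31_leg2C).
HB.instance Definition _ := GRing.LRMorphism.copy tens_perm231 (tens_mor tens_mor23_leg1C').
HB.instance Definition _ := GRing.LRMorphism.copy tens_perm132 (tens_mor tens_mor13_leg2C).
HB.instance Definition _ := GRing.LRMorphism.copy tens_perm213 (tens_mor tens_mor21_leg3C).

Section Legs.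
Variables (C : algType K) (u v w : {lrmorphism A -> C}).
Variables (uv : forall a b, GRing.comm (u a) (v b)).
Variables (uvw : forall t b, GRing.comm (tens_mor uv t) (w b)).
Lemma tens_mor_legs a :
  ((tens_mor uvw (leg1 a) = u a) * (tens_mor uvw (leg2 a) = v a) *
   (tens_mor uvw (leg3 a) = w a))%type.
Proof.
split; [split|].
- exact: etrans (tens_mor_inl _ _) (tens_mor_inl _ _).
- exact: etrans (tens_mor_inl _ _) (tens_mor_inr _ _).
- exact: tens_mor_inr.
Qed.
End Legs.

Lemma tens_perm312E a :
  ((tens_perm312 (leg1 a) = leg3 a) * (tens_perm312 (leg2 a) = leg1 a) *
   (tens_perm312 (leg3 a) = leg2 a))%type.
Proof. by rewrite /tens_perm312 !tens_mor_legs. Qed.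
Lemma tens_perm231E a :
  ((tens_perm231 (leg1 a) = leg2 a) * (tens_perm231 (leg2 a) = leg3 a) *
   (tens_perm231 (leg3 a) = leg1 a))%type.
Proof. by rewrite /tens_perm231 !tens_mor_legs. Qed.
Lemma tens_perm132E a :
  ((tens_perm132 (leg1 a) = leg1 a) * (tens_perm132 (leg2 a) = leg3 a) *
   (tens_perm132 (leg3 a) = leg2 a))%type.
Proof. by rewrite /tens_perm132 !tens_mor_legs. Qed.
Lemma tens_perm213E a :
  ((tens_perm213 (leg1 a) = leg2 a) * (tens_perm213 (leg2 a) = leg1 a) *
   (tens_perm213 (leg3 a) = leg3 a))%type.
Proof. by rewrite /tens_perm213 !tens_mor_legs. Qed.
Definition tens_permE := (tens_perm312E, tens_perm231E, tens_perm132E, tens_perm213E).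

Section PermPair.
Variables (p : {lrmorphism A \ox A \ox A -> A \ox A \ox A}).
Variables (u v u' v' : {lrmorphism A -> A \ox A \ox A}).
Variables (uv : forall a b, GRing.comm (u a) (v b)).
Variables (uv' : forall a b, GRing.comm (u' a) (v' b)).
Lemma perm_tens_mor t : (forall a, p (u a) = u' a) -> (forall b, p (v b) = v' b) ->
  p (tens_mor uv t) = tens_mor uv' t.
Proof.
move=> pu pv; rewrite -[LHS]/((p \o tens_mor uv) t); move: t.
by apply: rmorph_tens_ext => a; rewrite /= ?tens_mor_inl ?tens_mor_inr ?pu ?pv.
Qed.
End PermPair.

Lemma perm_leg12 t :
  ((tens_perm312 (t12 t) = t31 t) * (tens_perm231 (t12 t) = t23 t) *
   (tens_perm132 (t12 t) = t13 t) * (tens_perm213 (t12 t) = t21 t))%type.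
Proof. by split; [split; [split|]|]; apply: perm_tens_mor => a; rewrite /= tens_permE. Qed.

Lemma perm_leg23 t :
  ((tens_perm312 (t23 t) = t12 t) * (tens_perm231 (t23 t) = t31 t) *
   (tens_perm132 (t23 t) = t32 t) * (tens_perm213 (t23 t) = t13 t))%type.
Proof. by split; [split; [split|]|]; apply: perm_tens_mor => a; rewrite /= tens_permE. Qed.

Lemma tens_mor_flip (C : algType K) (u v : {lrmorphism A -> C})
  (uv : forall a b, GRing.comm (u a) (v b)) (vu : forall a b, GRing.comm (v a) (u b)) t :
  tens_mor uv (flip t) = tens_mor vu t.
Proof.
rewrite flipE.
have ext := @rmorph_tens_ext K A A C (tens_mor uv \o tens_mor (fun a b => esym (tens_inC b a))) (tens_mor vu).
by move: t; apply: ext => a; rewrite /= ?tens_mor_inl ?tens_mor_inr /= ?tens_mor_inl.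
Qed.

Lemma tens_mor_cocomm (C : algType K) (u v : {lrmorphism A -> C})
  (uv : forall a b, GRing.comm (u a) (v b)) (vu : forall a b, GRing.comm (v a) (u b)) a :
  tens_mor uv (D a) = tens_mor vu (D a).
Proof. by rewrite -[in LHS]cocomm (tens_mor_flip uv vu). Qed.

(** These two facts define the coproduct spread over legs 1 and 3, with the other tensor factor in
    leg 2; it is the intermediate term of both hexagon computations. *)
Lemma coprod13_leg2C a b : GRing.comm ((t13 \o D) a) (leg2 b).
Proof. exact: tens_mor13_leg2C. Qed.
Lemma leg2_coprod13C a b : GRing.comm (leg2 a) ((t13 \o D) b).
Proof. exact/esym/tens_mor13_leg2C. Qed.

Local Notation DI := (tens_mor (coprod_leg3C D)).
Local Notation ID := (tens_mor (leg1_coprodC D)).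
Local Notation DI2 := (tens_mor coprod13_leg2C).
Local Notation ID2 := (tens_mor leg2_coprod13C).

(** By cocommutativity, the image under a permutation depends only on the leg where the factor
    untouched by Delta lands: the order of the other two legs is irrelevant. *)
Lemma perm_coprod_id t :
  ((tens_perm312 (DI t) = DI2 t) * (tens_perm231 (DI t) = ID (flip t)) *
   (tens_perm132 (DI t) = DI2 t) * (tens_perm213 (DI t) = DI t))%type.
Proof.
have IDf := tens_mor_flip (leg1_coprodC D) (fun a b => esym (leg1_coprodC D b a)).
split; [split; [split|]|]; rewrite ?IDf; apply: perm_tens_mor => a; rewrite /= ?tens_permE //.
- by rewrite perm_leg12; exact: tens_mor_cocomm.
- by rewrite perm_leg12.
- by rewrite perm_leg12.
- by rewrite perm_leg12; exact: tens_mor_cocomm.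
Qed.

Lemma perm_id_coprod t :
  ((tens_perm312 (ID t) = DI (flip t)) * (tens_perm231 (ID t) = ID2 t) *
   (tens_perm132 (ID t) = ID t) * (tens_perm213 (ID t) = ID2 t))%type.
Proof.
have DIf := tens_mor_flip (coprod_leg3C D) (fun a b => esym (coprod_leg3C D b a)).
split; [split; [split|]|]; rewrite ?DIf; apply: perm_tens_mor => a; rewrite /= ?tens_permE //.
- by rewrite perm_leg23.
- by rewrite perm_leg23; exact: tens_mor_cocomm.
- by rewrite perm_leg23; exact: tens_mor_cocomm.
- by rewrite perm_leg23.
Qed.

End Permutations.

(** * Twisted coproducts *)

Section Twist.
Variables (K : fieldType) (A : algType K).
Variables (D : {lrmorphism A -> A \ox A}) (e : {lrmorphism A -> K^o}).
Variable F : {series A \ox A}.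

Local Notation t12 := (tens_mor (@leg_12C K A)).
Local Notation t13 := (tens_mor (@leg_13C K A)).
Local Notation t23 := (tens_mor (@leg_23C K A)).
Local Notation t21 := (tens_mor (@leg_21C K A)).
Local Notation t31 := (tens_mor (@leg_31C K A)).
Local Notation t32 := (tens_mor (@leg_32C K A)).
Local Notation DI := (tens_mor (coprod_leg3C D)).
Local Notation ID := (tens_mor (leg1_coprodC D)).
Local Notation DI2 := (tens_mor (coprod13_leg2C D)).
Local Notation ID2 := (tens_mor (leg2_coprod13C D)).
Local Notation Delta := (ser_map D).
Local Notation DeltaF := (twisted_coprod Delta F).

Lemma twisted_coprod_cst a : DeltaF a%:S = F * (D a)%:S * F^-1.
Proof. by rewrite /twisted_coprod; congr (_ * _ * _); exact: ser_lrmap_cst. Qed.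

Lemma coprod_id_untwisted t : coprod_id Delta t = ser_map DI t.
Proof.
rewrite (@coprod_id_conj _ _ D _ 1 1) => [|a].
  by rewrite leg12E !rmorph1 mul1r mulr1.
by rewrite mul1r mulr1; exact: ser_lrmap_cst.
Qed.

Lemma id_coprod_untwisted t : id_coprod Delta t = ser_map ID t.
Proof.
rewrite (@id_coprod_conj _ _ D _ 1 1) => [|a].
  by rewrite leg23E !rmorph1 mul1r mulr1.
by rewrite mul1r mulr1; exact: ser_lrmap_cst.
Qed.

Lemma coprod_id_twisted t :
  coprod_id DeltaF t = ser_map t12 F * ser_map DI t * ser_map t12 F^-1.
Proof. by rewrite (coprod_id_conj t twisted_coprod_cst) leg12E. Qed.

Lemma id_coprod_twisted t :
  id_coprod DeltaF t = ser_map t23 F * ser_map ID t * ser_map t23 F^-1.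
Proof. by rewrite (id_coprod_conj t twisted_coprod_cst) leg23E. Qed.

Hypothesis Funit : F \is a GRing.unit.
Hypothesis twistF : ser_map t12 F * ser_map DI F = ser_map t23 F * ser_map ID F.

(** * The universal R-matrix *)

Section Rmatrix.
Hypothesis cocomm : forall a, flip (D a) = D a.

Local Notation R := (leg21 F * F^-1).

Let f21E p (tf t : A \ox A -> A \ox A \ox A) :
  (forall x, tf (flip x) = t x) -> ser_map tf (leg21 p) = ser_map t p.
Proof. by move=> tfE; exact: ser_map_eq. Qed.

Let u3 (f : {lrmorphism A \ox A -> A \ox A \ox A}) : ser_map f F \is a GRing.unit.
Proof. exact: rmorph_unit. Qed.

Let leg21_unit : leg21 F \is a GRing.unit.
Proof. by rewrite leg21E rmorph_unit. Qed.

(** The permutations 312 and 132 of the twist equation, [E1] and [E2], share the factor [DI2 F].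
    Eliminating it, and cancelling [ID F] by the twist equation itself, leaves F_31 F_13^-1 F_32
    F_23^-1. *)
Lemma twist_Rmx_coprod_id : coprod_id DeltaF R = leg13 R * leg23 R.
Proof.
rewrite coprod_id_twisted leg13E leg23E !rmorphM !(rmorphV _ Funit) /=.
rewrite !(f21E _ (tens_mor_flip (@leg_13C K A) (@leg_31C K A))).
rewrite !(f21E _ (tens_mor_flip (@leg_23C K A) (@leg_32C K A))).
have E1 : ser_map t31 F * ser_map DI2 F = ser_map t12 F * ser_map DI (leg21 F).
  have := congr1 (ser_map (@tens_perm312 K A)) twistF; rewrite !rmorphM /=.
  rewrite (ser_map_eq F (fun t => (perm_leg12 t).1.1.1)).
  rewrite (ser_map_eq F (fun t => (perm_leg23 t).1.1.1)).
  rewrite (ser_map_eq F (fun t => (perm_coprod_id cocomm t).1.1.1)).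
  by rewrite (ser_map_eq F (fun t => (perm_id_coprod cocomm t).1.1.1)).
have E2 : ser_map t13 F * ser_map DI2 F = ser_map t32 F * ser_map ID F.
  have := congr1 (ser_map (@tens_perm132 K A)) twistF; rewrite !rmorphM /=.
  rewrite (ser_map_eq F (fun t => (perm_leg12 t).1.2)).
  rewrite (ser_map_eq F (fun t => (perm_leg23 t).1.2)).
  rewrite (ser_map_eq F (fun t => (perm_coprod_id cocomm t).1.2)).
  by rewrite (ser_map_eq F (fun t => (perm_id_coprod cocomm t).1.2)).
rewrite mulrA -E1 -!mulrA -invrM ?u3 // twistF invrM ?u3 //.
have -> : ser_map DI2 F = (ser_map t13 F)^-1 * (ser_map t32 F * ser_map ID F).
  by rewrite -E2 mulKr ?u3.
by rewrite !mulrA mulrK ?u3.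
Qed.

Lemma twist_Rmx_id_coprod : id_coprod DeltaF R = leg13 R * leg12 R.
Proof.
rewrite id_coprod_twisted leg13E leg12E !rmorphM !(rmorphV _ Funit) /=.
rewrite !(f21E _ (tens_mor_flip (@leg_13C K A) (@leg_31C K A))).
rewrite !(f21E _ (tens_mor_flip (@leg_12C K A) (@leg_21C K A))).
(* The same elimination, now with the common factor [ID2 F] of the permutations 231 and 213. *)
have E1 : ser_map t23 F * ser_map ID (leg21 F) = ser_map t31 F * ser_map ID2 F.
  have := congr1 (ser_map (@tens_perm231 K A)) twistF; rewrite !rmorphM /=.
  rewrite (ser_map_eq F (fun t => (perm_leg12 t).1.1.2)).
  rewrite (ser_map_eq F (fun t => (perm_leg23 t).1.1.2)).
  rewrite (ser_map_eq F (fun t => (perm_coprod_id cocomm t).1.1.2)).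
  by rewrite (ser_map_eq F (fun t => (perm_id_coprod cocomm t).1.1.2)).
have E2 : ser_map t21 F * ser_map DI F = ser_map t13 F * ser_map ID2 F.
  have := congr1 (ser_map (@tens_perm213 K A)) twistF; rewrite !rmorphM /=.
  rewrite (ser_map_eq F (fun t => (perm_leg12 t).2)).
  rewrite (ser_map_eq F (fun t => (perm_leg23 t).2)).
  rewrite (ser_map_eq F (fun t => (perm_coprod_id cocomm t).2)).
  by rewrite (ser_map_eq F (fun t => (perm_id_coprod cocomm t).2)).
rewrite mulrA E1 -!mulrA -invrM ?u3 // -twistF invrM ?u3 //.
have -> : ser_map ID2 F = (ser_map t13 F)^-1 * (ser_map t21 F * ser_map DI F).
  by rewrite E2 mulKr ?u3.
by rewrite !mulrA mulrK ?u3.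
Qed.

Lemma leg21K (x : {series A \ox A}) : leg21 (leg21 x) = x.
Proof.
apply/funext=> n; rewrite /leg21 /ser_map flipE; move: (x n) => t.
have ext := @rmorph_tens_ext K A A (A \ox A)%type (tens_mor (fun a b => esym (tens_inC b a)) \o tens_mor (fun a b => esym (tens_inC b a))) idfun.
by move: t; apply: ext => a; rewrite /= ?tens_mor_inl ?tens_mor_inr /= ?tens_mor_inl ?tens_mor_inr.
Qed.

(** By cocommutativity the flipped twisted coproduct is F_21 Delta F_21^-1, to which conjugation by
    F_21 F^-1 carries F Delta F^-1. *)
Lemma twist_triangular : triangular DeltaF R.
Proof.
have l21M : {morph @leg21 K A : x y / x * y} by rewrite leg21E; exact: rmorphM.
have l21V : leg21 F^-1 = (leg21 F)^-1 by rewrite leg21E rmorphV.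
split; last by rewrite l21M l21V leg21K !mulrA mulrVK // mulrV.
split.
- by rewrite unitrMr ?unitrV.
- move=> x; rewrite /twisted_coprod !l21M l21V invrM ?unitrV // invrK.
  have -> : leg21 (Delta x) = Delta x by apply: ser_map_eq.
  by rewrite !mulrA !mulrVK.
- exact: twist_Rmx_coprod_id.
- exact: twist_Rmx_id_coprod.
Qed.

End Rmatrix.

(** * Counit and antipode of the twisted coproduct *)

Section Hopf.
Variable S : {linear A -> A}.
Hypothesis S1 : S 1 = 1.
Hypothesis SM : forall a b, S (a * b) = S b * S a.

Lemma twist_coprod_linear : linear DeltaF.
Proof.
by move=> c x y; rewrite /twisted_coprod linearP mulrDr mulrDl scalerAl scalerAr.
Qed.

Lemma twist_coprod_monoid : monoid_morphism DeltaF.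
Proof.
split=> [|x y]; rewrite /twisted_coprod ?rmorph1 ?mulr1 ?mulrV //.
by rewrite rmorphM !mulrA mulrVK.
Qed.

Hypothesis coassoc : forall a, DI (D a) = ID (D a).

(** The two sides are the iterated coproducts of x conjugated by F_12 (Delta (x) id)(F) and by F_23
    (id (x) Delta)(F), which are equal by the twist equation. *)
Lemma twist_coprodA x : coprod_id DeltaF (DeltaF x) = id_coprod DeltaF (DeltaF x).
Proof.
rewrite coprod_id_twisted id_coprod_twisted /twisted_coprod !rmorphM !(rmorphV _ Funit) /=.
have conjM (a b y : {series A \ox A \ox A}) : a \is a GRing.unit ->
    b \is a GRing.unit -> a * (b * y * b^-1) * a^-1 = a * b * y * (a * b)^-1.
  by move=> au bu; rewrite invrM // !mulrA.
rewrite !conjM ?rmorph_unit // twistF; congr (_ * _ * _).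
by apply/funext=> n; exact: coassoc.
Qed.

Local Notation el := (tens_mor (counit_algC e)).
Local Notation er := (tens_mor (counit_algC' e)).
Local Notation eps := (ser_map e).
Hypothesis counitL : forall a, el (D a) = a.
Hypothesis counitR : forall a, er (D a) = a.
Hypothesis elF : ser_map el F = 1.
Hypothesis erF : ser_map er F = 1.

Lemma twist_counitl x :
  ser_lift (fun y z => (eps y : {series K}) *: z) (DeltaF x) = x.
Proof.
rewrite (ser_liftE (T := ser_map el)); first last.
- move=> a b; rewrite (ser_lrmap_cst el) /= tens_mor_pure ser_map_cst.
  apply/funext=> n; rewrite ser_scaleEn /ser_cst; case: eqP => _; last exact: scaler0.
  by rewrite /counit_alg mulr_algl.
- exact: ser_continuous_map.
rewrite /twisted_coprod !rmorphM rmorphV //= elF invr1 mul1r mulr1.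
by apply/funext=> n; exact: counitL.
Qed.

Lemma twist_counitr x :
  ser_lift (fun y z => (eps z : {series K}) *: y) (DeltaF x) = x.
Proof.
rewrite (ser_liftE (T := ser_map er)); first last.
- move=> a b; rewrite (ser_lrmap_cst er) /= tens_mor_pure ser_map_cst.
  apply/funext=> n; rewrite ser_scaleEn /ser_cst; case: eqP => _; last exact: scaler0.
  by rewrite /counit_alg mulr_algr.
- exact: ser_continuous_map.
rewrite /twisted_coprod !rmorphM rmorphV //= erF invr1 mul1r mulr1.
by apply/funext=> n; exact: counitR.
Qed.

(* The right action [w <| (a (x) b) = S a * w * b] and the left action
   [(a (x) b) |> w = a * w * S b] of [A (x) A] on [A]. The antipode equations of
   [D] are about [1 <| D a] and [D a |> 1]. *)
Definition antipode_actr w (t : A \ox A) : A := tens_lift (fun a b => S a * w * b) t.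
Definition antipode_actl w (t : A \ox A) : A := tens_lift (fun a b => a * w * S b) t.

Let actr_lin w : (forall b : A, linear ((fun a b => S a * w * b)^~ b)) /\
  (forall a : A, linear ((fun a b => S a * w * b) a)).
Proof.
split=> [b|a] c x y; first by rewrite linearP !mulrDl -!scalerAl.
by rewrite mulrDr -scalerAr.
Qed.
Let actl_lin w : (forall b : A, linear ((fun a b => a * w * S b)^~ b)) /\
  (forall a : A, linear ((fun a b => a * w * S b) a)).
Proof.
split=> [b|a] c x y; first by rewrite !mulrDl -!scalerAl.
by rewrite linearP mulrDr -scalerAr.
Qed.

Lemma antipode_actr_linear w : linear (antipode_actr w).
Proof. by have [l r] := actr_lin w; case: (tens_liftZ l r). Qed.
Lemma antipode_actl_linear w : linear (antipode_actl w).
Proof. by have [l r] := actl_lin w; case: (tens_liftZ l r). Qed.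
HB.instance Definition _ w := GRing.isLinear.Build K (A \ox A)%type A _
  (antipode_actr w) (antipode_actr_linear w).
HB.instance Definition _ w := GRing.isLinear.Build K (A \ox A)%type A _
  (antipode_actl w) (antipode_actl_linear w).

Lemma antipode_actr_pure w a b : antipode_actr w (a \ox b) = S a * w * b.
Proof. by have [l r] := actr_lin w; rewrite /antipode_actr tens_lift_pure //; case: (tens_liftZ l r). Qed.
Lemma antipode_actl_pure w a b : antipode_actl w (a \ox b) = a * w * S b.
Proof. by have [l r] := actl_lin w; rewrite /antipode_actl tens_lift_pure //; case: (tens_liftZ l r). Qed.

Lemma antipode_actrD t : {morph antipode_actr^~ t : u w / u + w}.
Proof.
move=> u w; elim/tens_ind: t => [|a b|x y Ex Ey]; first by rewrite !raddf0 addr0.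
  by rewrite !antipode_actr_pure mulrDr mulrDl.
by rewrite !raddfD /= Ex Ey addrACA.
Qed.
Lemma antipode_actlD t : {morph antipode_actl^~ t : u w / u + w}.
Proof.
move=> u w; elim/tens_ind: t => [|a b|x y Ex Ey]; first by rewrite !raddf0 addr0.
  by rewrite !antipode_actl_pure mulrDr mulrDl.
by rewrite !raddfD /= Ex Ey addrACA.
Qed.

Lemma antipode_actrZ c w t : antipode_actr (c *: w) t = c *: antipode_actr w t.
Proof.
elim/tens_ind: t => [|a b|x y Ex Ey]; first by rewrite !raddf0 ?scaler0.
  by rewrite !antipode_actr_pure -scalerAr -scalerAl.
by rewrite !raddfD /= Ex Ey ?scalerDr.
Qed.
Lemma antipode_actlZ c w t : antipode_actl (c *: w) t = c *: antipode_actl w t.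
Proof.
elim/tens_ind: t => [|a b|x y Ex Ey]; first by rewrite !raddf0 ?scaler0.
  by rewrite !antipode_actl_pure -scalerAr -scalerAl.
by rewrite !raddfD /= Ex Ey ?scalerDr.
Qed.

Lemma antipode_actrM w s t : antipode_actr (antipode_actr w s) t = antipode_actr w (s * t).
Proof.
elim/tens_ind: t => [|a b|x y Ex Ey]; first by rewrite mulr0 !raddf0.
  elim/tens_ind: s => [|c d|x y Ex Ey].
  - by rewrite mul0r !raddf0 antipode_actr_pure mulr0 mul0r.
  - by rewrite pureM !antipode_actr_pure SM !mulrA.
  - by rewrite mulrDl !raddfD /= antipode_actrD Ex Ey.
by rewrite mulrDr !raddfD /= Ex Ey.
Qed.
Lemma antipode_actlM w s t : antipode_actl (antipode_actl w t) s = antipode_actl w (s * t).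
Proof.
elim/tens_ind: s => [|a b|x y Ex Ey]; first by rewrite mul0r !raddf0.
  elim/tens_ind: t => [|c d|x y Ex Ey].
  - by rewrite mulr0 !raddf0 antipode_actl_pure mulr0 mul0r.
  - by rewrite pureM !antipode_actl_pure SM !mulrA.
  - by rewrite mulrDr !raddfD /= antipode_actlD Ex Ey.
by rewrite mulrDl !raddfD /= Ex Ey.
Qed.

Hypothesis antipodeL : forall a, antipode_actr 1 (D a) = counit_alg e a.
Hypothesis antipodeR : forall a, antipode_actl 1 (D a) = counit_alg e a.

Definition antipode_contract (t : A \ox A \ox A) : A :=
  tens_lift (fun s c => antipode_actl 1 s * c) t.

Let contract_lin : (forall c : A, linear ((fun s c => antipode_actl 1 s * c)^~ c)) /\
  (forall s : A \ox A, linear ((fun s c => antipode_actl 1 s * c) s)).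
Proof.
split=> [c|s] k x y; first by rewrite linearP mulrDl -scalerAl.
by rewrite mulrDr -scalerAr.
Qed.

Lemma antipode_contract_linear : linear antipode_contract.
Proof. by have [l r] := contract_lin; case: (tens_liftZ l r). Qed.
HB.instance Definition _ := GRing.isLinear.Build K (A \ox A \ox A)%type A _
  antipode_contract antipode_contract_linear.

Lemma antipode_contract_pure a b c : antipode_contract (a \ox b \ox c) = a * S b * c.
Proof.
have [l r] := contract_lin; rewrite /antipode_contract tens_lift_pure.
  by rewrite antipode_actl_pure mulr1.
by case: (tens_liftZ l r).
Qed.

(** The reversal S(z y) = S(y) S(z) is what separates q from p. The case a = d = 1 evaluates F_23^-1
    F_12; taking coproducts for p and q evaluates the product of id (x) Delta and Delta (x) id. *)
Lemma antipode_contract23_12 a d p q :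
  antipode_contract (leg1 a * t23 p * (t12 q * leg3 d)) =
  a * antipode_actl 1 q * antipode_actr 1 p * d.
Proof.
elim/tens_ind: p => [|z w|x y Ex Ey].
- by rewrite !raddf0 mulr0 mul0r raddf0 mulr0 mul0r.
- elim/tens_ind: q => [|x y|x y Ex Ey].
  + by rewrite !raddf0 mul0r !mulr0 raddf0 !mul0r.
  + rewrite !tens_mor_pure antipode_actl_pure antipode_actr_pure !mulr1.
    have -> : leg1 a * (leg2 z * leg3 w) * (leg1 x * leg2 y * leg3 d) =
        (a * x) \ox (z * y) \ox (w * d).
      by rewrite /leg1 /leg2 /leg3 /= /tens_inl /tens_inr !pureM !(mulr1, mul1r).
    by rewrite antipode_contract_pure SM !mulrA.
  + by rewrite !raddfD /= mulrDl mulrDr raddfD /= Ex Ey mulrDr !mulrDl.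
- by rewrite !raddfD /= mulrDr mulrDl raddfD /= Ex Ey mulrDr mulrDl.
Qed.

(** The two inner coproducts meet the antipode as in the two antipode axioms, so each collapses to a
    counit. *)
Lemma antipode_contract_coprod f g :
  antipode_contract (ID f * DI g) = er f * el g.
Proof.
elim/tens_ind: f => [|a b|x y Ex Ey].
- by rewrite !raddf0 !mul0r raddf0.
- elim/tens_ind: g => [|c d|x y Ex Ey].
  + by rewrite !raddf0 !mulr0 raddf0.
  + rewrite !tens_mor_pure /= antipode_contract23_12 antipodeL antipodeR.
    rewrite /counit_alg !mulr_algr mulr_algl -!scalerAl !scalerA -scalerAr scalerA.
    by rewrite mulrC.
  + by rewrite !raddfD /= mulrDr raddfD /= Ex Ey mulrDr.
- by rewrite !raddfD /= mulrDl raddfD /= Ex Ey mulrDl.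
Qed.

Local Notation U := (ser_map (antipode_actl 1) F).
Local Notation V := (ser_map (antipode_actr 1) F^-1).

Lemma twist_antipode_unit : U * V = 1.
Proof.
have E : ser_map t23 F^-1 * ser_map t12 F = ser_map ID F * ser_map DI F^-1.
  rewrite !rmorphV // -[LHS](mulrK (rmorph_unit (ser_map DI) Funit)).
  by rewrite -[_^-1 * _ * _]mulrA twistF mulKr ?rmorph_unit.
transitivity (ser_map antipode_contract (ser_map t23 F^-1 * ser_map t12 F)).
  (* Contraction puts the contribution of q before that of p; as xi is central, the convolution can
     be summed in the reverse order. *)
  transitivity (ser_conv (fun p q => antipode_actl 1 q * antipode_actr 1 p) F^-1 F).
    by rewrite ser_conv_rev.
  symmetry; apply: (ser_conv_map (f := fun p q => t23 p * t12 q)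
    (f' := fun p q => antipode_actl 1 q * antipode_actr 1 p) (p := id) (q := id)).
    exact: raddfD.
  move=> p q; have := antipode_contract23_12 1 1 p q.
  by rewrite !rmorph1 !mulr1 !mul1r.
rewrite E; transitivity (ser_map er F * ser_map el F^-1); last first.
  by rewrite erF rmorphV //= elF invr1 mulr1.
apply: (ser_conv_map (f := fun p q => ID p * DI q)
  (f' := fun p q => er p * el q) (p := id) (q := id)); first exact: raddfD.
exact: antipode_contract_coprod.
Qed.

Definition twist_antipode (x : {series A}) : {series A} := U * ser_map S x * V.

Lemma twist_antipode_linear : linear twist_antipode.
Proof.
by move=> c x y; rewrite /twist_antipode linearP mulrDr mulrDl scalerAl scalerAr.
Qed.

Let epsE x : ser_map (counit_alg e) x = (eps x : {series K})%:A :> {series A}.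
Proof.
rewrite -[RHS]/(ser_conv *:%R (eps x) 1%:S) ser_conv_cstr // => c.
exact: scaler0.
Qed.

(** In terms of the right action, V = 1 <| F^-1 and the left side is U times V <| [DeltaF x]. The
    action telescopes: V <| F Delta(x) F^-1 = 1 <| Delta(x) F^-1 = eps(x) V, and U V = 1. *)
Lemma twist_antipodel x :
  ser_lift (fun y z => twist_antipode y * z) (DeltaF x) = (eps x : {series K})%:A.
Proof.
have aM W P Q : ser_conv antipode_actr (ser_conv antipode_actr W P) Q =
    ser_conv antipode_actr W (P * Q).
  apply: ser_convA => [t|w|w s t]; [exact: antipode_actrD|exact: raddfD|].
  exact: antipode_actrM.
have a1 P : ser_conv antipode_actr 1 P = ser_map (antipode_actr 1) P.
  apply: ser_conv_cst => t; apply: (addrI (antipode_actr 0 t)).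
  by rewrite -antipode_actrD !addr0.
rewrite (ser_liftE (T := fun t => U * ser_conv antipode_actr V t)); first last.
- move=> a b; rewrite /twist_antipode -!mulrA; congr (_ * _).
  rewrite [RHS]ser_conv_cstr => [|w]; last exact: raddf0.
  rewrite (ser_map_cst S).
  rewrite -[LHS]/(ser_conv *%R (S a)%:S _) ser_conv_cst => [|w]; last exact: mul0r.
  apply/funext=> n; rewrite antipode_actr_pure -mulrA; congr (_ * _).
  rewrite -[LHS]/(ser_conv *%R V b%:S n) ser_conv_cstr // => w; exact: mulr0.
- apply: ser_continuousMl.
  have -> : ser_conv antipode_actr V = fun t => ser_conv (fun t w => antipode_actr w t) t V.
    by apply/funext=> t; rewrite ser_conv_rev.
  by apply: ser_continuous_conv => w; exact: raddfD.
rewrite /twisted_coprod -!aM -(a1 F^-1) (aM 1 F^-1 F) mulVr // !a1.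
have -> : ser_map (antipode_actr 1) 1 = 1.
  have A1 : antipode_actr 1 (1 \ox 1) = 1 by rewrite antipode_actr_pure S1 !mulr1.
  by rewrite (ser_map_cst (antipode_actr 1)); exact: congr1 A1.
rewrite a1 (ser_map_eq x antipodeL) epsE.
have -> : ser_conv antipode_actr (eps x : {series K})%:A F^-1 =
    (eps x : {series K}) *: V.
  rewrite -a1; apply: (ser_convA (f := *:%R) (g' := *:%R)) => [t|c|c w t].
  - exact: antipode_actrD.
  - exact: scalerDr.
  - exact: antipode_actrZ.
by rewrite -scalerAr twist_antipode_unit.
Qed.

Lemma twist_antipoder x :
  ser_lift (fun y z => y * twist_antipode z) (DeltaF x) = (eps x : {series K})%:A.
Proof.
(* With the tensor as first argument, the left action composes in the order expected by
   [ser_convA]. *)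
pose act (t : A \ox A) w := antipode_actl w t.
have actD t : {morph act t : u w / u + w} by move=> u w; exact: antipode_actlD.
have aM P Q W : ser_conv act P (ser_conv act Q W) = ser_conv act (P * Q) W.
  symmetry; apply: ser_convA => [w|t|s t w]; [exact: raddfD|exact: actD|].
  by rewrite /act antipode_actlM.
have a1 P : ser_conv act P 1 = ser_map (antipode_actl 1) P.
  apply: ser_conv_cstr => t; apply: (addrI (act t 0)).
  by rewrite -actD !addr0.
rewrite (ser_liftE (T := fun t => ser_conv act t U * V)); first last.
- move=> a b; rewrite /twist_antipode !mulrA; congr (_ * _).
  rewrite [RHS]ser_conv_cst => [|w]; last exact: raddf0.
  rewrite (ser_map_cst S).
  rewrite -[LHS]/(ser_conv *%R _ (S b)%:S) ser_conv_cstr => [|w]; last exact: mulr0.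
  apply/funext=> n; rewrite /act antipode_actl_pure; congr (_ * _).
  rewrite -[LHS]/(ser_conv *%R a%:S U n) ser_conv_cst // => w; exact: mul0r.
- by apply/ser_continuousMr/ser_continuous_conv => w; exact: raddfD.
rewrite /twisted_coprod -!aM -{1}(a1 F) (aM F^-1 F 1) mulVr // !a1.
have -> : ser_map (antipode_actl 1) 1 = 1.
  have A1 : antipode_actl 1 (1 \ox 1) = 1 by rewrite antipode_actl_pure S1 !mulr1.
  by rewrite (ser_map_cst (antipode_actl 1)); exact: congr1 A1.
rewrite a1 (ser_map_eq x antipodeR) epsE.
have -> : ser_conv act F (eps x : {series K})%:A = (eps x : {series K}) *: U.
  pose sc (w : A) (c : K) := c *: w.
  rewrite -a1; transitivity (ser_conv act F (ser_conv sc 1 (eps x))).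
    by rewrite (ser_conv_rev sc).
  transitivity (ser_conv sc (ser_conv act F 1) (eps x)); last exact: ser_conv_rev.
  symmetry.
  apply: (ser_convA (f := act) (g := sc) (f' := sc) (g' := act)) => [c|t|t w c].
  - by move=> u w; exact: scalerDr.
  - exact: actD.
  - by rewrite /sc /act antipode_actlZ.
by rewrite -scalerAl twist_antipode_unit.
Qed.

Theorem twist_hopf_algebra : hopf_algebra DeltaF eps.
Proof.
split.
- exact: twist_coprod_linear.
- exact: twist_coprod_monoid.
- exact: linearP.
- exact: (conj (rmorph1 eps) (rmorphM eps)).
- exact: twist_coprodA.
- exact: twist_counitl.
- exact: twist_counitr.
- exists twist_antipode; split; first exact: twist_antipode_linear.
  by move=> x; rewrite twist_antipodel twist_antipoder.
Qed.

End Hopf.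
End Twist.

(** * The extended Jordanian twist *)

Section ExpMore.
Variables (K : fieldType) (A : algType K).
Hypothesis char0 : [pchar K] =i pred0.
Implicit Types x y z a b c d : {series A}.

Lemma ser_exp_unit x : x 0%N = 0 -> ser_exp x \is a GRing.unit.
Proof.
move=> x0; apply/unitrP; exists (ser_exp (- x)); rewrite ser_expN //; split=> //.
by have := @ser_expN _ char0 A (- x); rewrite opprK ser_coefN x0 oppr0; exact.
Qed.

Lemma ser_ln1 : ser_ln 1 = 0 :> {series A}.
Proof.
apply/funext=> n; rewrite /ser_ln /ser_sum big1 // => k _; rewrite ser_scaleEn subrr.
case: k => -[|k] ki /=; first by rewrite invr0 mulr0 scale0r.
by rewrite [0 ^+ _]exprS mul0r; exact: scaler0.
Qed.

(* [ad x] is nilpotent of order two on [c]. *)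
Lemma ser_exp_shift x c d : x 0%N = 0 -> x * c = c * x + d -> x * d = d * x ->
  ser_exp x * c = (c + d) * ser_exp x.
Proof.
move=> x0 xc xd; apply/funext=> n.
pose E M := \sum_(k < M) (k`!%:R^-1)%:S *: x ^+ k.
have xdX k : x ^+ k * d = d * x ^+ k by exact/esym/commrX/esym.
have xX k : x ^+ k.+1 * c = c * x ^+ k.+1 + (d * x ^+ k) *+ k.+1.
  elim: k => [|k IHk]; first by rewrite expr1 expr0 mulr1 xc.
  rewrite exprS -mulrA IHk mulrDr mulrA xc mulrDl -mulrA -exprS -addrA; congr (_ + _).
  by rewrite mulrnAr mulrA xd -mulrA -exprS [RHS]mulrS.
have EC : E n.+2 * c = c * E n.+2 + d * E n.+1.
  rewrite /E big_ord_recl mulrDl mulrDr -addrA; congr (_ + _).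
    by rewrite expr0 -scalerAl -scalerAr mul1r mulr1.
  rewrite mulr_suml !mulr_sumr -big_split; apply: eq_bigr => k _ /=.
  rewrite -scalerAl xX scalerDr -!scalerAr; congr (_ + _).
  apply/funext=> m; rewrite !ser_scaleEn ser_coefMn -scaler_nat scalerA.
  congr (_ *: _); rewrite factS natrM invfM mulrC mulVKf //.
  by move/pcharf0P: char0 => ->.
have Ex M m : (m < M)%N -> E M m = ser_exp x m by move=> mM; rewrite (ser_expE x0 mM).
transitivity ((E n.+2 * c) n).
  rewrite !ser_coefM; apply: eq_bigr => i _; rewrite Ex //.
  by have := ltn_ord i; lia.
rewrite EC mulrDl !ser_coefD !ser_coefM; congr (_ + _).
  by apply: eq_bigr => i _; rewrite Ex //; lia.
by apply: eq_bigr => i _; rewrite Ex //; lia.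
Qed.

(* Two-step nilpotent Baker-Campbell-Hausdorff: both sides are the exponential
   of [a + b + c + [a, c] / 2]. *)
Lemma ser_exp_exchange a b c d : a 0%N = 0 -> b 0%N = 0 -> c 0%N = 0 -> d 0%N = 0 ->
  a * c = c * a + (d - b) -> a * b = b * a -> a * d = d * a -> b * d = d * b ->
  b * c = c * b -> d * c = c * d ->
  ser_exp a * ser_exp (b + c) = ser_exp c * ser_exp (a + d).
Proof.
move=> a0 b0 c0 d0 ac ab ad bd bc dc.
have db0 : (d - b) 0%N = 0 by rewrite ser_coefD ser_coefN b0 d0 subrr.
have dbC : (d - b) * c = c * (d - b) by rewrite mulrBl mulrBr dc bc.
(* As [a, c] = d - b commutes with a, conjugation by e^a is the shift of c by d - b. Then e^c splits
   off on the left, and the remaining exponents d - b and a + b recombine to a + d. *)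
have exC : ser_exp a * c = (c + (d - b)) * ser_exp a.
  by apply: ser_exp_shift; rewrite // mulrBl mulrBr ab ad.
rewrite [b + c]addrC [ser_exp (c + b)]ser_expD //.
rewrite mulrA (ser_exp_conj c0 _ exC); last by rewrite ser_coefD c0 db0 addr0.
rewrite [ser_exp (c + _)]ser_expD //.
rewrite -!mulrA; congr (_ * _).
have bdb : b * (d - b) = (d - b) * b by rewrite mulrBl mulrBr bd.
rewrite -(@ser_expD _ char0 _ a b) // [a + b]addrC [ser_exp (b + a)]ser_expD //.
by rewrite mulrA -ser_expD // subrK [a + d]addrC [RHS]ser_expD.
Qed.

(** For h = H (x) sigma and x = x' (x) 1 with x' of weight k under ad H, b is k (1 (x) sigma): this
    is the rule for moving Phi past a weight vector. *)
Lemma ser_exp_weight (h x b : {series A}) : h 0%N = 0 -> b 0%N = 0 -> h * b = b * h ->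
  h * x = x * (h + b) -> ser_exp h * x = x * ser_exp b * ser_exp h.
Proof.
move=> h0 b0 hb hx; rewrite -mulrA -ser_expD //.
by symmetry; apply: ser_exp_conj => //; rewrite ?ser_coefD ?b0 ?h0 ?addr0 // hx addrC.
Qed.

(* [g * x * g^-1] is [ser_ln w], which commutes with the logarithm [m] of [w]. *)
Lemma ser_log_conj (g x w m : {series A}) : g \is a GRing.unit -> x 0%N = 0 ->
  w 0%N = 1 -> m 0%N = 0 -> m * w = w * m -> g * x = ser_ln w * g ->
  g * ser_exp x = w * g -> ser_exp m = w -> g * x = m * g.
Proof.
move=> gu x0 w0 m0 mw gx gex em; rewrite gx; congr (_ * g).
have lw0 := ser_ln_coef0 w; apply: (ser_exp_inj char0 lw0 m0).
  exact/esym/(ser_ln_conj w0 w0).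
by apply: (mulIr gu); rewrite /= -(ser_exp_conj x0 lw0 gx) gex em.
Qed.

Lemma ser_scale_coef0 k x : (k *: x) 0%N = k 0%N *: x 0%N.
Proof. by rewrite -[LHS]/(\sum_(i < 1) _) big_ord1. Qed.

Lemma ser_scale_cst k (a : A) n : (k *: a%:S) n = k n *: a.
Proof.
rewrite -[LHS]/(ser_conv *:%R k a%:S n) ser_conv_cstr // => m; exact: scaler0.
Qed.

End ExpMore.

Lemma ser_map_comm (R S T : nzRingType) (f : {additive R -> T}) (g : {additive S -> T}) x y :
  (forall a b, GRing.comm (f a) (g b)) -> GRing.comm (ser_map f x) (ser_map g y).
Proof.
move=> fg; rewrite /GRing.comm -[LHS]/(ser_conv *%R _ _) ser_conv_rev.
by apply/funext=> n; apply: eq_bigr => i _; exact: fg.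
Qed.

Lemma ser_lrmapZ (K : fieldType) (A B : algType K) (f : {lrmorphism A -> B}) k x :
  ser_map f (k *: x) = k *: ser_map f x.
Proof. exact: linearZZ. Qed.

Lemma ser_pureE (K : fieldType) (A B : algType K) (x : {series A}) (y : {series B}) :
  x \oxs y = ser_map (tens_inl B) x * ser_map (@tens_inr K A B) y.
Proof. by apply/funext=> n; apply: eq_bigr => i _; rewrite tens_inl_inr. Qed.

Local Opaque ser_exp ser_ln tens_inl tens_inr tens_mor leg1 leg2 leg3 ser_map ser_mul
  tens_mul tens_add.

(** * The twist over an abstract graded Heisenberg algebra *)

Section Jordanian.
Variables (K : fieldType) (A : algType K).
Hypothesis char0 : [pchar K] =i pred0.
(** Abstract form of E_11 - E_NN, E_1N, E_1i and E_iN: the elements X, Y and Z satisfy Heisenberg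
    relations, graded by ad H with weights 1, 1 and 2. The series c stands for 2 xi. *)
Variables (c : {series K}) (D : {lrmorphism A -> A \ox A}).
Variables (I : finType) (H Z : A) (X Y : I -> A).
Hypothesis c0 : c 0%N = 0.
(** The left side is xi dc/dxi, so in characteristic 0 this says that c is a scalar multiple of xi.
    It makes W - 1 the derivative of W = 1 + c Z; this commutes with W, and [ser_lnK] applies. *)
Hypothesis cD : (fun n => c n *+ n) = c.
Hypothesis HZ : H * Z = Z * H + Z *+ 2.
Hypothesis HX : forall i, H * X i = X i * H + X i.
Hypothesis HY : forall i, H * Y i = Y i * H + Y i.
Hypothesis ZX : forall i, Z * X i = X i * Z.
Hypothesis ZY : forall i, Z * Y i = Y i * Z.
Hypothesis XX : forall i j, X i * X j = X j * X i.
Hypothesis YY : forall i j, Y i * Y j = Y j * Y i.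
Hypothesis XY : forall i j, X i * Y j = Y j * X i + Z *+ (i == j).
Let prim a := D a = tens_inl A a + tens_inr A a.
Hypothesis DH : prim H.
Hypothesis DZ : prim Z.
Hypothesis DX : forall i, prim (X i).
Hypothesis DY : forall i, prim (Y i).

Let W : {series A} := 1 + c *: Z%:S.
Let l := ser_ln W.
Let sg : {series A} := (2^-1)%:S *: l.

Definition ext_twist_factor : {series A \ox A} :=
  ser_exp (c *: \sum_i (X i)%:S \oxs ((Y i)%:S * ser_exp (- sg))).
Definition jordan_factor : {series A \ox A} := ser_exp (H%:S \oxs sg).
Definition ext_jordan_twist : {series A \ox A} := ext_twist_factor * jordan_factor.

Lemma jt_scal0 (B : algType K) (x : {series B}) : (c *: x) 0%N = 0.
Proof. by rewrite ser_scale_coef0 c0 scale0r. Qed.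

Lemma jt_W0 : W 0%N = 1.
Proof. by rewrite /W ser_coefD jt_scal0 addr0. Qed.

Lemma jt_l0 : l 0%N = 0. Proof. exact: ser_ln_coef0. Qed.
Lemma jt_sg0 : sg 0%N = 0. Proof. by rewrite /sg ser_scaleEn jt_l0 scaler0. Qed.

Lemma jt_two_neq0 : 2 != 0 :> K.
Proof. by move/pcharf0P: char0 => ->. Qed.

Lemma jt_sg2 : sg + sg = l.
Proof.
apply/funext=> n; rewrite ser_coefD /sg ser_scaleEn -scalerDl.
have -> : 2^-1 + 2^-1 = 1 :> K by rewrite -[RHS](mulfV jt_two_neq0) mulr_natl mulr2n.
by rewrite scale1r.
Qed.

Lemma jt_exp_l : ser_exp l = W.
Proof.
apply: (ser_lnK char0 jt_W0).
have jt_DW : ser_deriv W = W - 1.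
  rewrite /W [RHS]addrC addKr ser_derivD.
  rewrite (_ : ser_deriv 1 = 0) ?add0r; last first.
    by apply/funext=> -[|n] //; rewrite /ser_deriv mul0rn.
  apply/funext=> n; rewrite /ser_deriv.
  by rewrite !ser_scale_cst scalerMnl (congr1 (fun f => f n) cD).
by rewrite jt_DW mulrBr mulrBl mulr1 mul1r.
Qed.

Lemma jt_comm_W (g : {series A}) : g * Z%:S = Z%:S * g -> g * W = W * g.
Proof.
by move=> gZ; rewrite /W mulrDr mulrDl mulr1 mul1r -scalerAr gZ scalerAl.
Qed.

Lemma jt_comm_sg (g : {series A}) : g * Z%:S = Z%:S * g -> g * sg = sg * g.
Proof.
move=> gZ; rewrite /sg -scalerAr -scalerAl; congr (_ *: _).
apply: (ser_ln_conj jt_W0 jt_W0); exact: jt_comm_W.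
Qed.

Lemma jt_cstM_comm (a b : A) : a * b = b * a -> a%:S * b%:S = b%:S * a%:S.
Proof. by move=> ab; rewrite -!ser_cstM ab. Qed.

(** * The Jordanian factor *)

Local Notation IL := (ser_map (tens_inl A)).
Local Notation IR := (ser_map (@tens_inr K A A)).
Local Notation Phi := jordan_factor.

Lemma jt_ILRC x y : IL x * IR y = IR y * IL x.
Proof. by apply: ser_map_comm => a b; exact: tens_inC. Qed.

Lemma jt_PhiE : Phi = ser_exp (IL H%:S * IR sg).
Proof. by rewrite /jordan_factor ser_pureE. Qed.
Local Opaque jordan_factor.

Lemma jt_Hsg0 : (IL H%:S * IR sg) 0%N = 0.
Proof. by rewrite ser_coef0M !ser_mapE jt_sg0 raddf0 mulr0. Qed.

Lemma jordan_factor_inl x k : H * x = x * H + x *+ k ->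
  Phi * IL x%:S = IL x%:S * IR (ser_exp (sg *+ k)) * Phi.
Proof.
move=> Hx; rewrite jt_PhiE ser_map_exp; apply: ser_exp_weight => //.
- exact: jt_Hsg0.
- by rewrite !ser_mapE ser_coefMn jt_sg0 mul0rn raddf0.
- by rewrite rmorphMn /= mulrnAl mulrnAr mulrA -jt_ILRC -!mulrA.
have Hx' : H%:S * x%:S = x%:S * H%:S + x%:S *+ k :> {series A}.
  rewrite -!ser_cstM Hx ser_cstD; congr (_ + _).
  by apply/funext=> n; rewrite ser_coefMn /ser_cst; case: eqP; rewrite ?mul0rn.
rewrite -[LHS]mulrA -jt_ILRC [LHS]mulrA -rmorphM /= Hx' rmorphD rmorphMn rmorphM /=.
by rewrite mulrDr mulrDl -mulrA (rmorphMn IR) /= mulrnAl mulrnAr.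
Qed.

Lemma jordan_factor_inr y : y * sg = sg * y -> Phi * IR y = IR y * Phi.
Proof.
move=> ys; rewrite jt_PhiE; symmetry; apply: (ser_exp_conj jt_Hsg0 jt_Hsg0).
by rewrite mulrA -jt_ILRC -!mulrA -!rmorphM /= ys.
Qed.

Lemma jt_expZ : ser_exp (sg *+ 2) = W. Proof. by rewrite mulr2n jt_sg2 jt_exp_l. Qed.

Lemma jt_lC (g : {series A}) : g * Z%:S = Z%:S * g -> g * l = l * g.
Proof. by move=> gZ; apply: (ser_ln_conj jt_W0 jt_W0); exact: jt_comm_W. Qed.

Lemma jt_Zsg : Z%:S * sg = sg * Z%:S. Proof. exact: jt_comm_sg. Qed.

Lemma jt_DW : ser_map D W = 1 + c *: (IL Z%:S + IR Z%:S).
Proof.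
rewrite /W rmorphD rmorph1 /= ser_lrmapZ !(ser_lrmap_cst _ Z); congr (_ + _ *: _).
by rewrite -ser_cstD -DZ.
Qed.

Lemma jordan_factor_W : Phi * ser_map D W = IL W * IR W * Phi.
Proof.
rewrite jt_DW mulrDr mulr1 -scalerAr mulrDr (jordan_factor_inl HZ) jt_expZ.
rewrite (jordan_factor_inr jt_Zsg) -mulrDl scalerAl -[X in X + _]mul1r -mulrDl.
congr (_ * _).
have ILW : IL W = 1 + c *: IL Z%:S by rewrite /W rmorphD rmorph1 /= ser_lrmapZ.
have IRW : IR W = 1 + c *: IR Z%:S by rewrite /W rmorphD rmorph1 /= ser_lrmapZ.
rewrite ILW mulrDl mul1r -scalerAl {2}IRW -addrA -scalerDr.
by rewrite [IR _ + _]addrC.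
Qed.

Lemma jt_Phi_unit : Phi \is a GRing.unit.
Proof. by rewrite jt_PhiE; exact: (ser_exp_unit char0 jt_Hsg0). Qed.

(* [Phi * Delta l * Phi^-1] and [l (x) 1 + 1 (x) l] are commuting logarithms of the same
   series. *)
Lemma jordan_factor_ln : Phi * ser_map D l = (IL l + IR l) * Phi.
Proof.
have W20 : (IL W * IR W) 0%N = 1.
  by rewrite ser_coef0M !ser_mapE jt_W0 !rmorph1 mulr1.
have jt_D0 : ser_map D W 0%N = 1 by rewrite !ser_mapE jt_W0 rmorph1.
have E : Phi * ser_map D l = ser_ln (IL W * IR W) * Phi.
  by rewrite /l ser_map_ln; apply: (ser_ln_conj jt_D0 W20); exact: jordan_factor_W.
have il0 : IL l 0%N = 0 by rewrite !ser_mapE jt_l0 raddf0.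
have ir0 : IR l 0%N = 0 by rewrite !ser_mapE jt_l0 raddf0.
have m0 : (IL l + IR l) 0%N = 0 by rewrite ser_coefD il0 ir0 addr0.
have x0 : ser_map D l 0%N = 0 by rewrite !ser_mapE jt_l0 raddf0.
have Wl : W * l = l * W by apply: jt_lC; apply/esym/jt_comm_W.
apply: (ser_log_conj char0 jt_Phi_unit x0 W20 m0 _ E).
- rewrite mulrDl mulrDr; congr (_ + _).
    by rewrite mulrA -rmorphM -Wl rmorphM /= -!mulrA; congr (_ * _); rewrite jt_ILRC.
  by rewrite mulrA -jt_ILRC -!mulrA -!rmorphM /= Wl.
- by rewrite -ser_map_exp jt_exp_l jordan_factor_W.
- by rewrite (ser_expD char0 il0 ir0 (jt_ILRC _ _)) -!ser_map_exp jt_exp_l.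
Qed.

Lemma jordan_factor_sg : Phi * ser_map D sg = (IL sg + IR sg) * Phi.
Proof.
by rewrite /sg !ser_lrmapZ -scalerDr -scalerAr -scalerAl jordan_factor_ln.
Qed.

Let es := ser_exp sg.
Let ens := ser_exp (- sg).
Let y i := (Y i)%:S * ens.

Lemma jt_ens_es : ens * es = 1. Proof. exact: (ser_expN char0 jt_sg0). Qed.
Lemma jt_es_ens : es * ens = 1.
Proof. by have := @ser_expN _ char0 _ (- sg); rewrite opprK ser_coefN jt_sg0 oppr0; exact. Qed.

Lemma jt_Dsg0 : ser_map D sg 0%N = 0. Proof. by rewrite !ser_mapE jt_sg0 raddf0. Qed.

Lemma jordan_factor_ens : Phi * ser_map D ens = IL ens * IR ens * Phi.
Proof.
have i0 : IL (- sg) 0%N = 0 by rewrite !ser_mapE ser_coefN jt_sg0 oppr0 raddf0.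
have r0 : IR (- sg) 0%N = 0 by rewrite !ser_mapE ser_coefN jt_sg0 oppr0 raddf0.
have E : IL ens * IR ens = ser_exp (IL (- sg) + IR (- sg)).
  by rewrite /ens !ser_map_exp; exact: esym (ser_expD char0 i0 r0 (jt_ILRC _ _)).
transitivity (ser_exp (IL (- sg) + IR (- sg)) * Phi); last first.
  by congr (_ * _); rewrite E.
rewrite /ens ser_map_exp; apply: ser_exp_conj.
- by rewrite !ser_mapE ser_coefN jt_sg0 oppr0 raddf0.
- by rewrite ser_coefD i0 r0 addr0.
- by rewrite !rmorphN /= mulrN jordan_factor_sg -opprD mulNr.
Qed.

Lemma jt_sgY i : (Y i)%:S * sg = sg * (Y i)%:S.
Proof. by apply: jt_comm_sg; apply: jt_cstM_comm; rewrite ZY. Qed.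
Lemma jt_sgX i : (X i)%:S * sg = sg * (X i)%:S.
Proof. by apply: jt_comm_sg; apply: jt_cstM_comm; rewrite ZX. Qed.

Lemma jt_exp_comm (g : {series A}) : g * sg = sg * g -> g * es = es * g.
Proof. by move=> gs; exact: (ser_exp_conj jt_sg0 jt_sg0 gs). Qed.
Lemma jt_expN_comm (g : {series A}) : g * sg = sg * g -> g * ens = ens * g.
Proof.
have nsg0 : (- sg) 0%N = 0 by rewrite ser_coefN jt_sg0 oppr0.
by move=> gs; apply: (ser_exp_conj nsg0 nsg0); rewrite mulrN mulNr gs.
Qed.

(** The conjugated coproduct of [y i] is skew-primitive; its two terms are the sources of [tA] and
    [tD] in [jt_jordan_conjr]. *)
Lemma jordan_factor_y i : Phi * ser_map D (y i) = (IL (y i) + IL ens * IR (y i)) * Phi.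
Proof.
have DYs : ser_map D (Y i)%:S = IL (Y i)%:S + IR (Y i)%:S.
  by rewrite !(ser_lrmap_cst _ (Y i)) -ser_cstD -DY.
have HY1 : H * Y i = Y i * H + Y i *+ 1 by exact: HY.
rewrite /y rmorphM /= DYs mulrDl mulrDr !mulrA (jordan_factor_inl HY1) mulr1n.
rewrite (jordan_factor_inr (jt_sgY i)) -!mulrA jordan_factor_ens !mulrA -!mulrDl; congr (_ * _).
rewrite !rmorphM !mulrDl; congr (_ + _).
  have E : IR es * IR ens = 1 by rewrite -rmorphM /= jt_es_ens rmorph1.
  by rewrite -[IL _ * IR _ * IL _]mulrA -jt_ILRC -!mulrA E mulr1.
by rewrite -jt_ILRC !mulrA.
Qed.

(** * The twist equation in three legs *)

Local Notation t12 := (tens_mor (@leg_12C K A)).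
Local Notation t23 := (tens_mor (@leg_23C K A)).
Local Notation DI := (tens_mor (coprod_leg3C D)).
Local Notation ID := (tens_mor (leg1_coprodC D)).
Local Notation L1 := (ser_map (@leg1 K A)).
Local Notation L2 := (ser_map (@leg2 K A)).
Local Notation L3 := (ser_map (@leg3 K A)).

Lemma jt_L12l x : ser_map t12 (IL x) = L1 x.
Proof. by apply: ser_map_eq => a; rewrite tens_mor_inl. Qed.
Lemma jt_L12r x : ser_map t12 (IR x) = L2 x.
Proof. by apply: ser_map_eq => a; rewrite tens_mor_inr. Qed.
Lemma jt_L23l x : ser_map t23 (IL x) = L2 x.
Proof. by apply: ser_map_eq => a; rewrite tens_mor_inl. Qed.
Lemma jt_L23r x : ser_map t23 (IR x) = L3 x.
Proof. by apply: ser_map_eq => a; rewrite tens_mor_inr. Qed.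
Lemma jt_DIl x : ser_map DI (IL x) = ser_map t12 (ser_map D x).
Proof. by apply/funext=> n; rewrite !ser_mapE tens_mor_inl. Qed.
Lemma jt_DIr x : ser_map DI (IR x) = L3 x.
Proof. by apply: ser_map_eq => a; rewrite tens_mor_inr. Qed.
Lemma jt_IDl x : ser_map ID (IL x) = L1 x.
Proof. by apply: ser_map_eq => a; rewrite tens_mor_inl. Qed.
Lemma jt_IDr x : ser_map ID (IR x) = ser_map t23 (ser_map D x).
Proof. by apply/funext=> n; rewrite !ser_mapE tens_mor_inr. Qed.

Lemma jt_C12 u v : L1 u * L2 v = L2 v * L1 u.
Proof. by apply: ser_map_comm => a b; exact: leg_12C. Qed.
Lemma jt_C13 u v : L1 u * L3 v = L3 v * L1 u.
Proof. by apply: ser_map_comm => a b; exact: leg_13C. Qed.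
Lemma jt_C23 u v : L2 u * L3 v = L3 v * L2 u.
Proof. by apply: ser_map_comm => a b; exact: leg_23C. Qed.
Lemma jt_C1_23 x t : L1 x * ser_map t23 t = ser_map t23 t * L1 x.
Proof. by apply: ser_map_comm => a b; exact: tens_mor23_leg1C. Qed.
Lemma jt_C12_3 t x : ser_map t12 t * L3 x = L3 x * ser_map t12 t.
Proof. by apply: ser_map_comm => a b; exact: tens_mor12_leg3C. Qed.

Lemma jt_map0 (V V' : zmodType) (f : {additive V -> V'}) (x : {series V}) :
  x 0%N = 0 -> ser_map f x 0%N = 0.
Proof. by move=> x0; rewrite !ser_mapE x0 raddf0. Qed.
Lemma jt_M0 (R : nzRingType) (u v : {series R}) : v 0%N = 0 -> (u * v) 0%N = 0.
Proof. by move=> v0; rewrite ser_coef0M v0 mulr0. Qed.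
Lemma jt_D0 (R : zmodType) (u v : {series R}) : u 0%N = 0 -> v 0%N = 0 -> (u + v) 0%N = 0.
Proof. by move=> u0 v0; rewrite ser_coefD u0 v0 addr0. Qed.

Lemma jt_DHs : ser_map D H%:S = IL H%:S + IR H%:S.
Proof. by rewrite !(ser_lrmap_cst _ H) -ser_cstD -DH. Qed.
Lemma jt_DXs i : ser_map D (X i)%:S = IL (X i)%:S + IR (X i)%:S.
Proof. by rewrite !(ser_lrmap_cst _ (X i)) -ser_cstD -DX. Qed.

Definition ext_term (a b d : {series A}) := L1 a * L2 b * L3 d.

Lemma ext_termM a b d a' b' d' :
  ext_term a b d * ext_term a' b' d' = ext_term (a * a') (b * b') (d * d').
Proof.
rewrite /ext_term !rmorphM /= -!mulrA; congr (_ * _).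
rewrite [L3 d * (L1 a' * _)]mulrA -jt_C13 -mulrA [LHS]mulrA -jt_C12 -mulrA.
by congr (_ * (_ * _)); rewrite mulrA -jt_C23 mulrA.
Qed.

Lemma ext_term_comm a b d a' b' d' : a * a' = a' * a -> b * b' = b' * b ->
  d * d' = d' * d -> ext_term a b d * ext_term a' b' d' = ext_term a' b' d' * ext_term a b d.
Proof. by move=> aa bb dd; rewrite !ext_termM aa bb dd. Qed.

Lemma jt_ext_term_eqs (a b : {series A}) :
  (((L1 a * L2 b)%R = ext_term a b 1) * ((L1 a * L3 b)%R = ext_term a 1 b) *
   ((L2 a * L3 b)%R = ext_term 1 a b))%type.
Proof. by rewrite /ext_term !rmorph1 !mulr1 mul1r. Qed.

Lemma jt_ext_term0 a b d : b 0%N = 0 \/ d 0%N = 0 -> ext_term a b d 0%N = 0.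
Proof.
rewrite /ext_term !ser_coef0M => -[] /(@jt_map0 _ _ _ _) E; first by rewrite E mulr0 mul0r.
by rewrite E mulr0.
Qed.

(** This and [jt_twistr] reach the same value, here because H is primitive, there because
    conjugation by Phi makes the coproduct of sigma primitive. Together they are the twist equation
    of Phi. *)
Lemma jt_twistl : ser_map t12 Phi * ser_map DI Phi =
  ser_exp (L1 H%:S * (L2 sg + L3 sg)) * ser_map t23 Phi.
Proof.
rewrite jt_PhiE !ser_map_exp !rmorphM /= jt_L12l jt_L12r jt_L23l jt_L23r jt_DIl jt_DIr jt_DHs.
rewrite rmorphD /= jt_L12l jt_L12r mulrDl mulrDr !jt_ext_term_eqs.
have z1 : ext_term H%:S 1 sg 0%N = 0 by apply: jt_ext_term0; right; exact: jt_sg0.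
have z2 : ext_term 1 H%:S sg 0%N = 0 by apply: jt_ext_term0; right; exact: jt_sg0.
have z3 : ext_term H%:S sg 1 0%N = 0 by apply: jt_ext_term0; left; exact: jt_sg0.
have c1 : ext_term H%:S 1 sg * ext_term 1 H%:S sg = ext_term 1 H%:S sg * ext_term H%:S 1 sg.
  by apply: ext_term_comm; rewrite ?mulr1 ?mul1r.
have c2 : ext_term H%:S sg 1 * ext_term H%:S 1 sg = ext_term H%:S 1 sg * ext_term H%:S sg 1.
  by apply: ext_term_comm; rewrite ?mulr1 ?mul1r.
by rewrite (ser_expD char0 z1 z2 c1) (ser_expD char0 z3 z1 c2) mulrA.
Qed.

Lemma jt_twistr : ser_map t23 Phi * ser_map ID Phi =
  ser_exp (L1 H%:S * (L2 sg + L3 sg)) * ser_map t23 Phi.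
Proof.
rewrite {2}jt_PhiE (ser_map_exp ID) rmorphM /= jt_IDl jt_IDr; apply: ser_exp_conj.
- by apply/jt_M0/jt_map0; exact: jt_Dsg0.
- by apply/jt_M0/jt_D0; apply: jt_map0; exact: jt_sg0.
rewrite mulrA -jt_C1_23 -!mulrA; congr (_ * _).
by rewrite -rmorphM jordan_factor_sg rmorphM rmorphD /= jt_L23l jt_L23r.
Qed.

Let sum_term (a b d : I -> {series A}) := c *: \sum_i ext_term (a i) (b i) (d i).

Lemma jt_sum_term_comm a b d a' b' d' :
  (forall i j, a i * a' j = a' j * a i) -> (forall i j, b i * b' j = b' j * b i) ->
  (forall i j, d i * d' j = d' j * d i) ->
  sum_term a b d * sum_term a' b' d' = sum_term a' b' d' * sum_term a b d.
Proof.
move=> aa bb dd; rewrite /sum_term -!scalerAl -!scalerAr !mulr_suml; congr (_ *: (_ *: _)).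
under eq_bigr do rewrite mulr_sumr.
under [RHS]eq_bigr do rewrite mulr_sumr.
rewrite exchange_big; apply: eq_bigr => j _; apply: eq_bigr => i _.
exact: ext_term_comm.
Qed.

Let x i : {series A} := (X i)%:S.
Let tA := sum_term x y (fun=> 1).
Let tB := sum_term x (fun=> es) y.
Let tC := sum_term (fun=> 1) x y.
Let tD := sum_term x (fun=> ens) y.

Lemma jt_xx i j : x i * x j = x j * x i. Proof. exact: jt_cstM_comm. Qed.
Lemma jt_x1 i : x i * 1 = 1 * x i. Proof. by rewrite mulr1 mul1r. Qed.
Lemma jt_yy i j : y i * y j = y j * y i.
Proof.
have E k m : y k * y m = (Y k)%:S * (Y m)%:S * (ens * ens).
  by rewrite /y mulrA -[_ * ens * _]mulrA -(jt_expN_comm (jt_sgY m)) !mulrA.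
by rewrite !E (jt_cstM_comm (YY i j)).
Qed.
Lemma jt_es_es : es * ens = ens * es. Proof. by rewrite jt_es_ens jt_ens_es. Qed.
Lemma jt_yes i : y i * es = es * y i.
Proof. by rewrite /y -mulrA -jt_es_es mulrA (jt_exp_comm (jt_sgY i)) mulrA. Qed.
Lemma jt_yens i : y i * ens = ens * y i.
Proof. by rewrite /y {1}(jt_expN_comm (jt_sgY i)) mulrA. Qed.
Lemma jt_xes i : x i * es = es * x i. Proof. exact: jt_exp_comm (jt_sgX i). Qed.
Lemma jt_xens i : x i * ens = ens * x i. Proof. exact: jt_expN_comm (jt_sgX i). Qed.

Lemma jt_xy i j : y i * x j = x j * y i - (Z%:S * ens) *+ (j == i).
Proof.
rewrite /y -mulrA -jt_xens !mulrA -!ser_cstM XY ser_cstD mulrDl.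
rewrite [X in _ + X - _](_ : _ = (Z%:S * ens) *+ (j == i)) ?addrK //.
by case: eqP => // _; rewrite mulr0n [ser_cst 0](_ : _ = 0) ?mul0r //; apply/funext; case.
Qed.

Lemma jt_ens_es_diff : ens - es = - (c *: (Z%:S * ens)).
Proof.
have -> : es = W * ens.
  by rewrite -jt_expZ mulr2n (ser_expD char0 jt_sg0 jt_sg0 erefl) -mulrA jt_es_ens mulr1.
by rewrite /W mulrDl mul1r opprD addrA subrr add0r scalerAl.
Qed.

Lemma jt_termB a b b' d : ext_term a (b - b') d = ext_term a b d - ext_term a b' d.
Proof. by rewrite /ext_term rmorphB mulrBr mulrBl. Qed.
Lemma jt_termZ a k b d : ext_term a (k *: b) d = k *: ext_term a b d.
Proof. by rewrite /ext_term ser_lrmapZ -scalerAr -scalerAl. Qed.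

(** Only the diagonal commutators of [y i] with [x i] contribute, each equal to -Z e^-sigma; one of
    the two factors c is then absorbed by [jt_ens_es_diff]. *)
Lemma jt_AC : tA * tC = tC * tA + (tD - tB).
Proof.
rewrite /tA /tC /tD /tB /sum_term -!scalerAl -!scalerAr -scalerBr -!scalerDr.
congr (_ *: _); rewrite !mulr_suml.
under eq_bigr do rewrite mulr_sumr.
under [X in _ = _ *: X + _]eq_bigr do rewrite mulr_sumr.
rewrite [X in _ = _ *: X + _]exchange_big !scaler_sumr -sumrB -big_split /=.
apply: eq_bigr => i _; rewrite -jt_termB jt_ens_es_diff -[- (c *: _)]scalerN jt_termZ -scalerDr.
congr (_ *: _).
rewrite -[- _]sub0r jt_termB.
under eq_bigr do rewrite ext_termM mulr1 mul1r jt_xy jt_termB.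
under [X in _ = X + _]eq_bigr do rewrite ext_termM mulr1 mul1r.
rewrite sumrB; congr (_ + _); rewrite (bigD1 i) //= eqxx mulr1n big1 ?addr0.
  by rewrite [ext_term _ 0 _](_ : _ = 0) ?sub0r // /ext_term rmorph0 mulr0 mul0r.
by move=> j /negPf ->; rewrite mulr0n /ext_term rmorph0 mulr0 mul0r.
Qed.

Lemma ext_jordan_exchange : ser_exp tA * ser_exp (tB + tC) = ser_exp tC * ser_exp (tA + tD).
Proof.
apply: (ser_exp_exchange char0 _ _ _ _ jt_AC); try exact: jt_scal0.
- by apply: jt_sum_term_comm => i j; [exact: jt_xx|exact: jt_yes|rewrite mulr1 mul1r].
- by apply: jt_sum_term_comm => i j; [exact: jt_xx|exact: jt_yens|rewrite mulr1 mul1r].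
- by apply: jt_sum_term_comm => i j; [exact: jt_xx|exact: jt_es_es|exact: jt_yy].
- by apply: jt_sum_term_comm => i j; [exact: jt_x1|exact/esym/jt_xes|exact: jt_yy].
- by apply: jt_sum_term_comm => i j; [exact: jt_x1|exact/esym/jt_xens|exact: jt_yy].
Qed.

Lemma jt_twist_factorE : ext_twist_factor = ser_exp (c *: \sum_i IL (x i) * IR (y i)).
Proof. by rewrite /ext_twist_factor; under eq_bigr do rewrite ser_pureE. Qed.

(** As X_i has weight 1, conjugation by Phi turns its coproduct into X_i (x) e^sigma + 1 (x) X_i;
    the two terms give [tB] and [tC]. *)
Lemma jt_jordan_conjl : ser_map t12 Phi * ser_map DI ext_twist_factor =
  ser_exp (tB + tC) * ser_map t12 Phi.
Proof.
rewrite jt_twist_factorE (ser_map_exp DI); apply: ser_exp_conj.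
- by apply: jt_map0; exact: jt_scal0.
- by apply: jt_D0; exact: jt_scal0.
rewrite ser_lrmapZ raddf_sum /tB /tC /sum_term -scalerDr -big_split -scalerAr -scalerAl.
congr (_ *: _); rewrite mulr_sumr mulr_suml; apply: eq_bigr => i _ /=.
rewrite rmorphM /= jt_DIl jt_DIr jt_DXs mulrA -rmorphM mulrDr.
have HX1 : H * X i = X i * H + X i *+ 1 by exact: HX.
rewrite (jordan_factor_inl HX1) mulr1n (jordan_factor_inr (jt_sgX i)) -mulrDl rmorphM -mulrA jt_C12_3 mulrA.
congr (_ * _); rewrite rmorphD rmorphM /= jt_L12l !jt_L12r mulrDl.
by rewrite /ext_term rmorph1 mul1r.
Qed.

Lemma jt_jordan_conjr : ser_map t23 Phi * ser_map ID ext_twist_factor =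
  ser_exp (tA + tD) * ser_map t23 Phi.
Proof.
rewrite jt_twist_factorE (ser_map_exp ID); apply: ser_exp_conj.
- by apply: jt_map0; exact: jt_scal0.
- by apply: jt_D0; exact: jt_scal0.
rewrite ser_lrmapZ raddf_sum /tA /tD /sum_term -scalerDr -big_split -scalerAr -scalerAl.
congr (_ *: _); rewrite mulr_sumr mulr_suml; apply: eq_bigr => i _ /=.
rewrite rmorphM /= jt_IDl jt_IDr mulrA -jt_C1_23 -mulrA -rmorphM jordan_factor_y rmorphM mulrA.
congr (_ * _); rewrite rmorphD rmorphM /= !jt_L23l jt_L23r mulrDr mulrA.
by rewrite /ext_term rmorph1 mulr1.
Qed.

Lemma ext_jordan_twistP :
  ser_map t12 ext_jordan_twist * ser_map DI ext_jordan_twist =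
  ser_map t23 ext_jordan_twist * ser_map ID ext_jordan_twist.
Proof.
(* Here f and p stand for E_12 and Phi_12, f1 and p1 for the images of E and Phi under Delta (x) id,
   and g for e^(B + C); primes denote the other side, with g' for e^(A + D), and h is the common
   value of the twist equation of Phi. *)
have assemble (R : nzRingType) (f p f' p' f1 p1 f1' p1' g g' h : R) :
    p * f1 = g * p -> p * p1 = h -> p' * f1' = g' * p' -> p' * p1' = h ->
    f * g = f' * g' -> f * p * (f1 * p1) = f' * p' * (f1' * p1').
  move=> e1 e2 e3 e4 e5.
  by rewrite -mulrA [p * _]mulrA e1 -mulrA e2 mulrA e5 -[RHS]mulrA [p' * _]mulrA e3
    -[in RHS]mulrA e4 mulrA.
rewrite /ext_jordan_twist !rmorphM /=.
apply: (assemble _ _ _ _ _ _ _ _ _ _ _ _ jt_jordan_conjl jt_twistl jt_jordan_conjr jt_twistr).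
have e12 : ser_map t12 ext_twist_factor = ser_exp tA.
  rewrite jt_twist_factorE (ser_map_exp t12) ser_lrmapZ raddf_sum /tA /sum_term /=.
  under eq_bigr do rewrite rmorphM /= jt_L12l jt_L12r jt_ext_term_eqs.
  exact: erefl.
have e23 : ser_map t23 ext_twist_factor = ser_exp tC.
  rewrite jt_twist_factorE (ser_map_exp t23) ser_lrmapZ raddf_sum /tC /sum_term /=.
  under eq_bigr do rewrite rmorphM /= jt_L23l jt_L23r jt_ext_term_eqs.
  exact: erefl.
apply: (etrans (congr1 (fun u => u * _) e12)).
exact: (etrans ext_jordan_exchange (congr1 (fun u => u * _) (esym e23))).
Qed.

Lemma ext_jordan_twist_unit : ext_jordan_twist \is a GRing.unit.
Proof.
have u1 : ext_twist_factor \is a GRing.unit by exact: (ser_exp_unit char0 (jt_scal0 _)).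
exact: etrans (unitrMl _ jt_Phi_unit) u1.
Qed.

Lemma ext_jordan_twist_coef0 : ext_jordan_twist 0%N = 1.
Proof. by rewrite /ext_jordan_twist ser_coef0M jt_PhiE /ext_twist_factor !ser_exp_coef0 mulr1. Qed.

(** * Counit normalization of the twist *)

Variable e : {lrmorphism A -> K^o}.
Hypothesis eH : e H = 0.
Hypothesis eZ : e Z = 0.
Hypothesis eX : forall i, e (X i) = 0.
Hypothesis eY : forall i, e (Y i) = 0.
Local Notation el := (tens_mor (counit_algC e)).
Local Notation er := (tens_mor (counit_algC' e)).
Local Notation ce := (ser_map (counit_alg e)).

Lemma jt_ce0 a : e a = 0 -> ce a%:S = 0.
Proof.
move=> ea; rewrite ser_lrmap_cst /= /counit_alg ea scale0r.
by apply/funext; case.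
Qed.
Lemma jt_elE u v : ser_map el (IL u * IR v) = ce u * v.
Proof.
rewrite rmorphM /=; congr (_ * _); first by apply: ser_map_eq => a; rewrite tens_mor_inl.
by apply/funext=> n; rewrite !ser_mapE tens_mor_inr.
Qed.
Lemma jt_erE u v : ser_map er (IL u * IR v) = u * ce v.
Proof.
rewrite rmorphM /=; congr (_ * _); last by apply: ser_map_eq => a; rewrite tens_mor_inr.
by apply/funext=> n; rewrite !ser_mapE tens_mor_inl.
Qed.

Lemma ext_jordan_counitl : ser_map el ext_jordan_twist = 1.
Proof.
have E1 : ser_map el ext_twist_factor = 1.
  rewrite jt_twist_factorE (ser_map_exp el) ser_lrmapZ raddf_sum /=.
  by rewrite big1 ?scaler0 ?ser_exp0 // => i _; rewrite jt_elE jt_ce0 ?mul0r.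
have E2 : ser_map el Phi = 1.
  by rewrite jt_PhiE (ser_map_exp el) jt_elE jt_ce0 // mul0r ser_exp0.
exact: etrans (rmorphM _ _ _) (etrans (congr2 *%R E1 E2) (mulr1 _)).
Qed.

Lemma ext_jordan_counitr : ser_map er ext_jordan_twist = 1.
Proof.
have ces : ce sg = 0.
  rewrite /sg ser_lrmapZ /l ser_map_ln /W rmorphD rmorph1 /= ser_lrmapZ jt_ce0 // scaler0 addr0.
  by rewrite ser_ln1 scaler0.
have E1 : ser_map er ext_twist_factor = 1.
  rewrite jt_twist_factorE (ser_map_exp er) ser_lrmapZ raddf_sum /=.
  rewrite big1 ?scaler0 ?ser_exp0 // => i _.
  by rewrite jt_erE /y rmorphM /= jt_ce0 // mul0r mulr0.
have E2 : ser_map er Phi = 1.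
  by rewrite jt_PhiE (ser_map_exp er) jt_erE ces mulr0 ser_exp0.
exact: etrans (rmorphM _ _ _) (etrans (congr2 *%R E1 E2) (mulr1 _)).
Qed.

End Jordanian.

(** * The Hopf algebra U(L) *)

Section ConverseAlgebra.
Variables (K : fieldType) (A : algType K).

HB.instance Definition _ := GRing.Zmodule_isLmodule.Build K A^c
  (@scalerA K A) (@scale1r K A) (@scalerDr K A) (fun v a b => @scalerDl K A v a b).

Lemma converse_scaleAl (a : K) (x y : A^c) : a *: (x * y) = (a *: x) * y.
Proof. exact: (@scalerAr K A). Qed.
HB.instance Definition _ := GRing.Lmodule_isLalgebra.Build K A^c converse_scaleAl.

Lemma converse_scaleAr (a : K) (x y : A^c) : a *: (x * y) = x * (a *: y).
Proof. exact: (@scalerAl K A). Qed.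
HB.instance Definition _ := GRing.Lalgebra_isAlgebra.Build K A^c converse_scaleAr.
End ConverseAlgebra.

Section EnvelopingData.
Variables (K : fieldType) (L : lieAlgType K).
Local Notation A := (envalg L).
Local Notation D := (@env_coprod K L).
Local Notation e := (@env_counit K L).

HB.instance Definition _ := GRing.isLinear.Build K A (A \ox A)%type _ D
  (env_lift_linear (env_coprod_lie_morphism L)).
HB.instance Definition _ := GRing.isMonoidMorphism.Build A (A \ox A)%type D
  (env_lift_monoid (env_coprod_lie_morphism L)).
HB.instance Definition _ := GRing.isLinear.Build K A K^o _ e
  (env_lift_linear (env_counit_lie_morphism L)).
HB.instance Definition _ := GRing.isMonoidMorphism.Build A K^o e
  (env_lift_monoid (env_counit_lie_morphism L)).

Lemma env_coprod_inj (x : L) : D (env_inj x) = tens_inl A (env_inj x) + tens_inr A (env_inj x).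
Proof. exact: env_lift_inj (env_coprod_lie_morphism L) x. Qed.

Lemma env_counit_inj (x : L) : e (env_inj x) = 0.
Proof. exact: env_lift_inj (env_counit_lie_morphism L) x. Qed.

(** The antipode reverses products, so it is obtained from the universal property of U(L) with
    values in the opposite algebra, which has the same underlying vector space. *)
Lemma env_antipode_lie_morphism : lie_morphism (fun x : L => - env_inj x : A^c).
Proof.
have [il iM] := env_inj_lie_morphism L.
split=> [a x y|x y]; first by rewrite il opprD -scalerN.
have cM (u v : A^c) : u * v = (v : A) * (u : A) by [].
by rewrite iM opprB !cM !mulrNN.
Qed.

Definition env_antipode : A -> A := env_lift (fun x : L => - env_inj x : A^c).

Lemma env_antipode_linear : linear env_antipode.
Proof. exact: env_lift_linear env_antipode_lie_morphism. Qed.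
HB.instance Definition _ := GRing.isLinear.Build K A A _ env_antipode env_antipode_linear.

Lemma env_antipode1 : env_antipode 1 = 1.
Proof. by have [] := env_lift_monoid env_antipode_lie_morphism. Qed.

Lemma env_antipodeM a b : env_antipode (a * b) = env_antipode b * env_antipode a.
Proof. by have [_] := env_lift_monoid env_antipode_lie_morphism; exact. Qed.

Lemma env_antipode_inj x : env_antipode (env_inj x) = - env_inj x.
Proof. exact: env_lift_inj env_antipode_lie_morphism x. Qed.

Lemma lrmorph_env_ext (C : algType K) (f g : {lrmorphism A -> C}) :
  (forall x, f (env_inj x) = g (env_inj x)) -> f =1 g.
Proof.
move=> fg; elim/env_ind => [a|//|x y Ex Ey|x y Ex Ey].
- by rewrite !linearZ !rmorph1.
- by rewrite !rmorphD /= Ex Ey.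
- by rewrite !rmorphM /= Ex Ey.
Qed.

Lemma env_coprodA a :
  tens_mor (coprod_leg3C D) (D a) = tens_mor (leg1_coprodC D) (D a).
Proof.
have ext := @lrmorph_env_ext _ (tens_mor (coprod_leg3C D) \o D) (tens_mor (leg1_coprodC D) \o D).
move: a; apply: ext => x; rewrite /= env_coprod_inj !raddfD /=.
rewrite !tens_mor_inl !tens_mor_inr /= env_coprod_inj !raddfD /=.
by rewrite !tens_mor_inl !tens_mor_inr addrA.
Qed.

Lemma env_coprod_flip a : flip (D a) = D a.
Proof.
rewrite flipE.
have ext := @lrmorph_env_ext _ (tens_mor (fun a b => esym (tens_inC b a)) \o D) D.
move: a; apply: ext => x; rewrite /= env_coprod_inj raddfD /=.
by rewrite tens_mor_inl tens_mor_inr addrC.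
Qed.

Lemma counit_alg_inj (x : L) : counit_alg e (env_inj x) = 0.
Proof. by rewrite /counit_alg /= env_counit_inj scale0r. Qed.

Lemma env_counitl a : tens_mor (counit_algC e) (D a) = a.
Proof.
have ext := @lrmorph_env_ext _ (tens_mor (counit_algC e) \o D) idfun.
move: a; apply: ext => x; rewrite /= env_coprod_inj raddfD /=.
by rewrite tens_mor_inl tens_mor_inr /= counit_alg_inj add0r.
Qed.

Lemma env_counitr a : tens_mor (counit_algC' e) (D a) = a.
Proof.
have ext := @lrmorph_env_ext _ (tens_mor (counit_algC' e) \o D) idfun.
move: a; apply: ext => x; rewrite /= env_coprod_inj raddfD /=.
by rewrite tens_mor_inl tens_mor_inr /= counit_alg_inj addr0.
Qed.

(** The axiom passes to products through the action: 1 <| D(x y) = (1 <| D x) <| D y = eps(x) (1 <|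
    D y). It is then enough to check scalars and generators. *)
Lemma env_antipodel a : antipode_actr env_antipode 1 (D a) = counit_alg e a.
Proof.
elim/env_ind: a => [a|x|x y Ex Ey|x y Ex Ey].
- rewrite !linearZ !rmorph1 /= -[1 in X in antipode_actr _ _ X]/(1 \ox 1).
  by rewrite antipode_actr_pure /= env_antipode1 !mulr1.
- rewrite env_coprod_inj raddfD /= !antipode_actr_pure /= env_antipode1 env_antipode_inj.
  by rewrite !mulr1 mul1r addNr counit_alg_inj.
- by rewrite !raddfD /= Ex Ey.
- rewrite !rmorphM /= -antipode_actrM ?Ex; last exact: env_antipodeM.
  by rewrite /counit_alg antipode_actrZ Ey /counit_alg mulr_algl.
Qed.

Lemma env_antipoder a : antipode_actl env_antipode 1 (D a) = counit_alg e a.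
Proof.
elim/env_ind: a => [a|x|x y Ex Ey|x y Ex Ey].
- rewrite !linearZ !rmorph1 /= -[1 in X in antipode_actl _ _ X]/(1 \ox 1).
  by rewrite antipode_actl_pure /= env_antipode1 !mulr1.
- rewrite env_coprod_inj raddfD /= !antipode_actl_pure /= env_antipode1 env_antipode_inj.
  by rewrite !mulr1 mul1r addrN counit_alg_inj.
- by rewrite !raddfD /= Ex Ey.
- rewrite !rmorphM /= -antipode_actlM ?Ey; last exact: env_antipodeM.
  by rewrite /counit_alg antipode_actlZ Ex /counit_alg mulr_algl scalerA mulrC -scalerA -mulr_algl.
Qed.

End EnvelopingData.

(** * The relations of sl(N) *)

Section SlRelations.
Variables (K : fieldType) (N : nat).
Local Notation M := (mxunit K N).
Local Notation inj A := (env_inj (sl_of A)).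

(** The bounds on j matter: [mxunit] is the zero matrix when an index lies outside 1..N. *)
Lemma mxunitM i j k l : (0 < j <= N)%N -> M i j *m M k l = M i l *+ (j == k).
Proof.
move=> /andP[j0 jN]; apply/matrixP=> a b; rewrite mxE mulmxnE mxE.
have jN' : (j.-1 < N)%N by rewrite prednK.
rewrite (bigD1 (Ordinal jN')) //= big1 ?addr0 => [|m mj]; rewrite !mxE /=.
  rewrite prednK // eqxx andbT.
  by case: (j == k); case: (_ == i); case: (_ == l); rewrite /= ?mulr1 ?mulr0 ?mul0r.
suff /negPf -> : m.+1 != j by rewrite andbF mul0r.
by move: mj; rewrite -val_eqE /= -eqSS prednK.
Qed.

(** The trace conditions guard against the default value 0 of [sl_of]. The multiplicity n covers
    both the weights of ad H and the Kronecker symbol in [X_i, Y_j]. *)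
Lemma env_inj_sl_comm (A B C : 'M[K]_N) n : \tr A = 0 -> \tr B = 0 -> \tr C = 0 ->
  A *m B - B *m A = C *+ n -> inj A * inj B = inj B * inj A + inj C *+ n.
Proof.
move=> tA tB tC AB; have [il iM] := env_inj_lie_morphism (sl K N).
have iMn (x : sl K N) m : env_inj (x *+ m) = env_inj x *+ m.
  have iD u v : env_inj (u + v) = env_inj u + env_inj v :> envalg (sl K N).
    by rewrite -[u]scale1r il !scale1r.
  have i0 : env_inj 0 = 0 :> envalg (sl K N).
    by apply: (addrI (env_inj 0)); rewrite -iD !addr0.
  by elim: m => [|m IHm]; rewrite ?mulr0n // !mulrS iD IHm.
have -> : inj A * inj B = inj B * inj A + env_inj (lie (sl_of A) (sl_of B)).
  by rewrite iM addrC subrK.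
congr (_ + _); rewrite -iMn; congr env_inj; apply: val_inj.
by rewrite raddfMn /= !val_sl_of.
Qed.

Lemma env_inj_sl_comm0 (A B : 'M[K]_N) : \tr A = 0 -> \tr B = 0 ->
  A *m B = B *m A -> inj A * inj B = inj B * inj A.
Proof.
move=> tA tB AB; have := @env_inj_sl_comm A B 0 0 tA tB; rewrite mxtrace0 mulr0n addr0.
by apply; rewrite // AB subrr.
Qed.
End SlRelations.
Lemma iota_shift (V : nmodType) (N : nat) (F : nat -> V) :
  \sum_(2 <= i < N) F i = \sum_(i < N - 2) F (i + 2)%N.
Proof. by rewrite -{1}[2%N]add0n big_addn big_mkord. Qed.

(** * Specialization to sl(N) *)

Section Main.
Variables (K : fieldType) (N : nat).
Hypothesis char0 : [pchar K] =i pred0.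
Hypothesis N2 : (2 <= N)%N.
Local Notation A := (envalg (sl K N)).
Local Notation M := (mxunit K N).
Local Notation H := (Hmx K N : A).
Local Notation Z := (Emx K N 1 N : A).
(** Ordinals start at 0, so the shift by 2 gives the indices 2, ..., N - 1. For N = 2 there are
    none, and the twist reduces to its Jordanian factor. *)
Let X (i : 'I_(N - 2)) : A := Emx K N 1 (i + 2).
Let Y (i : 'I_(N - 2)) : A := Emx K N (i + 2) N.
Let c : {series K} := 2 * ser_xi.

Lemma two_xiE n : c n = ((n == 1%N) * 2)%:R.
Proof.
rewrite /c mulr_natl ser_coefMn /ser_xi; case: eqP => _ //=.
by rewrite mul0rn.
Qed.
Lemma two_xi0 : c 0%N = 0. Proof. by rewrite two_xiE. Qed.
Lemma two_xi_deriv : (fun n => c n *+ n) = c.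
Proof. by apply/funext=> -[|[|n]]; rewrite two_xiE // mul0rn. Qed.

Let N1 : (0 < N <= N)%N. Proof. lia. Qed.
Let o1 : (0 < 1 <= N)%N. Proof. lia. Qed.
Let NE1 : (1 == N)%N = false. Proof. lia. Qed.
Let NE1' : (N == 1)%N = false. Proof. lia. Qed.
Let iE (i : 'I_(N - 2)) : ((1 == i + 2)%N = false) * ((i + 2 == 1)%N = false) *
  ((i + 2 == N)%N = false) * ((N == i + 2)%N = false).
Proof. have := ltn_ord i; do !split; lia. Qed.
Let oi (i : 'I_(N - 2)) : (0 < i + 2 <= N)%N. Proof. have := ltn_ord i; lia. Qed.

Let trZ : \tr (M 1 N) = 0. Proof. by apply: mxtrace_mxunit_neq; rewrite NE1. Qed.
Let trX (i : 'I_(N - 2)) : \tr (M 1 (i + 2)) = 0. 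
Proof. by apply: mxtrace_mxunit_neq; rewrite (iE i). Qed.
Let trY (i : 'I_(N - 2)) : \tr (M (i + 2) N) = 0. 
Proof. by apply: mxtrace_mxunit_neq; rewrite (iE i). Qed.
Let trH : \tr (M 1 1 - M N N) = 0. Proof. exact: mxtrace_mxunitB. Qed.

Lemma slHZ : H * Z = Z * H + Z *+ 2.
Proof.
apply: env_inj_sl_comm => //.
by rewrite mulmxBl mulmxBr !mxunitM ?eqxx ?NE1 ?NE1' //= !mulr0n !mulr1n subr0 sub0r opprK.
Qed.
Lemma slHX i : H * X i = X i * H + X i.
Proof.
apply: (@env_inj_sl_comm K N _ _ _ 1) => //.
by rewrite mulmxBl mulmxBr !mxunitM // ?eqxx ?NE1 ?NE1' ?iE //= !mulr0n !mulr1n !subr0.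
Qed.
Lemma slHY i : H * Y i = Y i * H + Y i.
Proof.
apply: (@env_inj_sl_comm K N _ _ _ 1) => //.
by rewrite mulmxBl mulmxBr !mxunitM // ?eqxx ?NE1 ?NE1' ?iE //= !mulr0n !mulr1n ?subr0 ?sub0r ?opprK.
Qed.
Lemma slZX i : Z * X i = X i * Z.
Proof. by apply: env_inj_sl_comm0; rewrite // !mxunitM // ?NE1' ?iE. Qed.
Lemma slZY i : Z * Y i = Y i * Z.
Proof. by apply: env_inj_sl_comm0; rewrite // !mxunitM // ?NE1' ?iE. Qed.
Lemma slXX i j : X i * X j = X j * X i.
Proof. by apply: env_inj_sl_comm0; rewrite // !mxunitM // ?iE. Qed.
Lemma slYY i j : Y i * Y j = Y j * Y i.
Proof. by apply: env_inj_sl_comm0; rewrite // !mxunitM // ?iE. Qed.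
Lemma slXY i j : X i * Y j = Y j * X i + Z *+ (i == j).
Proof.
apply: env_inj_sl_comm => //.
by rewrite !mxunitM // NE1' mulr0n subr0 eqn_add2r.
Qed.

Lemma jordanian_twistE : jordanian_twist K N = ext_jordan_twist c H Z X Y.
Proof.
rewrite /ext_jordan_twist /ext_twist_factor /jordan_factor.
rewrite -(iota_shift N (fun i => (Emx K N 1 i)%:S \oxs ((Emx K N i N)%:S * _))).
exact: erefl.
Qed.

Local Notation F := (jordanian_twist K N).
Local Notation D := (@env_coprod K (sl K N)).

Lemma jordanian_twist_unit : F \is a GRing.unit.
Proof. by rewrite jordanian_twistE; exact: (ext_jordan_twist_unit char0 _ _ _ _ two_xi0). Qed.

Lemma jordanian_twist_coef0 : F 0%N = 1.
Proof. by rewrite jordanian_twistE; exact: ext_jordan_twist_coef0. Qed.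

Lemma jordanian_twistP :
  ser_map (tens_mor (@leg_12C K A)) F * ser_map (tens_mor (coprod_leg3C D)) F =
  ser_map (tens_mor (@leg_23C K A)) F * ser_map (tens_mor (leg1_coprodC D)) F.
Proof.
have prim (x : sl K N) := env_coprod_inj x.
rewrite jordanian_twistE; exact: (ext_jordan_twistP char0 two_xi0 two_xi_deriv slHZ
  slHX slHY slZX slZY slXX slYY slXY (prim _) (prim _) (fun=> prim _) (fun=> prim _)).
Qed.

Lemma jordanian_twist_counitl :
  ser_map (tens_mor (counit_algC (@env_counit K (sl K N)))) F = 1.
Proof.
have e0 (x : sl K N) := env_counit_inj x.
by rewrite jordanian_twistE; exact: (ext_jordan_counitl _ _ _ (e0 _) (fun=> e0 _)).
Qed.

Lemma jordanian_twist_counitr :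
  ser_map (tens_mor (counit_algC' (@env_counit K (sl K N)))) F = 1.
Proof.
have e0 (x : sl K N) := env_counit_inj x.
by rewrite jordanian_twistE; exact: (ext_jordan_counitr _ _ _ (e0 _) (fun=> e0 _)).
Qed.

(** The sense in which the twisted coproduct is a deformation: modulo xi it is the standard one,
    since F is 1 modulo xi. *)
Lemma twisted_coprod_coef0 x : twisted_coprod (ser_map D) F x 0%N = D (x 0%N).
Proof.
have FV0 : F^-1 0%N = 1.
  have := congr1 (fun u : {series A \ox A} => u 0%N) (mulVr jordanian_twist_unit).
  by rewrite ser_coef0M jordanian_twist_coef0 mulr1.
by rewrite /twisted_coprod !ser_coef0M jordanian_twist_coef0 FV0 mul1r mulr1.
Qed.

Lemma twisted_sl_hopf : hopf_algebra (twisted_coprod (ser_map D) F)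
  (ser_map (@env_counit K (sl K N))).
Proof.
exact: (twist_hopf_algebra jordanian_twist_unit jordanian_twistP
  (@env_antipode1 K _) (@env_antipodeM K _) (@env_coprodA K _) (@env_counitl K _)
  (@env_counitr K _) jordanian_twist_counitl jordanian_twist_counitr
  (@env_antipodel K _) (@env_antipoder K _)).
Qed.

Lemma twisted_sl_triangular :
  triangular (twisted_coprod (ser_map D) F) (leg21 F * F^-1).
Proof. exact: (twist_triangular jordanian_twist_unit jordanian_twistP (@env_coprod_flip K _)). Qed.

End Main.

Theorem mainTheorem2 (R : realType) (N : nat) (hN : (2 <= N)%N) :
  let U : algType R[i] := envalg (sl R[i] N) in
  let Delta : {series U} -> {series U \ox U} :=
    ser_map (@env_coprod R[i] (sl R[i] N)) in
  let eps : {series U} -> {series R[i]^o} :=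
    ser_map (@env_counit R[i] (sl R[i] N)) in
  let F : {series U \ox U} := jordanian_twist R[i] N in
  let DeltaF : {series U} -> {series U \ox U} := twisted_coprod Delta F in
  [/\ twist_equation Delta F,
      F \is a GRing.unit,
      forall x : {series U}, DeltaF x 0%N = env_coprod (x 0%N),
      hopf_algebra DeltaF eps &
      triangular DeltaF (leg21 F * F^-1)].
Proof.
have char0 : [pchar R[i]] =i pred0 by exact: Num.Theory.pchar_num.
move=> U Delta eps F DeltaF; split.
- rewrite /twist_equation coprod_id_untwisted id_coprod_untwisted leg12E leg23E.
  exact: (jordanian_twistP char0 hN).
- exact: jordanian_twist_unit char0.
- exact: twisted_coprod_coef0 char0.
- exact: twisted_sl_hopf char0 hN.
- exact: twisted_sl_triangular char0 hN.
Qed.
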